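(* For $\lambda\in(0,+\infty)$ define $$\mathbf{c}(\lambda)=\frac{\lambda\,\mathrm{Li}_2(1-\lambda)}{1-\lambda}\cdot\frac{1}{\zeta(2)^{1/3}(\zeta(3)-\mathrm{Li}_3(1-\lambda))^{2/3}},$$ $$\mathbf{e}(\lambda)=3\left(\frac{\zeta(3)-\mathrm{Li}_3(1-\lambda)}{\zeta(2)}\right)^{1/3}-\frac{\lambda\ln(\lambda)\,\mathrm{Li}_2(1-\lambda)}{1-\lambda}\cdot\frac{1}{\zeta(2)^{1/3}(\zeta(3)-\mathrm{Li}_3(1-\lambda))^{2/3}}$$ (at $\lambda=1$, $\mathrm{Li}_2(1-\lambda)/(1-\lambda)$ is understood as its limit $1$). Let $p_J(n;k)$ denote the number of convex chains on $\mathbb{Z}_+^2$ issuing from $(0,0)$ with $k$ vertices and Euclidean length between $n$ and $n+1$. Let $\lambda\in(0,+\infty)$ and let $n\to+\infty$, $k=k(n)$ with $$\frac{k}{n^{2/3}}\longrightarrow\frac{\pi^{1/3}}{2}\,\mathbf{c}(\lambda).$$ Then $$\frac{1}{n^{2/3}}\log p_J(n;k)\longrightarrow\frac{\pi^{1/3}}{2}\,\mathbf{e}(\lambda).$$ Moreover, the Hausdorff distance between a uniformly random element of this set of chains, rescaled by the factor $\frac{\pi}{2n}$, and the arc of circle $\{(x,y)\in[0,1]^2:x^2+(y-1)^2=1\}$ converges to $0$ in probability.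
   Context: A convex chain on $\mathbb{Z}_+^2$ issuing from $(0,0)$ is a finite planar polygonal chain starting at $(0,0)$ (with free endpoint), with vertices in $\mathbb{Z}^2$, whose successive edges have strictly increasing slopes in $[0,+\infty]$ (each edge makes an angle in $[0,\pi/2]$ with the horizontal axis). Its number of vertices is counted as its number of edges (the starting point is not counted), and its length is the sum of the Euclidean lengths of its edges. $\mathrm{Li}_s$ is the polylogarithm: $\mathrm{Li}_s(z)=\sum_{r\ge1}z^r/r^s$ for $|z|<1$, continued by $\mathrm{Li}_s(z)=\frac{1}{\Gamma(s)}\int_0^\infty\frac{z\,t^{s-1}}{e^t-z}\,dt$ for $\Re(s)>0$, $z\in\mathbb{C}\setminus[1,+\infty)$. $\zeta$ is the Riemann zeta function. *)

(* Defs.v *)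
From mathcomp Require Import all_boot all_order all_algebra finmap.
From mathcomp Require Import all_classical all_reals all_analysis.

Set Implicit Arguments.
Unset Strict Implicit.
Unset Printing Implicit Defensive.

Import Order.TTheory GRing.Theory Num.Theory.
Import numFieldNormedType.Exports.

Local Open Scope classical_set_scope.
Local Open Scope ring_scope.

(* Riemann zeta function at an integer s >= 2. *)
Definition zeta {R : realType} (s : nat) : R :=
  limn (fun N => \sum_(1 <= r < N) (r%:R ^- s : R)).

(* Polylogarithm of integer order s >= 1 at a real z < 1: the power series
   inside the unit disc, continued outside it by
   1 / Gamma(s) * int_0^oo z t^(s-1) / (e^t - z) dt, where Gamma(s) = (s-1)!. *)
Definition Li {R : realType} (s : nat) (z : R) : R :=
  if `|z| < 1 then limn (fun N => \sum_(1 <= r < N) (z ^+ r / r%:R ^+ s))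
  else (s.-1)`!%:R^-1 *
    \int[lebesgue_measure]_(t in `]0, +oo[) (z * t ^+ s.-1 / (expR t - z)).

(* Li_2(1 - l) / (1 - l), extended by its limit 1 at l = 1. *)
Definition Li2_ratio {R : realType} (l : R) : R :=
  if l == 1 then 1 else Li 2 (1 - l) / (1 - l).

Definition c_param {R : realType} (l : R) : R :=
  l * Li2_ratio l
  * (zeta 2 `^ (1 / 3) * (zeta 3 - Li 3 (1 - l)) `^ (2 / 3))^-1.

Definition e_entropy {R : realType} (l : R) : R :=
  3 * ((zeta 3 - Li 3 (1 - l)) / zeta 2) `^ (1 / 3)
  - l * ln l * Li2_ratio l
    * (zeta 2 `^ (1 / 3) * (zeta 3 - Li 3 (1 - l)) `^ (2 / 3))^-1.

(* A chain issuing from (0,0) is given by the sequence of its vertices, the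
   starting point excluded; the size of the sequence is the number of edges. *)
Definition edges (s : seq (int * int)) : seq (int * int) :=
  pairmap (fun p q => q - p) 0 s.

Definition slope (e : int * int) : \bar rat :=
  if e.1 == 0 then +oo%E else (e.2%:Q / e.1%:Q)%:E.

Definition quadrant_edge (e : int * int) : bool :=
  [&& e != 0, 0 <= e.1 & 0 <= e.2].

Definition convex_chain (s : seq (int * int)) : bool :=
  all quadrant_edge (edges s)
  && sorted (fun e f => (slope e < slope f)%O) (edges s).

Definition norm2 {R : realType} (p : R * R) : R :=
  Num.sqrt (p.1 ^+ 2 + p.2 ^+ 2).

Definition to_plane {R : realType} (p : int * int) : R * R :=
  (p.1%:~R, p.2%:~R).

Definition chain_length {R : realType} (s : seq (int * int)) : R :=
  \sum_(e <- edges s) norm2 (to_plane e).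

Definition chains (R : realType) (n k : nat) : set (seq (int * int)) :=
  [set s | [/\ convex_chain s, size s = k &
    n%:R <= chain_length s :> R /\ chain_length s <= n.+1%:R :> R]].

Lemma finite_chains (R : realType) (n k : nat) : finite_set (chains R n k).
Proof.
pose B : finType := ('I_n.+2 * 'I_n.+2)%type.
pose f (t : k.-tuple B) : seq (int * int) :=
  scanl +%R 0 [seq ((p.1 : nat)%:Z, (p.2 : nat)%:Z) | p : B <- t].
apply: (@sub_finite_set _ _ (f @` setT)); last exact/finite_image/finite_finset.
move=> s [/andP[q _] sk [_ len]].
have ge0 (e : int * int) : 0 <= norm2 (to_plane e : R * R) by exact: sqrtr_ge0.
have bnd e : e \in edges s -> [/\ 0 <= e.1, 0 <= e.2, (`|e.1| < n.+2)%N
    & (`|e.2| < n.+2)%N].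
  move=> es; have /and3P[_ e1 e2] := allP q _ es.
  have le : norm2 (to_plane e : R * R) <= n.+1%:R.
    apply: le_trans len; rewrite /chain_length (big_rem e es)/= lerDl.
    by apply: sumr_ge0 => *; exact: ge0.
  have aux (x : int) : 0 <= x -> (x%:~R : R) <= n.+1%:R -> (`|x| < n.+2)%N.
    by case: x => // m _; rewrite -pmulrn ler_nat.
  split=> //; apply: aux => //; apply: le_trans le.
    rewrite /norm2 -[leLHS]ger0_norm ?ler0z// -sqrtr_sqr ler_wsqrtr//.
    by rewrite lerDl sqr_ge0.
  rewrite /norm2 -[leLHS]ger0_norm ?ler0z// -sqrtr_sqr ler_wsqrtr//.
  by rewrite lerDr sqr_ge0.
pose g (e : int * int) : B := (inord `|e.1|, inord `|e.2|).
have sz : size (map g (edges s)) == k by rewrite size_map size_pairmap sk.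
exists (Tuple sz) => //; rewrite /f /= -map_comp.
rewrite (_ : map _ _ = edges s); last first.
  rewrite -[RHS]map_id; apply/eq_in_map => -[a b] /bnd /= [a0 b0 a1 b1].
  by rewrite !inordK// !gez0_abs.
by rewrite /edges (@pairmapK _ _ (fun p q => q - p) +%R)// => x y; rewrite addrC subrK.
Qed.

Definition pJ (R : realType) (n k : nat) : nat := #|` fset_set (chains R n k)|.

(* Probability of the event E under the uniform law on the finite set A. *)
Definition uniform_pr {R : realType} {T : choiceType} (A E : set T) : R :=
  #|` fset_set (A `&` E)|%:R / #|` fset_set A|%:R.

Definition segment {R : realType} (p q : R * R) : set (R * R) :=
  [set ((1 - t) * p.1 + t * q.1, (1 - t) * p.2 + t * q.2) | t in `[0, 1]].

Fixpoint polyline {R : realType} (p : R * R) (s : seq (R * R)) : set (R * R) :=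
  if s is q :: s' then segment p q `|` polyline q s' else [set p].

Definition chain_curve {R : realType} (s : seq (int * int)) : set (R * R) :=
  polyline (0, 0) (map to_plane s).

Definition rescale {R : realType} (a : R) (A : set (R * R)) : set (R * R) :=
  [set (a * p.1, a * p.2) | p in A].

Definition hausdorff_dist {R : realType} (A B : set (R * R)) : \bar R :=
  let d (C D : set (R * R)) :=
    ereal_sup [set ereal_inf [set (norm2 (p - q))%:E | q in D] | p in C] in
  maxe (d A B) (d B A).

Definition circle_arc {R : realType} : set (R * R) :=
  [set p | [/\ 0 <= p.1 <= 1, 0 <= p.2 <= 1 & p.1 ^+ 2 + (p.2 - 1) ^+ 2 = 1]].

(* Main.v *)
Require Import Defs.
From mathcomp Require Import all_boot all_order all_algebra finmap.
From mathcomp Require Import all_classical all_reals all_analysis.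
From mathcomp Require Import measurable_realfun ring lra zify.

(* A convex chain is determined by the multiset of its edges, hence by a finitely
   supported function om on primitive vectors: its edges are the om(v) v. Give om
   the weight prod_v (l exp(-b om(v) |v|)), the product being over the support of om.
   Counting primitive vectors in sectors shows that for b = b' / n^(1/3) the
   logarithm of the partition function is asymptotic to n^(2/3) times
   (pi / (2 zeta(2))) (zeta(3) - Li_3(1 - l)) / b'^2. At the critical b' = b0 the
   typical om has length n and (pi^(1/3) / 2) c(l) n^(2/3) edges, so that dividing
   the partition function by the common weight of these om gives the entropy.
   The upper bound is Chernoff's. For the lower bound b0 is increased slightly, and
   the typical om, now a little too short, is completed to k edges and length in
   [n, n + 1] by short edges of multiplicity 1 and a single horizontal edge.
   Decreasing b in one sector shows that a sector of angle pi / (2 J) carries more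
   than (1/J + d) n of the length only with exponentially small probability. Hence
   the length is nearly uniformly distributed among directions, which characterizes
   the circle. *)

Set Implicit Arguments.
Unset Strict Implicit.
Unset Printing Implicit Defensive.

Import Order.TTheory GRing.Theory Num.Theory.
Import numFieldNormedType.Exports.

Local Open Scope classical_set_scope.
Local Open Scope ring_scope.

(** * Polylogarithms as integrals *)

(** Write X(l, b) n^(2/3) for the asymptotic logarithm of the partition function. The mean length is
    minus its derivative in [b], the mean number of edges is [l] times its derivative in [l]; [b0]
    is the [b] that makes the first equal to n, and the second at [b0] gives c(l). The obstacle to
    the lower bound is exactness: the number of edges must be k and the length must fall in a window
    of width 1, whereas exponential bounds locate both only up to a small fraction of their means.
    The completion takes the place of a local limit theorem. Replacing [b0] by (1 + eta) [b0]
    divides the typical length by (1 + eta)^3 and the typical number of edges by (1 + eta)^2, so at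
    most 3 eta k edges are missing and a length of order eta n is free. The added edges have norm at
    most 2 x0 n^(1/3) / b, hence fit in that length if x0 is small. Their directions come from a set
    of about x0^2 n^(2/3) vectors, up to a constant, and recording which ones are used costs a
    factor 2 per vector. So x0 is fixed first, and eta is then taken so small that enough of these
    vectors have multiplicity 0. *)

Section Integrals.
Context {R : realType}.
Implicit Types (f F g : R -> R) (a t z l : R).
Local Notation mu := (@lebesgue_measure R).

(** Nonnegativity gives the extended-real integral a value before integrability is known, and
    finiteness of this value is the integrability. The closed-form integrals below are obtained in
    this way from an explicit primitive that vanishes at infinity. *)
Lemma improper_FTC f F a :
  (forall x, a <= x -> is_derive x 1 F (f x)) ->
  (forall x, a <= x -> 0 <= f x) ->
  (forall x, a <= x -> {for x, continuous f}) ->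
  F x @[x --> +oo] --> (0 : R) ->
  mu.-integrable `]a, +oo[ (EFin \o f) /\
  \int[mu]_(x in `]a, +oo[) f x = - F a.
Proof.
move=> dF f0 cf F0.
have cF x : a <= x -> {for x, continuous F}.
  by move=> ax; apply/differentiable_continuous/derivable1_diffP; case: (dF _ ax).
have mf : measurable_fun `]a, +oo[ f.
  apply: open_continuous_measurable_fun => // x; rewrite inE/= in_itv/= andbT => ax.
  exact/cf/ltW.
have wcf : {within `[a, +oo[, continuous f}.
  apply: continuous_in_subspaceT => x; rewrite inE/= in_itv/= andbT => ax.
  exact: cf.
have Fa : F x @[x --> a^'+] --> F a by apply: cvg_at_right_filter; exact: cF.
have dF1 x : a < x -> derivable F x 1 by move=> /ltW /dF [].
have dF2 : {in `]a, +oo[, F^`()%classic =1 f}.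
  move=> x; rewrite in_itv/= andbT => /ltW /dF ?.
  by rewrite derive1E derive_val.
have E := ge0_continuous_FTC2y f0 wcf F0 dF1 Fa dF2.
have icc : mu.-integrable `[a, +oo[ (EFin \o f).
  apply/integrableP; split.
    by apply/measurable_EFinP; exact: (subspace_continuous_measurable_fun _ wcf).
  under eq_integral do rewrite /= -/(abse _).
  rewrite (_ : (\int[mu]_(x in _) _)%E = (\int[mu]_(x in `[a, +oo[) (f x)%:E)%E).
    by rewrite E ltry.
  apply: eq_integral => x; rewrite inE/= in_itv/= andbT => ax.
  by rewrite ger0_norm// f0.
have ioc : mu.-integrable `]a, +oo[ (EFin \o f).
  by apply: integrableS icc => //; apply: subset_itvr; rewrite bnd_simp.
split => //; rewrite Rintegral_itv_obnd_cbnd// /Rintegral E/=.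
by rewrite add0r.
Qed.

Lemma expR_ge_xn (n : nat) (x : R) : 0 <= x -> x ^+ n / (n`!)%:R <= expR x.
Proof.
case: n => [|n] x0; first by rewrite expr0 fact0 divr1 -expR0 ler_expR.
by apply: le_trans (expR_ge1Dxn n x0); rewrite lerDr.
Qed.

Lemma cvgy_0_le (u : R -> R) (K : R) :
  (forall t, 1 <= t -> `|u t| <= K / t) -> u t @[t --> +oo] --> (0 : R).
Proof.
move=> uK; apply/cvgr0Pnorm_lt => e e0; near=> t.
have t1 : 1 <= t by near: t; apply: nbhs_pinfty_ge; rewrite num_real.
have t0 : 0 < t by lra.
apply: le_lt_trans (uK _ t1) _.
rewrite ltr_pdivrMr// mulrC -ltr_pdivrMr//.
by near: t; apply: nbhs_pinfty_gt; rewrite num_real.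
Unshelve. all: end_near. Qed.

Lemma expRN_le (n : nat) (x : R) : 0 < x -> expR (- x) <= (n`!)%:R / x ^+ n.
Proof.
move=> x0; rewrite expRN -[leRHS]invf_div lef_pV2 ?posrE ?expR_gt0//.
- exact/expR_ge_xn/ltW.
- by rewrite divr_gt0// ?exprn_gt0// ltr0n fact_gt0.
Qed.

Lemma integral_xexpN (c : R) : 0 < c ->
  mu.-integrable `]0, +oo[ (EFin \o (fun t => t * expR (- (c * t)))) /\
  \int[mu]_(t in `]0, +oo[) (t * expR (- (c * t))) = (c ^+ 2)^-1.
Proof.
move=> c0.
pose F t := - ((t / c + (c ^+ 2)^-1) * expR (- (c * t))).
rewrite (_ : (c ^+ 2)^-1 = - F 0); last first.
  by rewrite /F !(mul0r, mulr0, oppr0, expR0, add0r, mulr1) opprK.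
apply: improper_FTC => [x _|x x0|x _|].
- apply: is_derive_eq; rewrite /GRing.scale/=.
  by field; lra.
- by rewrite mulr_ge0 ?expR_ge0.
- apply: differentiable_continuous; apply/derivable1_diffP.
  exact: ex_derive.
- apply: (@cvgy_0_le _ (2 / c ^+ 3 + 2 / c ^+ 4)) => t t1.
  have t0 : 0 < t by lra.
  have ct0 : 0 < c * t by rewrite mulr_gt0.
  have c20 : 0 < (c ^+ 2)^-1 by rewrite invr_gt0 exprn_gt0.
  rewrite /F normrN ger0_norm; last first.
    by rewrite mulr_ge0 ?expR_ge0// addr_ge0 ?divr_ge0 ?ltW.
  apply: (le_trans (ler_wpM2l _ (expRN_le 2 ct0))).
    by rewrite addr_ge0 ?divr_ge0 ?ltW.
  rewrite [leLHS](_ : _ = (2 / c ^+ 3 + 2 / c ^+ 4 / t) / t); last first.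
    by rewrite (_ : 2`!%:R = 2 :> R)//; field; lra.
  rewrite ler_pM2r ?invr_gt0// lerD2l ler_pdivrMr// ler_peMr//.
  by rewrite divr_ge0 ?exprn_ge0 ?ltW.
Qed.

Lemma integral_x2expN (c : R) : 0 < c ->
  mu.-integrable `]0, +oo[ (EFin \o (fun t => t ^+ 2 * expR (- (c * t)))) /\
  \int[mu]_(t in `]0, +oo[) (t ^+ 2 * expR (- (c * t))) = 2 / c ^+ 3.
Proof.
move=> c0.
pose F t := - ((t ^+ 2 / c + 2 * t / c ^+ 2 + 2 / c ^+ 3) * expR (- (c * t))).
rewrite (_ : 2 / c ^+ 3 = - F 0); last first.
  by rewrite /F !(expr0n, mul0r, mulr0, oppr0, expR0, add0r, mulr1) opprK.
apply: improper_FTC => [x _|x x0|x _|].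
- apply: is_derive_eq; rewrite /GRing.scale/=.
  by field; lra.
- by rewrite mulr_ge0 ?expR_ge0 ?exprn_ge0.
- apply: differentiable_continuous; apply/derivable1_diffP.
  exact: ex_derive.
- apply: (@cvgy_0_le _ (6 / c ^+ 4 + 12 / c ^+ 5 + 12 / c ^+ 6)) => t t1.
  have t0 : 0 < t by lra.
  have ct0 : 0 < c * t by rewrite mulr_gt0.
  have cn n : 0 < (c ^+ n)^-1 by rewrite invr_gt0 exprn_gt0.
  have ge0 : 0 <= t ^+ 2 / c + 2 * t / c ^+ 2 + 2 / c ^+ 3.
    by rewrite !addr_ge0// ?divr_ge0 ?mulr_ge0 ?exprn_ge0 ?ltW.
  rewrite /F normrN ger0_norm ?mulr_ge0 ?expR_ge0//.
  apply: (le_trans (ler_wpM2l ge0 (expRN_le 3 ct0))).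
  rewrite [leLHS](_ : _ = (6 / c ^+ 4 + 12 / c ^+ 5 / t + 12 / c ^+ 6 / t ^+ 2) / t); last first.
    by rewrite (_ : 3`!%:R = 6 :> R)//; field; lra.
  have h : 12 / c ^+ 5 / t <= 12 / c ^+ 5 :> R.
    by rewrite ler_pdivrMr// ler_peMr// divr_ge0 ?exprn_ge0 ?ltW.
  have h' : 12 / c ^+ 6 / t ^+ 2 <= 12 / c ^+ 6 :> R.
    rewrite ler_pdivrMr ?exprn_gt0// ler_peMr// ?exprn_ege1//.
    by rewrite divr_ge0 ?exprn_ge0 ?ltW.
  by rewrite ler_pM2r ?invr_gt0// !lerD.
Qed.

Lemma expRB_gt0 z t : z <= 1 -> 0 < t -> 0 < expR t - z.
Proof. by move=> z1 t0; have := expR_gt1Dx (lt0r_neq0 t0); lra. Qed.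

Lemma expRB1_ge t : 0 <= t -> t / 2 * expR (t / 2) <= expR t - 1.
Proof.
have -> : expR t = expR (t / 2) * expR (t / 2).
  by rewrite -expRD; congr expR; field.
move=> t0; have := expR_ge1Dx (t / 2); have := expR_gt0 (t / 2).
set e := expR _ => e0 h; nra.
Qed.

(** The bound keeps both the singularity 1 / t at 0, which a factor [t ^+ k] with k > 0 absorbs, and
    an exponential decay at infinity. *)
Lemma invr_expRB1_le t : 0 < t -> (expR t - 1)^-1 <= 2 / t * expR (- (t / 2)).
Proof.
move=> t0; rewrite expRN -[2 / t]invf_div -invfM lef_pV2 ?posrE.
- exact/expRB1_ge/ltW.
- exact: expRB_gt0.
- by rewrite mulr_gt0 ?expR_gt0 ?divr_gt0.
Qed.

Lemma expRB_ge z t : z < 1 -> 0 <= t -> Num.min 1 (1 - z) * expR t <= expR t - z.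
Proof.
move=> z1 t0; have := expR_ge1Dx t; case: (leP 1 (1 - z)) => h et; nra.
Qed.

Lemma minr1_gt0 z : z < 1 -> 0 < Num.min 1 (1 - z).
Proof. by move=> z1; rewrite lt_min; lra. Qed.

Lemma measurable_on_gt0 f :
  (forall t, 0 < t -> {for t, continuous f}) -> measurable_fun (`]0, +oo[%classic : set R) f.
Proof.
move=> cf; apply: open_continuous_measurable_fun => // x.
by rewrite inE/= in_itv/= andbT; exact: cf.
Qed.

Lemma Rintegral_dominated (f_ : nat -> R -> R) f g :
  (forall n, measurable_fun (`]0, +oo[%classic : set R) (f_ n)) ->
  measurable_fun (`]0, +oo[%classic : set R) f ->
  (forall t, 0 < t -> f_ n t @[n --> \oo] --> f t) ->
  mu.-integrable `]0, +oo[ (EFin \o g) ->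
  (forall n t, 0 < t -> `|f_ n t| <= g t) ->
  mu.-integrable `]0, +oo[ (EFin \o f) /\
  \int[mu]_(t in `]0, +oo[) f_ n t @[n --> \oo] -->
    \int[mu]_(t in `]0, +oo[) f t.
Proof.
move=> mf_ mf cvf ig fg.
have D0 (t : R) : t \in (`]0, +oo[%classic : set R) -> 0 < t.
  by rewrite inE/= in_itv/= andbT.
have [//| | | |//| |i1 _ i2] := @dominated_convergence _ _ R mu `]0, +oo[%classic _
  (fun n t => (f_ n t)%:E) (EFin \o f) (EFin \o g).
- by move=> n; apply/measurable_EFinP; exact: mf_.
- by apply/measurable_EFinP.
- apply: aeW => t /mem_set/D0 t0; apply: cvg_EFin; first exact: nearW.
  exact: cvf.
- by apply: aeW => t n /mem_set/D0 t0; rewrite lee_fin fg.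
split=> //; rewrite /Rintegral; apply: fine_cvg.
rewrite fineK//; exact: integrable_fin_num.
Qed.

Lemma gamma_integral (k : nat) (c : R) : (0 < k < 3)%N -> 0 < c ->
  mu.-integrable `]0, +oo[ (EFin \o (fun t => t ^+ k * expR (- (c * t)))) /\
  \int[mu]_(t in `]0, +oo[) (t ^+ k * expR (- (c * t))) = k`!%:R / c ^+ k.+1.
Proof.
case: k => [//|[|[|//]]] _ c0; last exact: integral_x2expN.
have -> : (fun t : R => t ^+ 1 * expR (- (c * t))) = (fun t => t * expR (- (c * t))).
  by apply/funext => t; rewrite expr1.
by rewrite div1r; exact: integral_xexpN.
Qed.

Lemma integrable_xk_invr (k : nat) : (0 < k < 3)%N ->
  mu.-integrable `]0, +oo[ (EFin \o (fun t => t ^+ k / (expR t - 1))).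
Proof.
move=> k03.
have mf : measurable_fun (`]0, +oo[%classic : set R) (fun t : R => t ^+ k / (expR t - 1)).
  apply: measurable_on_gt0 => t t0; apply: differentiable_continuous.
  apply/derivable1_diffP; apply: derivableM; first exact: exprn_derivable.
  apply: derivableV; last exact: ex_derive.
  by rewrite gt_eqF// expRB_gt0.
have b t : 0 < t -> 0 <= t ^+ k / (expR t - 1) <= 2 * (t ^+ k.-1 * expR (- (2^-1 * t))).
  move=> t0; have t1 := ltW t0; apply/andP; split.
    by rewrite divr_ge0 ?exprn_ge0// ltW// expRB_gt0.
  have -> : t ^+ k / (expR t - 1) = t ^+ k.-1 * (t / (expR t - 1)).
    by rewrite mulrA -exprSr prednK//; case/andP: k03.
  rewrite (mulrCA 2) ler_wpM2l ?exprn_ge0//.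
  rewrite -ler_pdivlMl// mulrA (mulrC _ 2) (mulrC 2^-1).
  exact: invr_expRB1_le.
have h2 : 0 < 2^-1 :> R by lra.
have [g gi bg] : exists2 g : R -> R, mu.-integrable `]0, +oo[ (EFin \o g) &
    forall t, 0 < t -> 2 * (t ^+ k.-1 * expR (- (2^-1 * t))) <= g t.
  case: k k03 {mf b} => [//|[|[|//]]] _ /=.
    exists (fun t => 2 * expR (- (2^-1 * t))); last first.
      by move=> t _; rewrite expr0 mul1r.
    have [x _|x x0|x _| |i1 _ //] := @improper_FTC (fun t => 2 * expR (- (2^-1 * t)))
      (fun t => - 4 * expR (- (2^-1 * t))) 0.
    - by apply: is_derive_eq; rewrite /GRing.scale/=; field.
    - by rewrite mulr_ge0 ?expR_ge0.
    - by apply: differentiable_continuous; apply/derivable1_diffP; exact: ex_derive.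
    - apply: (@cvgy_0_le _ 8) => t t1; have t0 : 0 < t by lra.
      rewrite normrM normrN (ger0_norm (expR_ge0 _)) ger0_norm//.
      have h : expR (- (2^-1 * t)) <= 2 / t.
        have -> : 2 / t = 1`!%:R / (2^-1 * t) ^+ 1 by rewrite (_ : 1`!%:R = 1 :> R)//; field; lra.
        by apply: expRN_le; rewrite mulr_gt0.
      by apply: le_trans (ler_wpM2l _ h) _ => //; rewrite mulrA; lra.
  exists (fun t => 2 * (t * expR (- (2^-1 * t)))); last first.
    by move=> t _; rewrite expr1.
  rewrite (_ : EFin \o _ = fun t => (2%:E * (t * expR (- (2^-1 * t)))%:E)%E)//.
  by apply: integrableZl => //; case: (integral_xexpN h2).
apply: (le_integrable _ _ _ gi) => //; first by apply/measurable_EFinP.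
move=> t /=; rewrite in_itv/= andbT => t0; have /andP[b0 b1] := b _ t0.
by rewrite lee_fin ger0_norm// (le_trans b1)// (le_trans (bg _ t0))// ler_norm.
Qed.

Lemma cvg_geometric_from1 (x : R) : `|x| < 1 ->
  (fun N => \sum_(1 <= r < N) x ^+ r) @ \oo --> x / (1 - x).
Proof.
move=> x1; have x1' : 1 - x != 0 by rewrite subr_eq0 eq_sym; apply: contraTneq x1 => ->; rewrite normr1 ltxx.
have -> : x / (1 - x) = 1 / (1 - x) - 1 by field.
rewrite -(cvg_shiftS (fun N => \sum_(1 <= r < N) x ^+ r)).
have -> : [sequence \sum_(1 <= r < n.+1) x ^+ r]_n = (fun n => series (geometric 1 x) n.+1 - 1).
  apply/funext => n /=; rewrite /series/= (big_nat_recl n 0)//= expr0 mul1r addrC addKr.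
  by rewrite big_add1/=; apply: eq_bigr => i _; rewrite mul1r.
apply: cvgB; last exact: cvg_cst.
by rewrite (cvg_shiftS (series (geometric 1 x))); exact: cvg_geometric_series.
Qed.

Lemma sum_pow_le (x : R) N : 0 <= x < 1 -> \sum_(1 <= r < N) x ^+ r <= x / (1 - x).
Proof.
move=> /andP[x0 x1]; have nx : `|x| < 1 by rewrite ger0_norm.
rewrite -(cvg_lim _ (cvg_geometric_from1 nx))//.
apply: nondecreasing_cvgn_le; last exact: cvgP (cvg_geometric_from1 nx).
apply/nondecreasing_seqP => -[|n]; first by rewrite !big_geq.
by rewrite [leRHS]big_nat_recr//= lerDl exprn_ge0.
Qed.

(** Expand z / (e^t - z) as the geometric series of z e^(-t) and integrate termwise. Since |z| <= 1,
    all partial sums are dominated by the case z = 1, namely t^k / (e^t - 1). The value z = 1 is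
    included, so that the same statement yields zeta. *)
Lemma polylog_series_integral (k : nat) (z : R) : (0 < k < 3)%N -> `|z| <= 1 ->
  (fun N => \sum_(1 <= r < N) (z ^+ r / r%:R ^+ k.+1)) @ \oo -->
    k`!%:R^-1 * \int[mu]_(t in `]0, +oo[) (z * t ^+ k / (expR t - z)).
Proof.
move=> k03 z1.
pose f_ (N : nat) (t : R) := t ^+ k * \sum_(1 <= r < N) (z * expR (- t)) ^+ r.
have f_E N t : f_ N t = \sum_(1 <= r < N) (z ^+ r * (t ^+ k * expR (- (r%:R * t)))).
  rewrite /f_ big_distrr/=; apply: eq_bigr => r _.
  by rewrite exprMn -expRM_natl mulrN; ring.
have xlt t : 0 < t -> 0 <= expR (- t) < 1.
  by move=> t0; rewrite expR_ge0/= -expR0 ltr_expR; lra.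
have zx t : 0 < t -> `|z * expR (- t)| < 1.
  move=> t0; rewrite normrM (ger0_norm (expR_ge0 _)).
  have /andP[? ?] := xlt _ t0; have := expR_ge0 (- t); nra.
have zle : z <= 1 by apply: le_trans z1; exact: ler_norm.
have k0 : (k`!%:R : R) != 0 by rewrite pnatr_eq0 -lt0n fact_gt0.
have [||t t0|||_] := @Rintegral_dominated f_ (fun t => z * t ^+ k / (expR t - z))
   (fun t => t ^+ k / (expR t - 1)).
- move=> N; rewrite (_ : f_ N = fun t => \sum_(1 <= r < N) (z ^+ r * (t ^+ k * expR (- (r%:R * t))))).
    apply: measurable_sum => r; apply: measurable_on_gt0 => t t0.
    apply: differentiable_continuous; apply/derivable1_diffP.
    apply: derivableM; first exact: ex_derive.
    apply: derivableM; first exact: exprn_derivable.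
    exact: ex_derive.
  by apply/funext => t; exact: f_E.
- apply: measurable_on_gt0 => t t0; apply: differentiable_continuous.
  apply/derivable1_diffP; apply: derivableM.
    apply: derivableM; first exact: ex_derive.
    exact: exprn_derivable.
  apply: derivableV; last exact: ex_derive.
  by rewrite gt_eqF// expRB_gt0.
- rewrite (_ : _ / _ = t ^+ k * ((z * expR (- t)) / (1 - z * expR (- t)))).
    by apply: cvgMr; apply: cvg_geometric_from1; exact: zx.
  have h := expRB_gt0 zle t0; rewrite expRN; field.
  by rewrite gt_eqF ?expR_gt0// gt_eqF.
- exact: integrable_xk_invr.
- move=> N t t0; rewrite /f_ normrM (ger0_norm (exprn_ge0 _ (ltW t0))).
  rewrite ler_wpM2l ?exprn_ge0 ?(ltW t0)//.
  apply: le_trans (ler_norm_sum _ _ _) _.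
  have := sum_pow_le N (xlt _ t0).
  rewrite (_ : _ / (1 - _) = (expR t - 1)^-1); last first.
    have h := expRB_gt0 (lexx 1) t0; rewrite expRN; field.
    by rewrite !gt_eqF ?expR_gt0.
  apply: le_trans; apply: ler_sum => r _.
  rewrite normrX lerXn2r ?nnegrE ?expR_ge0// normrM (ger0_norm (expR_ge0 _)).
  by rewrite ler_piMl ?expR_ge0.
move=> cv.
have E N : mu.-integrable `]0, +oo[ (EFin \o f_ N) /\
    \int[mu]_(t in `]0, +oo[) f_ N t = k`!%:R * \sum_(1 <= r < N) (z ^+ r / r%:R ^+ k.+1).
  have f_0 N' : (N' <= 1)%N -> f_ N' = fun=> 0.
    by move=> N1; apply/funext => t; rewrite /f_ big_geq// mulr0.
  have base N' : (N' <= 1)%N -> mu.-integrable `]0, +oo[ (EFin \o f_ N') /\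
    \int[mu]_(t in `]0, +oo[) f_ N' t = k`!%:R * \sum_(1 <= r < N') (z ^+ r / r%:R ^+ k.+1).
    move=> N1; rewrite f_0// big_geq// mulr0; split; first exact: integrable0.
    by rewrite Rintegral_cst// mul0r.
  elim: N => [|[|N] [iN eN]]; [exact: base|exact: base|].
  have N0 : 0 < N.+1%:R :> R by rewrite ltr0n.
  have [i1 e1] := gamma_integral k03 N0.
  have i2 : mu.-integrable `]0, +oo[
      (EFin \o (fun t => z ^+ N.+1 * (t ^+ k * expR (- (N.+1%:R * t))))).
    rewrite (_ : EFin \o _ = fun t => ((z ^+ N.+1)%:E * (t ^+ k * expR (- (N.+1%:R * t)))%:E)%E)//.
    exact: integrableZl.
  have fS : f_ N.+2 = fun t => f_ N.+1 t + z ^+ N.+1 * (t ^+ k * expR (- (N.+1%:R * t))).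
    by apply/funext => t; rewrite !f_E big_nat_recr.
  rewrite fS; split; first by have := integrableD _ iN i2; apply.
  rewrite RintegralD// eN RintegralZl// e1 (big_nat_recr N.+1)//= mulrDr; congr (_ + _).
  by ring.
rewrite (_ : (fun N => _) = fun N => k`!%:R^-1 * \int[mu]_(t in `]0, +oo[) f_ N t).
  exact: cvgMr.
by apply/funext => N; rewrite (proj2 (E N)) mulrA mulVf// mul1r.
Qed.

Lemma integrable_sub D f g : measurable D ->
  mu.-integrable D (EFin \o f) -> mu.-integrable D (EFin \o g) ->
  mu.-integrable D (EFin \o (fun t => f t - g t)).
Proof. by move=> mD fi gi; have := integrableB mD fi gi; apply. Qed.

Lemma integrable_add D f g : measurable D ->
  mu.-integrable D (EFin \o f) -> mu.-integrable D (EFin \o g) ->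
  mu.-integrable D (EFin \o (fun t => f t + g t)).
Proof. by move=> mD fi gi; have := integrableD mD fi gi; apply. Qed.

Lemma integrable_scale D (c : R) f : measurable D ->
  mu.-integrable D (EFin \o f) -> mu.-integrable D (EFin \o (fun t => c * f t)).
Proof. by move=> mD fi; have := integrableZl mD c fi; apply. Qed.

Lemma eq_integrable_gt0 f g : (forall t, 0 < t -> f t = g t) ->
  mu.-integrable `]0, +oo[ (EFin \o f) -> mu.-integrable `]0, +oo[ (EFin \o g).
Proof.
move=> fg; apply: eq_integrable => // t; rewrite inE/= in_itv/= andbT => t0.
by rewrite fg.
Qed.

Lemma eq_Rintegral_gt0 f g : (forall t, 0 < t -> f t = g t) ->
  \int[mu]_(t in `]0, +oo[) f t = \int[mu]_(t in `]0, +oo[) g t.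
Proof.
by move=> fg; apply: eq_Rintegral => t; rewrite inE/= in_itv/= andbT => /fg.
Qed.

Lemma continuous_derivable1 f t : derivable f t 1 -> {for t, continuous f}.
Proof. by move=> df; apply: differentiable_continuous; apply/derivable1_diffP. Qed.

Lemma measurable_polylog (k : nat) (z c : R) : z <= 1 ->
  measurable_fun (`]0, +oo[%classic : set R) (fun t => c * t ^+ k / (expR t - z)).
Proof.
move=> z1; apply: measurable_on_gt0 => t t0; apply: continuous_derivable1.
apply: derivableM.
  by apply: derivableM; [exact: ex_derive|exact: exprn_derivable].
apply: derivableV; last exact: ex_derive.
by rewrite gt_eqF// expRB_gt0.
Qed.

Lemma expRB_le z t : z < 1 -> 0 < t -> (expR t - z)^-1 <= (Num.min 1 (1 - z))^-1 / (expR t - 1).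
Proof.
move=> z1 t0; have m0 := minr1_gt0 z1; have e0 := expRB_gt0 (lexx 1) t0.
have ez := expRB_gt0 (ltW z1) t0.
rewrite -invfM lef_pV2 ?posrE ?mulr_gt0//.
apply: le_trans (expRB_ge z1 (ltW t0)); rewrite ler_wpM2l ?(ltW m0)//; lra.
Qed.

Lemma integrable_polylog (k : nat) (z c : R) : (0 < k < 3)%N -> z < 1 ->
  mu.-integrable `]0, +oo[ (EFin \o (fun t => c * t ^+ k / (expR t - z))).
Proof.
move=> k03 z1; have m0 := minr1_gt0 z1; set m := Num.min _ _ in m0 *.
have ig : mu.-integrable `]0, +oo[ (EFin \o (fun t => (c / m) * (t ^+ k / (expR t - 1)))).
  rewrite (_ : EFin \o _ = fun t => ((c / m)%:E * (t ^+ k / (expR t - 1))%:E)%E)//.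
  by apply: integrableZl => //; exact: integrable_xk_invr.
apply: (le_integrable _ _ _ ig) => //.
  by apply/measurable_EFinP; apply: measurable_polylog; exact: ltW.
move=> t /=; rewrite in_itv/= andbT => t0; rewrite lee_fin.
have ez := expRB_gt0 (ltW z1) t0; have e0 := expRB_gt0 (lexx 1) t0.
have tk := exprn_ge0 k (ltW t0).
rewrite !normrM !normfV !(ger0_norm tk) (gtr0_norm e0) (gtr0_norm ez) (gtr0_norm m0).
rewrite -[leRHS]mulrA (mulrCA m^-1) -!mulrA ler_wpM2l// ler_wpM2l//.
exact: expRB_le.
Qed.

(** Merges the two branches of [Li]: below -1 it is the definition, inside the unit disc it is the
    series identity. From here on no distinction between small and large [l] is made in
    [Li _ (1 - l)]. *)
Lemma Li_integral (k : nat) (z : R) : (0 < k < 3)%N -> z < 1 ->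
  Li k.+1 z = k`!%:R^-1 * \int[mu]_(t in `]0, +oo[) (z * t ^+ k / (expR t - z)).
Proof.
move=> k03 z1; rewrite /Li; case: ltP => // nz1.
by apply/cvg_lim => //; apply: polylog_series_integral => //; exact: ltW.
Qed.

Lemma cvg_zeta (k : nat) : (0 < k < 3)%N ->
  (fun N => \sum_(1 <= r < N) (r%:R ^- k.+1 : R)) @ \oo --> (zeta k.+1 : R) /\
  zeta k.+1 = k`!%:R^-1 * \int[mu]_(t in `]0, +oo[) (1 * t ^+ k / (expR t - 1)) :> R.
Proof.
move=> k03; have := @polylog_series_integral _ 1 k03; rewrite normr1 => /(_ (lexx _)).
rewrite (_ : (fun N => _) = (fun N => \sum_(1 <= r < N) (r%:R ^- k.+1 : R))); last first.
  by apply/funext => N; apply: eq_bigr => r _; rewrite expr1n div1r.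
by move=> h; split; [apply: cvgP h|apply: cvg_lim h].
Qed.

(** Minus the derivative in t of ln (1 + l / (e^t - 1)), the contribution of one primitive vector to
    the logarithm of the partition function. Its partial fractions, [boseE], are the kernels of zeta
    and of [Li _ (1 - l)]. *)
Definition bose (l t : R) : R := l * expR t / ((expR t - 1) * (expR t - (1 - l))).

Lemma boseE l t : 0 < l -> 0 < t ->
  bose l t = (expR t - 1)^-1 - (1 - l) / (expR t - (1 - l)).
Proof.
move=> l0 t0; have e0 := expRB_gt0 (lexx 1) t0.
have ez := expRB_gt0 (_ : 1 - l <= 1) t0.
by rewrite /bose; field; rewrite !gt_eqF// ez; lra.
Qed.

Lemma bose_ge0 l t : 0 < l -> 0 < t -> 0 <= bose l t.
Proof.
move=> l0 t0; rewrite /bose divr_ge0 ?mulr_ge0 ?expR_ge0 ?(ltW l0)//.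
  by rewrite ltW ?expRB_gt0.
by rewrite ltW ?expRB_gt0//; lra.
Qed.

Lemma integral_x2bose l : 0 < l ->
  mu.-integrable `]0, +oo[ (EFin \o (fun t => t ^+ 2 * bose l t)) /\
  \int[mu]_(t in `]0, +oo[) (t ^+ 2 * bose l t) = 2 * (zeta 3 - Li 3 (1 - l)).
Proof.
move=> l0; have z1 : 1 - l < 1 by lra.
have i1 : mu.-integrable `]0, +oo[ (EFin \o (fun t : R => 1 * t ^+ 2 / (expR t - 1))).
  under [X in EFin \o X]eq_fun do rewrite mul1r.
  exact: integrable_xk_invr.
have i2 := integrable_polylog (1 - l) (isT : (0 < 2 < 3)%N) z1.
have E t : 0 < t -> t ^+ 2 * bose l t =
    1 * t ^+ 2 / (expR t - 1) - (1 - l) * t ^+ 2 / (expR t - (1 - l)).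
  by move=> t0; rewrite boseE//; ring.
split.
  apply: (@eq_integrable_gt0 (fun t => 1 * t ^+ 2 / (expR t - 1)
    - (1 - l) * t ^+ 2 / (expR t - (1 - l)))) => [t t0|]; first by rewrite E.
  exact: integrable_sub.
rewrite (eq_Rintegral_gt0 E).
rewrite RintegralB// Li_integral// (proj2 (@cvg_zeta 2 isT)).
by rewrite (_ : 2`!%:R = 2 :> R)//; field.
Qed.

Lemma integrable_x_polylog z : z < 1 ->
  mu.-integrable `]0, +oo[ (EFin \o (fun t => t / (expR t - z))).
Proof.
move=> z1; apply: eq_integrable_gt0 (integrable_polylog 1 (isT : (0 < 1 < 3)%N) z1).
by move=> t _; rewrite expr1 mul1r.
Qed.

Lemma Li2_ratioE l : 0 < l ->
  Li2_ratio l = \int[mu]_(t in `]0, +oo[) (t / (expR t - (1 - l))).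
Proof.
move=> l0; rewrite /Li2_ratio; case: eqP => [->|/eqP l1].
  rewrite subrr; under eq_Rintegral do rewrite subr0 -expRN.
  have [_] := @integral_xexpN 1 ltr01; rewrite expr1n invr1 => <-.
  by under eq_Rintegral do rewrite mul1r.
have z1 : 1 - l < 1 by lra.
rewrite Li_integral//; under eq_Rintegral do rewrite expr1 -mulrA.
rewrite RintegralZl//; last exact: integrable_x_polylog.
rewrite (_ : 1`!%:R = 1 :> R)// invr1 mul1r mulrAC divff ?mul1r//.
by rewrite subr_eq0 eq_sym.
Qed.

(** The factor of t^2 is the derivative of [bose l t] in [l], so this integral is the derivative in
    [l] of 2 (zeta 3 - Li 3 (1 - l)). An integration by parts reduces it to the integral of
    [Li2_ratioE]. *)
Lemma Li2_ratio_by_parts l : 0 < l ->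
  mu.-integrable `]0, +oo[ (EFin \o (fun t => t ^+ 2 * (expR t / (expR t - (1 - l)) ^+ 2))) /\
  \int[mu]_(t in `]0, +oo[) (t ^+ 2 * (expR t / (expR t - (1 - l)) ^+ 2)) = 2 * Li2_ratio l.
Proof.
move=> l0; set z := 1 - l; have z1 : z < 1 by rewrite /z; lra.
have m0 := minr1_gt0 z1; set m := Num.min _ _ in m0.
have ez t : 0 <= t -> 0 < expR t - z by move=> t0; have := expR_ge1Dx t; lra.
pose h1 t := 2 * t / (expR t - z).
pose h2 t := t ^+ 2 * (expR t / (expR t - z) ^+ 2).
pose K := 2 / m.
(* [h2 - h1] is the derivative of - t^2 / (e^t - z) but has no constant sign. The last term, which
   dominates [h1], makes the integrand nonnegative as [improper_FTC] requires; its known integral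
   [K] is removed at the end. *)
pose f t := h2 t - h1 t + K * (t * expR (- (1 * t))).
pose F t := - (t ^+ 2 / (expR t - z)) - K * (t + 1) * expR (- (1 * t)).
have K0 : 0 < K by rewrite divr_gt0.
have h1K t : 0 <= t -> h1 t <= K * (t * expR (- (1 * t))).
  move=> t0; rewrite /h1 /K expRN mul1r.
  have := expRB_ge z1 t0; rewrite -/m => h.
  rewrite ler_pdivrMr ?ez//.
  rewrite (_ : 2 / m * (t / expR t) * _ = 2 * t * ((expR t - z) / (m * expR t))).
    by rewrite ler_peMr ?mulr_ge0// ler_pdivlMr ?mul1r// mulr_gt0 ?expR_gt0.
  by field; rewrite ?gt_eqF ?expR_gt0.
have [t t0|t t0|t t0||iF eF] := @improper_FTC f F 0.
- have e := ez _ t0; have e' : expR t - z != 0 by rewrite gt_eqF.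
  rewrite /F /f /h1 /h2; apply: is_derive_eq; rewrite /GRing.scale/=.
  by field.
- have := h1K t t0; have : 0 <= h2 t.
    by rewrite mulr_ge0 ?exprn_ge0// divr_ge0 ?expR_ge0 ?exprn_ge0 ?ltW ?ez.
  by rewrite /f; lra.
- have e' : expR t - z != 0 by rewrite gt_eqF ?ez.
  apply: continuous_derivable1; rewrite /f /h1 /h2.
  apply: derivableD; last exact: ex_derive.
  apply: derivableB.
    apply: derivableM; first exact: exprn_derivable.
    apply: derivableM; first exact: ex_derive.
    by apply: derivableV; [rewrite expf_neq0|exact: ex_derive].
  apply: derivableM; first exact: ex_derive.
  by apply: derivableV => //; exact: ex_derive.
- apply: (@cvgy_0_le _ (6 / m + K * 4)) => t t1; have t0 : 0 < t by lra.
  have e := ez _ (ltW t0).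
  apply: le_trans (ler_normB _ _) _; rewrite normrN mulrDl lerD//.
    rewrite ger0_norm; last by rewrite divr_ge0 ?exprn_ge0 ?(ltW e) ?(ltW t0).
    rewrite ler_pdivrMr//; have h := expRB_ge z1 (ltW t0); rewrite -/m in h.
    apply: le_trans (ler_wpM2l _ h); last by rewrite !divr_ge0 ?(ltW m0) ?ltW.
    have := expR_ge_xn 3 (ltW t0); rewrite (_ : 3`!%:R = 6 :> R)// => h3.
    rewrite (_ : _ * _ = 6 / t * expR t); last by field; rewrite ?gt_eqF.
    rewrite -mulrA -ler_pdivrMl// mulrC (mulrC _ (expR t)) ler_pdivlMr//.
    by rewrite (_ : _ * _ = t ^+ 3 / 6)//; field.
  rewrite ger0_norm; last by apply: mulr_ge0 (expR_ge0 _); apply: mulr_ge0 (ltW K0) _; lra.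
  rewrite -mulrA -[in leRHS]mulrA ler_wpM2l ?(ltW K0)//.
  rewrite mul1r.
  apply: le_trans (ler_wpM2l _ (expRN_le 2 t0)) _; first lra.
  rewrite (_ : 2`!%:R = 2 :> R)// ler_pdivlMr// (_ : _ * t = (2 + 2 / t)); last by field; rewrite ?gt_eqF.
  have : 2 / t <= 2 by rewrite ler_pdivrMr//; lra.
  lra.
have [i3 e3] := @integral_xexpN 1 ltr01.
have i3' : mu.-integrable `]0, +oo[ (EFin \o (fun t => K * (t * expR (- (1 * t))))).
  exact: integrable_scale.
have i1 : mu.-integrable `]0, +oo[ (EFin \o h1).
  by have := integrable_polylog 2 (isT : (0 < 1 < 3)%N) z1.
have i2 : mu.-integrable `]0, +oo[ (EFin \o h2).
  apply: (@eq_integrable_gt0 (fun t => f t - K * (t * expR (- (1 * t))) + h1 t)).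
    by move=> t _; rewrite /f; ring.
  by apply: integrable_add => //; exact: integrable_sub.
split=> //.
have : \int[mu]_(t in `]0, +oo[) f t = K.
  rewrite eF /F expr0n !mul0r oppr0 !sub0r add0r mulr1 mulr0 oppr0 expR0 mulr1 opprK.
  by [].
rewrite /f RintegralD//; last exact: integrable_sub.
rewrite RintegralB// RintegralZl// e3 expr1n invr1 mulr1 -[in RHS](add0r K) => /addIr /eqP.
rewrite subr_eq0 => /eqP ->; rewrite Li2_ratioE// -RintegralZl//; last exact: integrable_x_polylog.
by apply: eq_Rintegral => t _; rewrite /h1 mulrA.
Qed.

Lemma Li2_ratio_gt0 l : 0 < l -> 0 < Li2_ratio l.
Proof.
move=> l0; rewrite Li2_ratioE//.
have [i e] := integral_xexpN (ltr01 : 0 < 1 :> R).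
apply: (@lt_le_trans _ _ ((1 + l)^-1 * \int[mu]_(t in `]0, +oo[) (t * expR (- (1 * t))))).
  by rewrite e expr1n invr1 mulr1 invr_gt0; lra.
rewrite -RintegralZl//; apply: le_Rintegral => //.
- exact: integrable_scale.
- by apply: integrable_x_polylog; lra.
move=> t /=; rewrite in_itv/= andbT mul1r expRN => t0.
rewrite mulrCA -invfM ler_wpM2l ?(ltW t0)//.
have := expR_gt1Dx (lt0r_neq0 t0) => et.
by rewrite lef_pV2 ?posrE; nra.
Qed.

Lemma zeta3BLi3_gt0 l : 0 < l -> 0 < zeta 3 - Li 3 (1 - l) :> R.
Proof.
move=> l0; have [i2 e2] := integral_x2bose l0.
have [i e] := integral_x2expN (ltr01 : 0 < 1 :> R).
suff : 0 < 2 * (zeta 3 - Li 3 (1 - l)) :> R by lra.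
rewrite -e2.
apply: (@lt_le_trans _ _ ((l / (1 + l)) * \int[mu]_(t in `]0, +oo[) (t ^+ 2 * expR (- (1 * t))))).
  by rewrite e expr1n invr1 mulr1 mulr_gt0// divr_gt0//; lra.
rewrite -RintegralZl//; apply: le_Rintegral => //.
  exact: integrable_scale.
move=> t /=; rewrite in_itv/= andbT mul1r expRN => t0.
rewrite mulrCA ler_wpM2l ?exprn_ge0 ?(ltW t0)//.
have e1 := expRB_gt0 (lexx 1) t0; have e0 := expR_gt0 t.
have -> : l / (1 + l) / expR t = l * expR t / ((1 + l) * expR t * expR t).
  by field; rewrite !gt_eqF//; lra.
rewrite /bose ler_wpM2l ?mulr_ge0 ?(ltW l0) ?(ltW e0)//.
rewrite lef_pV2 ?posrE; [|by rewrite !mulr_gt0//; lra..].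
rewrite [leRHS]mulrC; apply: ler_pM; first lra; first lra; first lra.
by nra.
Qed.

(** For fixed t, [bose l t] is concave in [l]; its tangent bound is integrated against t^2.
    [edges_tail] perturbs [l] and needs only this one-sided bound, so nothing has to be
    differentiated under the integral sign. *)
Lemma zeta3BLi3_concave l m : 0 < l -> 0 < m ->
  zeta 3 - Li 3 (1 - m) <= zeta 3 - Li 3 (1 - l) + (m - l) * Li2_ratio l :> R.
Proof.
move=> l0 m0; have [il el] := integral_x2bose l0; have [im em] := integral_x2bose m0.
have [ib eb] := Li2_ratio_by_parts l0.
suff : 2 * (zeta 3 - Li 3 (1 - m)) <= 2 * (zeta 3 - Li 3 (1 - l)) + (m - l) * (2 * Li2_ratio l).
  by lra.
have ib' := integrable_scale (m - l) (measurable_itv _) ib.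
rewrite -em -el -eb -RintegralZl// -RintegralD//; apply: le_Rintegral => //.
  exact: integrable_add.
move=> t /=; rewrite in_itv/= andbT => t0.
have e1 := expRB_gt0 (lexx 1) t0.
have el' : 0 < expR t - (1 - l) by lra.
have em' : 0 < expR t - (1 - m) by lra.
rewrite -subr_ge0 [leRHS](_ : _ = t ^+ 2 * ((m - l) ^+ 2 * expR t) /
   ((expR t - (1 - l)) ^+ 2 * (expR t - (1 - m)))); last first.
  by rewrite /bose; field; rewrite !gt_eqF.
by rewrite divr_ge0 ?(mulr_ge0 (sqr_ge0 _))// ?(ltW em')// mulr_ge0 ?sqr_ge0 ?expR_ge0.
Qed.

Lemma integral_bose l (x : R) : 0 < l -> 0 < x ->
  mu.-integrable `]x, +oo[ (EFin \o bose l) /\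
  \int[mu]_(t in `]x, +oo[) bose l t = ln (1 + l / (expR x - 1)).
Proof.
move=> l0 x0; pose F t := ln (expR t - 1) - ln (expR t - (1 - l)).
have e1 t : x <= t -> 0 < expR t - 1 by move=> xt; apply: expRB_gt0; lra.
have e2 t : x <= t -> 0 < expR t - (1 - l) by move=> /e1; lra.
have e0 (t : R) : expR t != 0 by rewrite gt_eqF ?expR_gt0.
(* The difference of logarithms is the form to differentiate; this one shows that the limit at
   infinity is 0. *)
have FE t : x <= t -> F t = - ln (1 + l / (expR t - 1)).
  move=> xt; rewrite /F -ln_div ?posrE ?e1 ?e2// -lnV ?posrE; last first.
    by rewrite addr_gt0// divr_gt0// e1.
  congr ln; have := e1 _ xt; have := e2 _ xt => ? ?; field.
  by rewrite !gt_eqF//; lra.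
have [t t0|t t0|t t0||iF eF] := @improper_FTC (bose l) F x.
- have h1 := e1 _ t0; have h2 := e2 _ t0.
  have d a : 0 < expR t - a ->
      is_derive t 1 (fun t : R => ln (expR t - a)) (expR t / (expR t - a)).
    move=> a0; rewrite mulrC.
    have dg : is_derive t 1 (fun t : R => expR t - a) (expR t).
      by apply: is_derive_eq; rewrite subr0.
    have := @is_derive1_comp _ (@ln R) (fun t : R => expR t - a) t _ _ (is_derive1_ln a0) dg.
    by [].
  have d1 := d _ h1; have d2 := d _ h2.
  rewrite /F; apply: is_derive_eq; rewrite /bose; field.
  by rewrite !gt_eqF.
- by apply: bose_ge0 => //; lra.
- have h1 := e1 _ t0; have h2 := e2 _ t0.
  apply: continuous_derivable1; apply: derivableM; first exact: ex_derive.
  by apply: derivableV; [rewrite mulf_neq0// gt_eqF|exact: ex_derive].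
- apply: (@cvg_trans _ ((fun t => - ln (1 + l / (expR t - 1))) @ +oo)).
    apply: near_eq_cvg; near=> t; apply/esym/FE; near: t.
    by apply: nbhs_pinfty_ge; rewrite num_real.
  apply: (@cvgy_0_le _ (4 * l)) => t t1; have t0 : 0 < t by lra.
  have h1 := expRB_gt0 (lexx 1) t0.
  have h2 : 0 <= l / (expR t - 1) by rewrite divr_ge0 ?(ltW l0) ?(ltW h1).
  rewrite normrN ger0_norm; last by rewrite ln_ge0//; lra.
  apply: le_trans (le_ln1Dx _ ) _; first by lra.
  rewrite ler_pdivrMr// mulrAC ler_pdivlMr//.
  by have := expR_ge1Dx t; nra.
by split => //; rewrite eF FE// opprK.
Unshelve. all: end_near. Qed.
End Integrals.

(** * Lattice points in sectors *)

Section Counting.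
Context {R : realType}.
Implicit Types (r x y th : R) (P Q : pred (nat * nat)).

Definition nrm (v : nat * nat) : R := Num.sqrt (v.1%:R ^+ 2 + v.2%:R ^+ 2).

Lemma nrm_ge0 v : 0 <= nrm v. Proof. exact: sqrtr_ge0. Qed.

Lemma nrm_le v r : 0 <= r -> (nrm v <= r) = (v.1%:R ^+ 2 + v.2%:R ^+ 2 <= r ^+ 2).
Proof.
move=> r0; have v0 : 0 <= v.1%:R ^+ 2 + v.2%:R ^+ 2 :> R by rewrite addr_ge0 ?sqr_ge0.
by rewrite -[RHS]ler_sqrt ?sqr_ge0// sqrtr_sqr ger0_norm.
Qed.

Lemma nrm_fst v : v.1%:R <= nrm v.
Proof. by rewrite -[leLHS]ger0_norm// -sqrtr_sqr ler_wsqrtr// lerDl sqr_ge0. Qed.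

Lemma nrm_snd v : v.2%:R <= nrm v.
Proof. by rewrite -[leLHS]ger0_norm// -sqrtr_sqr ler_wsqrtr// lerDr sqr_ge0. Qed.

Lemma nrm_swap a b : nrm (a, b) = nrm (b, a).
Proof. by rewrite /nrm/= addrC. Qed.

Lemma nrmM d a b : nrm ((d * a)%N, (d * b)%N) = d%:R * nrm (a, b).
Proof.
by rewrite /nrm/= !natrM !exprMn -mulrDr sqrtrM ?sqr_ge0// sqrtr_sqr ger0_norm.
Qed.

Lemma nrm_ge1 v : v != (0, 0)%N -> 1 <= nrm v.
Proof.
case: v => [[|a] [|b]] //= _.
- by apply: le_trans (nrm_snd _); rewrite ler1n.
- by apply: le_trans (nrm_fst _); rewrite ler1n.
- by apply: le_trans (nrm_fst _); rewrite ler1n.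
Qed.

(* The box of side [N] only makes the count finite: it is used for [r < N]. *)
Definition cnt P (N : nat) r : nat :=
  (\sum_(i < N) \sum_(j < N) (P (i : nat, j : nat) && (nrm (i : nat, j : nat) <= r)%R))%N.

(** The number of points of [P] in the disc of radius r is c r^2 + o(r^2), uniformly in the box, so
    that the box may later grow with n independently of r. *)
Definition dens P (c : R) := forall e, 0 < e -> exists r0, forall r (N : nat),
  r0 <= r -> r < N%:R -> `|(cnt P N r)%:R - c * r ^+ 2| <= e * r ^+ 2.

Lemma cnt_le P Q N r :
  (forall v, nrm v <= r -> P v -> Q v) -> (cnt P N r <= cnt Q N r)%N.
Proof.
move=> PQ; apply: leq_sum => i _; apply: leq_sum => j _.
case: (leP (nrm _) r) => h; rewrite ?andbT ?andbF//.
by case: (P _) (PQ _ h) => // ->.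
Qed.

Lemma eq_cnt P Q N r : (forall v, nrm v <= r -> P v = Q v) -> cnt P N r = cnt Q N r.
Proof.
move=> PQ; apply/eqP; rewrite eqn_leq !cnt_le// => v vr.
  by rewrite PQ.
by rewrite PQ.
Qed.

Lemma cnt_swap P N r : cnt (fun v => P (v.2, v.1)) N r = cnt P N r.
Proof.
rewrite /cnt exchange_big/=; apply: eq_bigr => i _; apply: eq_bigr => j _.
by rewrite nrm_swap.
Qed.

Lemma cntID P Q N r :
  cnt P N r = (cnt (fun v => P v && Q v) N r + cnt (fun v => P v && ~~ Q v) N r)%N.
Proof.
rewrite /cnt -big_split/=; apply: eq_bigr => i _; rewrite -big_split/=.
by apply: eq_bigr => j _; case: (P _) (Q _) (nrm _ <= _) => [] [] [].
Qed.

Lemma dens_diff P Q (c d : R) : dens P c -> dens Q d -> (forall v, Q v -> P v) ->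
  dens (fun v => P v && ~~ Q v) (c - d).
Proof.
move=> Pc Qd QP e e0; have e2 : 0 < e / 2 by rewrite divr_gt0.
have [r1 h1] := Pc _ e2; have [r2 h2] := Qd _ e2; exists (Num.max r1 r2) => r N.
rewrite ge_max => /andP[r1r r2r] rN.
have := h1 _ _ r1r rN; have := h2 _ _ r2r rN.
rewrite (cntID P Q) (@eq_cnt (fun v => P v && Q v) Q); last first.
  by move=> v _; case: (Q v) (QP v) => [/(_ isT) ->//|]; rewrite andbF.
rewrite natrD !ler_norml; lra.
Qed.

Lemma eq_dens P Q (c : R) : (forall v, P v = Q v) -> dens P c -> dens Q c.
Proof.
move=> PQ Pc e /Pc[r0 h]; exists r0 => r N r0r rN.
by rewrite (@eq_cnt Q P) ?h// => v _; rewrite PQ.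
Qed.

Definition below y (N : nat) : nat := (\sum_(j < N) (j%:R < y)%R)%N.

Lemma below_le y N : 0 <= y -> (below y N)%:R <= y + 1.
Proof.
move=> y0; rewrite /below; elim: N => [|N IH]; first by rewrite big_ord0; lra.
rewrite big_ord_recr/=; case: ltP => Ny; last by rewrite addn0.
have : (\sum_(i < N) (i%:R < y)%R <= N)%N.
  rewrite -[leqRHS]card_ord -sum1_card; apply: leq_sum => i _; exact: leq_b1.
by rewrite -(ler_nat R) natrD /= => h; lra.
Qed.

Lemma below_ge y N : y <= N%:R -> y <= (below y N)%:R.
Proof.
move=> yN; suff : (N%:R <= (below y N)%:R :> R) \/ y <= (below y N)%:R.
  by case => // /(le_trans yN).
elim: {yN} N => [|N IH]; first by left.
rewrite /below big_ord_recr/= -/(below y N) natrD; case: ltP => Ny /=.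
  by case: IH => h; [left; rewrite -natr1; lra|right; lra].
by right; case: IH => h; lra.
Qed.

Lemma sum_ord_le x N : 0 <= x ->
  \sum_(i < N) (if i%:R <= x then i%:R else 0) <= (x ^+ 2 + x) / 2 :> R.
Proof.
move=> x0; set g := fun N : nat => \sum_(i < N) (if i%:R <= x then i%:R else 0) : R.
suff : g N <= N%:R * (N%:R - 1) / 2 /\ g N <= (x ^+ 2 + x) / 2 by case.
elim: N => [|N [IH1 IH2]]; first by rewrite /g big_ord0; nra.
have N0 : 0 <= N%:R :> R by [].
have -> : g N.+1 = g N + (if N%:R <= x then N%:R else 0) by rewrite /g big_ord_recr.
rewrite -(natr1 N) addrK; case: (leP N%:R x) => h; split; [nra| |nra|nra].
by have : 0 <= (x - N%:R) * (x + N%:R + 1); [apply: mulr_ge0; lra|nra].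
Qed.

Lemma sum_ord_ge x N : 0 <= x < N%:R ->
  (x ^+ 2 - x) / 2 <= \sum_(i < N) (if i%:R <= x then i%:R else 0) :> R.
Proof.
set g := fun N : nat => \sum_(i < N) (if i%:R <= x then i%:R else 0) : R.
move=> /andP[x0 xN]; have N1 : 1 <= N%:R :> R.
  by rewrite ler1n -(ltr_nat R); lra.
have h1 : 0 <= (N%:R - x) * (N%:R + x - 1) by apply: mulr_ge0; lra.
(* The invariant is an alternative: either all indices so far are counted and the sum is the
   triangular number, or the target is already reached. Since x < N at the end, [h1] turns the first
   case into the second. *)
suff : N%:R * (N%:R - 1) / 2 <= g N \/ (x ^+ 2 - x) / 2 <= g N.
  by rewrite -/(g N); case=> //; set y := g N; nra.
elim: N {xN N1 h1} => [|N IH]; first by left; rewrite /g big_ord0; nra.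
have -> : g N.+1 = g N + (if N%:R <= x then N%:R else 0) by rewrite /g big_ord_recr.
have N0 : 0 <= N%:R :> R by [].
rewrite -(natr1 N); case: (leP N%:R x) => h; case: IH => IH; try by [left; nra|right; nra].
right; rewrite addr0; apply: le_trans IH.
case: N N0 h => [|N] N0 h; first lra.
have : 1 <= N.+1%:R :> R by rewrite ler1n.
nra.
Qed.

Lemma sum_ord_le1 x N : 0 <= x ->
  \sum_(i < N) (if i%:R <= x then 1 else 0) <= x + 1 :> R.
Proof.
move=> x0; set g := fun N : nat => \sum_(i < N) (if i%:R <= x then 1 else 0) : R.
suff : g N <= N%:R /\ g N <= x + 1 by case.
elim: N => [|N [IH1 IH2]]; first by rewrite /g big_ord0; lra.
have -> : g N.+1 = g N + (if N%:R <= x then 1 else 0) by rewrite /g big_ord_recr.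
by rewrite -(natr1 N); case: (leP N%:R x) => h; split; lra.
Qed.

Lemma sin_lip x y : `|sin x - sin y| <= `|x - y|.
Proof.
wlog xy : x y / y <= x.
  move=> H; have [/H//|/ltW/H] := leP y x.
  by rewrite distrC => /le_trans -> //; rewrite distrC.
have [|c _ ->] := @MVT_segment _ (@sin R) (@cos R) _ _ xy (fun x _ => is_derive_sin x).
  by apply: continuous_subspaceT => z; exact: continuous_sin.
by rewrite normrM ler_piMl// cos_max.
Qed.

Lemma cos_lip x y : `|cos x - cos y| <= `|x - y|.
Proof.
wlog xy : x y / y <= x.
  move=> H; have [/H//|/ltW/H] := leP y x.
  by rewrite distrC => /le_trans -> //; rewrite distrC.
have [|c _ ->] := @MVT_segment _ (@cos R) (fun x => - sin x) _ _ xy (fun x _ => is_derive_cos x).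
  by apply: continuous_subspaceT => z; exact: continuous_cos.
by rewrite normrM normrN ler_piMl// sin_max.
Qed.

Lemma sin_le_id x : 0 <= x -> sin x <= x.
Proof.
move=> x0; have := sin_lip x 0; rewrite sin0 !subr0 (ger0_norm x0).
exact/le_trans/ler_norm.
Qed.

Lemma sin_ge x : 0 <= x -> x * (1 - x) <= sin x.
Proof.
move=> x0; have [|c] := @MVT_segment _ (@sin R) (@cos R) _ _ x0 (fun x _ => is_derive_sin x).
  by apply: continuous_subspaceT => z; exact: continuous_sin.
rewrite in_itv/= => /andP[c0 cx]; rewrite sin0 !subr0 => ->.
rewrite mulrC ler_wpM2r//; have := cos_lip c 0.
by rewrite cos0 subr0 (ger0_norm c0) ler_norml; lra.
Qed.

Definition sector th (v : nat * nat) : bool := v.2%:R * cos th < v.1%:R * sin th.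

Lemma cos_gt0_quadrant th : 0 <= th < pi / 2 -> 0 < cos th.
Proof. by move=> h; apply: cos_gt0_pihalf; have := pi_gt0 R; lra. Qed.

Lemma sin_ge0_quadrant th : 0 <= th <= pi / 2 -> 0 <= sin th.
Proof. by move=> h; apply: sin_ge0_pi; have := pi_gt0 R; lra. Qed.

Lemma cos_ge0_quadrant th : 0 <= th <= pi / 2 -> 0 <= cos th.
Proof. by move=> h; apply: cos_ge0_pihalf; have := pi_gt0 R; lra. Qed.

Lemma sectorE th (v : nat * nat) : 0 <= th < pi / 2 -> sector th v = (v.2%:R < v.1%:R * tan th).
Proof. by move=> /cos_gt0_quadrant h; rewrite /sector -ltr_pdivlMr// mulrA. Qed.

Lemma cos_sin_le1 th : cos th ^+ 2 + sin th ^+ 2 = 1.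
Proof. exact: cos2Dsin2. Qed.

Section Wedge.
Variables (th th' : R).
Hypotheses (h0 : 0 <= th) (h1 : th <= th') (h2 : th' < pi / 2).
Local Notation c := (cos th). Local Notation c' := (cos th').
Local Notation s := (sin th). Local Notation s' := (sin th').
Local Notation wedge := (fun v => sector th' v && ~~ sector th v).

Let c0 : 0 < c.
Proof. by move: (h0) (h1) (h2) => ? ? ?; apply: cos_gt0_quadrant; lra. Qed.
Let c0' : 0 < c'.
Proof. by move: (h0) (h1) (h2) => ? ? ?; apply: cos_gt0_quadrant; lra. Qed.
Let s0 : 0 <= s.
Proof. by move: (h0) (h1) (h2) => ? ? ?; apply: sin_ge0_quadrant; lra. Qed.
Let s0' : 0 <= s'.
Proof. by move: (h0) (h1) (h2) => ? ? ?; apply: sin_ge0_quadrant; lra. Qed.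

Lemma tan_le : tan th <= tan th'.
Proof.
move: (h0) (h1) (h2) (c0) (c0') (s0) (s0') => ? ? ? ? ? ? ?.
have : 0 <= sin (th' - th) by apply: sin_ge0_quadrant; lra.
rewrite sinB /tan => h; rewrite ler_pdivrMr// mulrAC ler_pdivlMr//; lra.
Qed.

Lemma tanB : tan th' - tan th = sin (th' - th) / (c * c').
Proof. by rewrite sinB /tan; field; rewrite !gt_eqF. Qed.

Lemma sector_mono v : sector th v -> sector th' v.
Proof.
move: (h0) (h1) (h2) (c0) (c0') (s0) (s0') => ? ? ? ? ? ? ?.
rewrite !sectorE; [|lra..] => /lt_le_trans; apply.
by rewrite ler_wpM2l// tan_le.
Qed.

(** In the wedge, a point of norm at most r has abscissa at most r cos th: the disc sector lies in a
    triangle with a vertical side. The column of abscissa i meets the triangle in at most i (tan th'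
    - tan th) + 1 lattice points. *)
Lemma wedge_le r (N : nat) : 0 <= r -> r < N%:R ->
  (cnt wedge N r)%:R <= (tan th' - tan th) * (((r * c) ^+ 2 + r * c) / 2) + (r * c + 1).
Proof.
move: (h0) (h1) (h2) (c0) (c0') (s0) (s0') => ? ? ? ? ? ? ?.
move=> r0 rN; have rc0 : 0 <= r * c by rewrite mulr_ge0// ltW.
have tt := tan_le.
apply: (@le_trans _ _ (\sum_(i < N) ((tan th' - tan th) * (if i%:R <= r * c then i%:R else 0)
   + (if i%:R <= r * c then 1 else 0)))); last first.
  rewrite big_split/= -mulr_sumr lerD ?sum_ord_le1// ler_wpM2l ?sum_ord_le//; lra.
rewrite /cnt natr_sum; apply: ler_sum => i _.
have i0 : 0 <= i%:R :> R by [].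
case: (leP i%:R (r * c)) => ic; last first.
  rewrite big1 ?mulr0 ?addr0// => j _; apply/eqP; rewrite eqb0; apply/negP.
  rewrite !sectorE /=; [|lra..] => /andP[/andP[_]]; rewrite -leNgt => tj.
  rewrite nrm_le//= => h; have : i%:R ^+ 2 <= (r * c) ^+ 2 :> R.
    rewrite exprMn -ler_pdivrMr ?exprn_gt0//; apply: le_trans h.
    have -> : i%:R ^+ 2 / c ^+ 2 = i%:R ^+ 2 + (i%:R * tan th) ^+ 2.
      rewrite /tan; have := cos_sin_le1 th => e.
      have -> : i%:R ^+ 2 + (i%:R * (s / c)) ^+ 2 = i%:R ^+ 2 * (c ^+ 2 + s ^+ 2) / c ^+ 2.
        by field; rewrite gt_eqF.
      by rewrite e mulr1.
    rewrite lerD2l lerXn2r// nnegrE// mulr_ge0//.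
    by rewrite /tan divr_ge0// ltW.
  by rewrite ler_pXn2r ?nnegrE//; lra.
have it : i%:R * tan th <= N%:R.
  apply: le_trans (_ : r * s <= _).
    rewrite /tan mulrA ler_pdivrMr// mulrAC ler_wpM2r//.
  by have := sin_le1 th; nra.
have it0 : 0 <= i%:R * tan th' by rewrite mulr_ge0// /tan divr_ge0// ltW.
have B1 := below_ge it; have B2 := below_le N it0.
suff : ((\sum_(j < N) ((sector th' (i : nat, j : nat) && ~~ sector th (i : nat, j : nat))
    && (nrm (i : nat, j : nat) <= r)%R)) + below (i%:R * tan th) N <= below (i%:R * tan th') N)%N.
  by rewrite -(ler_nat R) natrD; nra.
rewrite /below -big_split/=; apply: leq_sum => j _; rewrite !sectorE/=; [|lra..].
have : i%:R * tan th <= i%:R * tan th' by rewrite ler_wpM2l.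
case: (ltP _ (i%:R * tan th')) => u; case: (ltP _ (i%:R * tan th)) => w //=; try lra.
by case: (_ <= r).
Qed.

(** The triangle of the wedge cut at abscissa r cos th' lies in the disc, and each of its columns
    loses at most one point. *)
Lemma wedge_ge r (N : nat) : 0 <= r -> r < N%:R ->
  (tan th' - tan th) * (((r * c') ^+ 2 - r * c') / 2) - (r * c' + 1) <= (cnt wedge N r)%:R.
Proof.
move: (h0) (h1) (h2) (c0) (c0') (s0) (s0') => ? ? ? ? ? ? ?.
move=> r0 rN; have rc0 : 0 <= r * c' by rewrite mulr_ge0// ltW.
have tt := tan_le.
have rcN : r * c' < N%:R by have := cos_le1 th'; nra.
apply: (@le_trans _ _ (\sum_(i < N) ((tan th' - tan th) * (if i%:R <= r * c' then i%:R else 0)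
   - (if i%:R <= r * c' then 1 else 0)))).
  rewrite big_split/= -mulr_sumr sumrN lerB ?sum_ord_le1// ler_wpM2l ?sum_ord_ge ?rc0//; lra.
rewrite /cnt natr_sum; apply: ler_sum => i _.
have i0 : 0 <= i%:R :> R by [].
case: (leP i%:R (r * c')) => ic; last by rewrite mulr0 subr0.
have its : i%:R * tan th' <= r * s'.
  by rewrite /tan mulrA ler_pdivrMr// mulrAC ler_wpM2r.
have it : i%:R * tan th' <= N%:R.
  by apply: le_trans its _; have := sin_le1 th'; nra.
have it0 : 0 <= i%:R * tan th by rewrite mulr_ge0// /tan divr_ge0// ltW.
have B1 := below_ge it; have B2 := below_le N it0.
suff : (below (i%:R * tan th') N <= (\sum_(j < N) ((sector th' (i : nat, j : nat) && ~~ sector th (i : nat, j : nat))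
    && (nrm (i : nat, j : nat) <= r)%R)) + below (i%:R * tan th) N)%N.
  by rewrite -(ler_nat R) natrD; nra.
rewrite /below -big_split/=; apply: leq_sum => j _; rewrite !sectorE/=; [|lra..].
case: (ltP _ (i%:R * tan th')) => u; last by rewrite leq0n.
case: (ltP _ (i%:R * tan th)) => w //=.
suff -> : nrm (i : nat, j : nat) <= r by [].
rewrite nrm_le//=; apply: (@le_trans _ _ ((r * c') ^+ 2 + (r * s') ^+ 2)).
  by rewrite lerD// lerXn2r// ?nnegrE ?mulr_ge0//; lra.
by rewrite !exprMn -mulrDr cos_sin_le1 mulr1.
Qed.

End Wedge.

Lemma ler_cos_quadrant x y : 0 <= x -> x <= y -> y <= pi / 2 -> cos y <= cos x.
Proof.
move=> x0 xy y2.
have [|c] := @MVT_segment _ (@cos R) (fun x => - sin x) _ _ xy (fun x _ => is_derive_cos x).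
  by apply: continuous_subspaceT => z; exact: continuous_cos.
rewrite in_itv/= => /andP[xc cy] e.
have : 0 <= sin c * (y - x) by rewrite mulr_ge0 ?subr_ge0// sin_ge0_quadrant//; lra.
by lra.
Qed.

(** The inner and the outer triangle differ from the disc sector by an area quadratic in the
    opening, so the total error disappears when a sector is cut into many wedges. The tangents are
    controlled by 1 / cos T, whence a bound [T] strictly below the vertical. *)
Lemma wedge_approx T th th' r (N : nat) : 0 <= th -> th <= th' -> th' <= T ->
  T < pi / 2 -> th' - th <= 1 -> 0 <= r -> r < N%:R ->
  `|(cnt (fun v => sector th' v && ~~ sector th v) N r)%:R - (th' - th) * r ^+ 2 / 2|
  <= (1 + (cos T)^-1) * (th' - th) ^+ 2 * (r ^+ 2 / 2) + ((cos T)^-1 ^+ 2 + 1) * (r + 1).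
Proof.
move=> h0 h1 h2 h3 h4 r0 rN.
have C0 : 0 < cos T by apply: cos_gt0_quadrant; lra.
have CT : cos T <= cos th' by apply: ler_cos_quadrant; lra.
have cc : cos th' <= cos th by apply: ler_cos_quadrant; lra.
have c1 := cos_le1 th.
have h5 : th' < pi / 2 by lra.
have U := wedge_le h0 h1 h5 r0 rN; have L := wedge_ge h0 h1 h5 r0 rN.
have tB := tanB h0 h1 h5; have tle := tan_le h0 h1 h5.
move: U L; set W := (cnt _ _ _)%:R => U L.
set h := th' - th in h4 tB *; have hh : 0 <= h by rewrite /h; lra.
set c := cos th in cc c1 tB U *; set c' := cos th' in CT cc tB L *.
have sh := sin_le_id hh; have sh' := sin_ge hh.
set S := sin h in sh sh' tB.
have cl : c - c' <= h.
  by have := cos_lip th th'; rewrite -/c -/c' distrC ler_norml (@distrC _ _ th) (ger0_norm hh); lra.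
set C := cos T in C0 CT *; set D := C^-1.
have D0 : 0 < D by rewrite invr_gt0.
have D1 : C * D = 1 by rewrite mulfV ?gt_eqF.
have c0 : 0 < c by lra. have c0' : 0 < c' by lra.
have i1 : c^-1 <= D by rewrite lef_pV2 ?posrE//; lra.
have i2 : c'^-1 <= D by rewrite lef_pV2 ?posrE//; lra.
have S0 : 0 <= S.
  have -> : S = (tan th' - tan th) * (c * c') by rewrite tB divfK// gt_eqF ?mulr_gt0.
  by rewrite !mulr_ge0// ?subr_ge0 // ltW.
have U1 : (tan th' - tan th) * c ^+ 2 <= h * (1 + h * D).
  have -> : (tan th' - tan th) * c ^+ 2 = S * (c / c') by rewrite tB; field; rewrite !gt_eqF.
  apply: ler_pM => //; first by rewrite divr_ge0 ?ltW.
  rewrite (_ : c / c' = 1 + (c - c') / c'); last by field; rewrite gt_eqF.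
  by rewrite lerD2l ler_pM ?invr_ge0 ?subr_ge0 ?(ltW c0').
have L1 : h * (1 - h - h * D) <= (tan th' - tan th) * c' ^+ 2.
  have -> : (tan th' - tan th) * c' ^+ 2 = S * (c' / c) by rewrite tB; field; rewrite !gt_eqF.
  have e : c' / c = 1 - (c - c') / c by field; rewrite gt_eqF.
  have e1 : 1 - h * D <= c' / c.
    by rewrite e lerD2l lerN2 ler_pM ?invr_ge0 ?subr_ge0 ?(ltW c0).
  have e2 : 0 <= c' / c by rewrite divr_ge0 ?ltW.
  apply: (@le_trans _ _ (h * (1 - h) * (c' / c))); last by rewrite ler_wpM2r.
  rewrite -mulrA ler_wpM2l//.
  apply: (@le_trans _ _ ((1 - h) * (1 - h * D))); last by rewrite ler_wpM2l//; lra.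
  by have : 0 <= h * h * D; [rewrite !mulr_ge0 ?(ltW D0)|nra].
have E1 : (tan th' - tan th) <= D ^+ 2.
  rewrite tB invfM expr2 mulrCA; apply: ler_pM => //.
  - by rewrite invr_ge0 ltW.
  - by rewrite mulr_ge0 ?invr_ge0 ?(ltW c0').
  - by rewrite -[leRHS]mul1r ler_pM ?invr_ge0 ?(ltW c0') ?(le_trans sh).
have t0 : 0 <= tan th' - tan th by lra.
have Ec : (tan th' - tan th) * (r * c) <= D ^+ 2 * r.
  by apply: ler_pM => //; [rewrite mulr_ge0 ?(ltW c0)|rewrite ler_piMr].
have Ec' : (tan th' - tan th) * (r * c') <= D ^+ 2 * r.
  by apply: ler_pM => //; [rewrite mulr_ge0 ?(ltW c0')|rewrite ler_piMr//; lra].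
have rc1 : r * c <= r by rewrite ler_piMr.
have rc1' : r * c' <= r by rewrite ler_piMr//; lra.
have r2 : 0 <= r ^+ 2 / 2 by rewrite divr_ge0 ?sqr_ge0.
have U2 := ler_wpM2r r2 U1; have L2 := ler_wpM2r r2 L1.
have D2 : 0 <= D ^+ 2 by exact: sqr_ge0.
have Dr : 0 <= D ^+ 2 * r by rewrite mulr_ge0.
have -> : (D ^+ 2 + 1) * (r + 1) = D ^+ 2 * r + D ^+ 2 + r + 1 by ring.
rewrite ler_norml; apply/andP; split.
  apply: le_trans (lerB L (lexx _)).
  have -> : (tan th' - tan th) * (((r * c') ^+ 2 - r * c') / 2) =
    (tan th' - tan th) * c' ^+ 2 * (r ^+ 2 / 2) - (tan th' - tan th) * (r * c') / 2 by field.
  have -> : h * r ^+ 2 / 2 = h * (r ^+ 2 / 2) by ring.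
  by lra.
apply: le_trans (lerB U (lexx _)) _.
have -> : (tan th' - tan th) * (((r * c) ^+ 2 + r * c) / 2) =
  (tan th' - tan th) * c ^+ 2 * (r ^+ 2 / 2) + (tan th' - tan th) * (r * c) / 2 by field.
have -> : h * r ^+ 2 / 2 = h * (r ^+ 2 / 2) by ring.
have : 0 <= h ^+ 2 * (r ^+ 2 / 2) by rewrite mulr_ge0 ?sqr_ge0.
by lra.
Qed.

Lemma cnt_pred0 P N r : (forall v, P v = false) -> cnt P N r = 0%N.
Proof. by move=> P0; rewrite /cnt big1// => i _; rewrite big1// => j _; rewrite P0. Qed.

Lemma dens_sector_lt th : 0 <= th -> th < pi / 2 -> dens (sector th) (th / 2).
Proof.
move=> th0 th2 e e0.
have C0 : 0 < cos th by apply: cos_gt0_quadrant; lra.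
set D := (cos th)^-1; have D0 : 0 < D by rewrite invr_gt0.
pose K := D ^+ 2 + 1; have K0 : 0 < K by rewrite addr_gt0// exprn_gt0.
pose a := (1 + D) * th ^+ 2; have a0 : 0 <= a by rewrite mulr_ge0 ?sqr_ge0//; lra.
(* With M equal wedges the quadratic errors add up to a / M <= e times r^2 / 2, and each opening th
   / M is at most 1. The linear errors, M K (r + 1) in all, are absorbed by taking r >= 4 M K /
   e. *)
pose M := (Num.truncn (a / e + th)).+1.
have ae : 0 <= a / e + th by rewrite addr_ge0// divr_ge0// ltW.
have Mlt : a / e + th < M%:R by have /andP[] := truncn_itv ae.
have M0 : 0 < M%:R :> R by rewrite ltr0n.
have aeM : a / e < M%:R by lra.
have ae0 : 0 <= a / e by rewrite divr_ge0// ltW.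
have thM : th < M%:R by lra.
pose h := th / M%:R.
have h1 : h <= 1 by rewrite ler_pdivrMr// mul1r ltW.
have h0 : 0 <= h by rewrite divr_ge0// ltW.
exists (Num.max 1 (4 * M%:R * K / e)) => r N; rewrite ge_max => /andP[r1 rK] rN.
have r0 : 0 <= r by lra.
have W i : (i < M)%N -> `|(cnt (sector (i.+1%:R * h)) N r)%:R - (cnt (sector (i%:R * h)) N r)%:R
    - h * r ^+ 2 / 2| <= (1 + D) * h ^+ 2 * (r ^+ 2 / 2) + K * (r + 1).
  move=> iM; have e1 : i.+1%:R * h - i%:R * h = h by rewrite -natr1; ring.
  have iT : i.+1%:R * h <= th by rewrite /h mulrCA ler_piMr// ler_pdivrMr// mul1r ler_nat.
  have i0 : 0 <= i%:R * h by rewrite mulr_ge0.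
  have ii : i%:R * h <= i.+1%:R * h by lra.
  have E : (cnt (sector (i.+1%:R * h)) N r)%:R - (cnt (sector (i%:R * h)) N r)%:R =
      (cnt (fun v => sector (i.+1%:R * h) v && ~~ sector (i%:R * h) v) N r)%:R :> R.
    rewrite (cntID (sector (i.+1%:R * h)) (sector (i%:R * h))) natrD.
    rewrite (@eq_cnt (fun v => sector (i.+1%:R * h) v && sector (i%:R * h) v) (sector (i%:R * h))).
      by rewrite addrC addKr.
    by move=> v _; rewrite andb_idl// => /(sector_mono i0 ii); apply; lra.
  by have := wedge_approx i0 ii iT th2 _ r0 rN; rewrite e1 E => /(_ h1).
have -> : (cnt (sector th) N r)%:R - th / 2 * r ^+ 2 = \sum_(0 <= i < M)
    ((cnt (sector (i.+1%:R * h)) N r)%:R - (cnt (sector (i%:R * h)) N r)%:R - h * r ^+ 2 / 2).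
  rewrite sumrB telescope_sumr// mul0r [X in _ - X - _](_ : _ = 0); last first.
    rewrite cnt_pred0// => v; rewrite /sector cos0 sin0 mulr1 mulr0.
    by apply/negP/negP; rewrite -leNgt.
  rewrite subr0 sumr_const_nat subn0 (_ : M%:R * h = th); last by rewrite /h mulrC divfK// gt_eqF.
  congr (_ - _); rewrite -mulr_natl -[in LHS](_ : M%:R * h = th); first by ring.
  by rewrite /h mulrC divfK// gt_eqF.
apply: le_trans (ler_norm_sum _ _ _) _.
apply: (@le_trans _ _ (\sum_(0 <= i < M) ((1 + D) * h ^+ 2 * (r ^+ 2 / 2) + K * (r + 1)))).
  rewrite big_nat_cond [leRHS]big_nat_cond; apply: ler_sum => i /andP[/andP[_ iM] _]; exact: W.
rewrite sumr_const_nat subn0 -[_ *+ M]mulr_natl (mulrDr M%:R).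
have -> : M%:R * ((1 + D) * h ^+ 2 * (r ^+ 2 / 2)) = a / M%:R * (r ^+ 2 / 2).
  by rewrite /a /h; field; rewrite gt_eqF.
have a1 : a / M%:R <= e by rewrite ler_pdivrMr// mulrC -ler_pdivrMr// ltW.
have r2 : 0 <= r ^+ 2 / 2 by rewrite divr_ge0 ?sqr_ge0.
have U1 := ler_wpM2r r2 a1.
have : M%:R * (K * (r + 1)) <= e * (r ^+ 2 / 2); last lra.
rewrite ler_pdivrMr// in rK; have := ler_wpM2r r0 rK.
have MK : 0 <= M%:R * K by rewrite mulr_ge0 ?ltW.
have := ler_wpM2l MK r1; rewrite (_ : r * e * r = e * r ^+ 2); last by ring.
lra.
Qed.

Lemma sector_pihalf v : sector (pi / 2) v = (0 < v.1)%N.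
Proof. by rewrite /sector cos_pihalf sin_pihalf mulr0 mulr1 ltr0n. Qed.

(** Tangents blow up at the vertical. The part of the quadrant within an angle [ph] of it is
    reflected in the diagonal into a horizontal sector, whose density is already known and small.
    The reflected sector is taken of angle 2 ph because [sector] is defined by a strict
    inequality. *)
Lemma dens_sector_pihalf : dens (sector (pi / 2)) (pi / 4).
Proof.
move=> e e0; have pi0 := pi_gt0 R.
pose ph := Num.min (e / 2) (pi / 8).
have ph0 : 0 < ph by rewrite lt_min; lra.
have phe : ph <= e / 2 by rewrite ge_min lexx.
have php : ph <= pi / 8 by rewrite ge_min lexx orbT.
have e4 : 0 < e / 4 by lra.
have p1 : 0 <= pi / 2 - ph by lra.
have p2 : pi / 2 - ph < pi / 2 by lra.
have p3 : 0 <= 2 * ph by lra.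
have p4 : 2 * ph < pi / 2 by lra.
have [r1 H1] := dens_sector_lt p1 p2 e4.
have [r2 H2] := dens_sector_lt p3 p4 e4.
exists (Num.max 0 (Num.max r1 r2)) => r N; rewrite !ge_max => /and3P[r0 rr1 rr2] rN.
have := H1 _ _ rr1 rN; have := H2 _ _ rr2 rN; rewrite !ler_norml.
have U : (cnt (sector (pi / 2 - ph)) N r <= cnt (sector (pi / 2)) N r)%N.
  apply: cnt_le => v _; rewrite sector_pihalf /sector; case: v => [[|a] b]//=.
  rewrite mul0r ltNge mulr_ge0// cos_ge0_quadrant//; lra.
have L : (cnt (sector (pi / 2)) N r <= cnt (sector (pi / 2 - ph)) N r + cnt (sector (2 * ph)) N r)%N.
  rewrite -(cnt_swap (sector (2 * ph))) (cntID (sector (pi / 2)) (sector (pi / 2 - ph))) leq_add//.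
    by apply: cnt_le => v _ /andP[].
  apply: cnt_le => -[a b] _ /andP[]; rewrite sector_pihalf /sector/= => a0.
  rewrite -leNgt cosB sinB cos_pihalf sin_pihalf !mul0r !mul1r add0r subr0 => ab.
  have a0' : 0 < a%:R :> R by rewrite ltr0n.
  have s0 : 0 < sin ph by apply: sin_gt0_pi; lra.
  have c0 : 0 < cos ph by apply: cos_gt0_quadrant; lra.
  rewrite (_ : 2 * ph = ph + ph); last by ring.
  rewrite cosD sinD.
  have b0 : 0 < b%:R :> R.
    by rewrite -(pmulr_lgt0 _ s0); apply: lt_le_trans ab; rewrite mulr_gt0.
  have := ler_wpM2r (ltW c0) ab; have : 0 < a%:R * sin ph * sin ph by rewrite !mulr_gt0.
  have : 0 < b%:R * sin ph * cos ph by rewrite !mulr_gt0.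
  by lra.
have r20 : 0 <= r ^+ 2 by exact: sqr_ge0.
have := ler_wpM2r r20 phe; rewrite -(ler_nat R) natrD in L; rewrite -(ler_nat R) in U.
move=> ? /andP[? ?] /andP[? ?]; apply/andP; split; lra.
Qed.

Lemma dens_sector th : 0 <= th <= pi / 2 -> dens (sector th) (th / 2).
Proof.
move=> /andP[th0]; rewrite le_eqVlt => /orP[/eqP ->|]; last exact: dens_sector_lt.
by rewrite (_ : pi / 2 / 2 = pi / 4); [exact: dens_sector_pihalf|field].
Qed.

Lemma dens_quadrant : dens (fun v => v != (0, 0)%N) (pi / 4).
Proof.
move=> e e0; have e2 : 0 < e / 2 by lra.
have [r1 H1] := dens_sector_pihalf e2.
exists (Num.max (Num.max 1 (4 / e)) r1) => r N; rewrite !ge_max => /andP[/andP[r1' r4] rr1] rN.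
have := H1 _ _ rr1 rN; rewrite !ler_norml.
rewrite (cntID (fun v => v != (0, 0)%N) (sector (pi / 2))).
rewrite (@eq_cnt (fun v => (v != (0, 0)%N) && sector (pi / 2) v) (sector (pi / 2))); last first.
  by move=> -[[|a] b] _; rewrite sector_pihalf// andbF.
have : (cnt (fun v => (v != (0, 0)%N) && ~~ sector (pi / 2) v) N r)%:R <= r + 1.
  apply: (@le_trans _ _ (\sum_(j < N) (if j%:R <= r then 1 else 0))); last first.
    by apply: sum_ord_le1; lra.
  case: N rN => [|N] rN; first by rewrite /cnt !big_ord0.
  rewrite /cnt big_ord_recl/= [X in (_ + X)%N]big1 ?addn0; last first.
    by move=> i _; rewrite big1// => j _; rewrite sector_pihalf.
  rewrite natr_sum; apply: ler_sum => j _; rewrite sector_pihalf/= andbT.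
  case: (leP (nrm (0%N, j : nat)) r) => h; rewrite ?andbF ?andbT; last by case: ifP.
  have -> : j%:R <= r by exact: le_trans (nrm_snd (0%N, j : nat)) h.
  by case: (_ != _).
rewrite natrD; set x := (cnt (fun v => _ && _) N r)%:R => h.
have y0 : 0 <= x by rewrite /x.
rewrite ler_pdivrMr// in r4; have : r + 1 <= e / 2 * r ^+ 2 by nra.
by move=> ? /andP[? ?]; apply/andP; split; lra.
Qed.
End Counting.

Arguments nrm_ge0 {R} v.
Arguments nrm_fst {R} v.
Arguments nrm_snd {R} v.
Arguments nrm_swap {R} a b.
Arguments nrmM {R} d a b.
Arguments nrm_ge1 {R} v _.

(** * Primitive vectors *)

Section Primitive.
Context {R : realType}.
Implicit Types (r x y th : R) (P Q : pred (nat * nat)).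
Local Notation nrm := (@nrm R).

Lemma cntE P (N : nat) r :
  cnt P N r = #|[pred v : 'I_N * 'I_N | P (v.1 : nat, v.2 : nat) && (nrm (v.1 : nat, v.2 : nat) <= r)%R]|.
Proof.
rewrite /cnt pair_big/= -sum1_card [RHS]big_mkcond/=; apply: eq_bigr => v _.
by rewrite inE/=; case: (_ && _).
Qed.

Lemma cnt_addN P (N k : nat) r : r < N%:R -> cnt P (N + k) r = cnt P N r.
Proof.
move=> rN; have rk (i : nat) : ((N + i)%:R <= r) = false.
  by apply/negbTE; rewrite -ltNge natrD; have : 0 <= i%:R :> R by []; lra.
rewrite /cnt big_split_ord/= [X in (_ + X)%N]big1 ?addn0.
  apply: eq_bigr => i _; rewrite big_split_ord/= [X in (_ + X)%N]big1 ?addn0// => j _.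
  apply/eqP; rewrite eqb0; apply/negP => /andP[_ h].
  by have := le_trans (nrm_snd _) h; rewrite rk.
move=> i _; rewrite big1// => j _; apply/eqP; rewrite eqb0; apply/negP => /andP[_ h].
by have := le_trans (nrm_fst _) h; rewrite rk.
Qed.

Lemma cnt_indep P (N N' : nat) r : r < N%:R -> r < N'%:R -> cnt P N r = cnt P N' r.
Proof.
move=> h h'; case: (leqP N N') => [|/ltnW] /subnKC <-.
  by rewrite [RHS]cnt_addN.
by rewrite cnt_addN.
Qed.

Definition prim (v : nat * nat) := coprime v.1 v.2.

(** Multiplication by d is a bijection from the primitive vectors of norm at most r / d onto the
    vectors of gcd d and norm at most r. *)
Lemma cnt_gcd P (N d : nat) r : (0 < d)%N -> r < N%:R ->
  (forall d a b, (0 < d)%N -> P ((d * a)%N, (d * b)%N) = P (a, b)) ->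
  cnt (fun v => P v && (gcdn v.1 v.2 == d)) N r = cnt (fun v => P v && prim v) N (r / d%:R).
Proof.
move=> d0 rN PZ; rewrite !cntE; case: N rN => [|N] rN.
  by apply: eq_card => -[[]].
have d0' : 0 < d%:R :> R by rewrite ltr0n.
pose f (w : 'I_N.+1 * 'I_N.+1) : 'I_N.+1 * 'I_N.+1 := (inord (d * w.1), inord (d * w.2)).
set B := [pred v : 'I_N.+1 * 'I_N.+1 | P _ && prim _ && _].
have bnd (w : 'I_N.+1 * 'I_N.+1) : nrm (w.1 : nat, w.2 : nat) <= r / d%:R ->
    (d * w.1 < N.+1)%N /\ (d * w.2 < N.+1)%N.
  rewrite ler_pdivlMr// => h; have h1 := @nrm_fst R (w.1 : nat, w.2 : nat).
  have h2 := @nrm_snd R (w.1 : nat, w.2 : nat).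
  have le x : x <= nrm (w.1 : nat, w.2 : nat) -> d%:R * x < N.+1%:R.
    by move=> /(ler_wpM2l (ltW d0')); rewrite (mulrC _ (nrm _)); lra.
  by split; rewrite -(ltr_nat R) natrM le.
rewrite [LHS](_ : _ = #|[seq f w | w in B]|).
  apply: card_in_image => w w'; rewrite !inE => /andP[_ H1] /andP[_ H2].
  have [h1 h2] := bnd _ H1; have [h3 h4] := bnd _ H2.
  case: w w' h1 h2 h3 h4 {H1 H2} => [a b] [a' b']/= h1 h2 h3 h4.
  case => /(congr1 val)/= + /(congr1 val)/=; rewrite !inordK// => /eqP + /eqP.
  by rewrite !eqn_pmul2l// => /eqP/val_inj -> /eqP/val_inj ->.
apply: eq_card => -[a b]; apply/idP/fintype.imageP; rewrite inE/=.
  move=> /andP[/andP[Pab /eqP gd] nr].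
  have da : (d %| a)%N by rewrite -gd dvdn_gcdl.
  have db : (d %| b)%N by rewrite -gd dvdn_gcdr.
  have ea : (d * (a %/ d) = a)%N by rewrite mulnC divnK.
  have eb : (d * (b %/ d) = b)%N by rewrite mulnC divnK.
  have la : (a %/ d < N.+1)%N by rewrite (leq_ltn_trans (leq_div _ _)).
  have lb : (b %/ d < N.+1)%N by rewrite (leq_ltn_trans (leq_div _ _)).
  exists (Ordinal la, Ordinal lb); last first.
    by rewrite /f/= ea eb; congr pair; apply: val_inj; rewrite /= inordK.
  rewrite inE/= -(PZ d)// ea eb Pab/= ler_pdivlMr// mulrC -nrmM ea eb nr andbT.
  by rewrite /prim /coprime/= -(eqn_pmul2l d0) muln_gcdr ea eb gd muln1.
move=> [[a' b']]; rewrite inE/= => /andP[/andP[Pab /eqP gd] nr] [-> ->].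
have [/= h1 h2] := bnd (a', b') nr.
rewrite !inordK//= PZ// Pab -muln_gcdr gd muln1 eqxx/= nrmM mulrC.
by rewrite -ler_pdivlMr.
Qed.

Lemma cnt_sum_prim P (N M : nat) r : r < N%:R -> r < M%:R ->
  (forall d a b, (0 < d)%N -> P ((d * a)%N, (d * b)%N) = P (a, b)) -> ~~ P (0, 0)%N ->
  cnt P N r = (\sum_(1 <= d < M) cnt (fun v => P v && prim v) N (r / d%:R))%N.
Proof.
move=> rN rM PZ P0.
transitivity (\sum_(1 <= d < M) cnt (fun v => P v && (gcdn v.1 v.2 == d)) N r)%N; last first.
  rewrite big_nat_cond [RHS]big_nat_cond; apply: eq_bigr => d /andP[/andP[d1 _] _].
  exact: cnt_gcd.
rewrite /cnt [RHS]exchange_big/=; apply: eq_bigr => i _; rewrite [RHS]exchange_big/=.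
apply: eq_bigr => j _; case: (boolP (P (i : nat, j : nat))) => Pij /=; last by rewrite big1.
case: leP => h; last by rewrite big1// => d _; rewrite andbF.
have g0 : (0 < gcdn i j)%N.
  by rewrite gcdn_gt0; move: Pij; case: (i : nat) (j : nat) => [|a] [|b]//; rewrite (negbTE P0).
have gM : (gcdn i j < M)%N.
  rewrite -(ltr_nat R); apply: le_lt_trans rM; apply: le_trans h.
  case: (posnP i) => i0.
    by rewrite {1}i0 gcd0n; exact: nrm_snd (i : nat, j : nat).
  apply: le_trans (nrm_fst (i : nat, j : nat)); rewrite ler_nat; exact: dvdn_leq (dvdn_gcdl _ _).
under eq_bigr do rewrite andbT.
rewrite (bigD1_seq (gcdn i j)) ?iota_uniq ?mem_index_iota ?g0//= eqxx big1 ?addn0// => d.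
by rewrite eq_sym => /negbTE ->.
Qed.

Lemma cnt_prim_le P r : 0 <= r ->
  (cnt (fun v => P v && prim v) (Num.truncn r).+1 r)%:R <= 4 * r ^+ 2.
Proof.
move=> r0; case: (ltP r 1) => r1.
  rewrite (_ : cnt _ _ _ = 0)%N ?mulr_ge0 ?sqr_ge0//.
  rewrite /cnt big1// => i _; rewrite big1// => j _; apply/eqP; rewrite eqb0.
  apply/negP => /andP[/andP[_ pij] h].
  have : (i : nat, j : nat) != (0, 0)%N by apply: contraTneq pij => ->.
  by move=> /(@nrm_ge1 R); lra.
have /andP[h1 _] := truncn_itv r0.
set N := (Num.truncn r).+1; have NR : N%:R <= 2 * r by rewrite /N -natr1; lra.
apply: (@le_trans _ _ (N%:R * N%:R)).
  rewrite -natrM ler_nat cntE; apply: leq_trans (max_card _) _.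
  by rewrite card_prod card_ord.
by have : 0 <= N%:R :> R by []; nra.
Qed.

(** Telescoping, by 1 / d^2 <= 1 / (d - 1) - 1 / d. *)
Lemma sum_invsqr_le (M K : nat) : (1 < M)%N -> (M <= K)%N ->
  \sum_(M <= d < K) d%:R ^- 2 <= (M.-1%:R)^-1 - (K.-1%:R)^-1 :> R.
Proof.
move=> M1 /subnKC <-; elim: (K - M)%N => [|k IH]; first by rewrite addn0 big_geq// subrr.
rewrite addnS big_nat_recr/= ?leq_addr//.
apply: le_trans (lerD IH (lexx _)) _.
have : (1 < M + k)%N by lia.
case: (M + k)%N => [//|[//|n]] _ /=.
have n0 : 0 < n.+1%:R :> R by rewrite ltr0n.
rewrite -(natr1 n.+1); set x := n.+1%:R in n0 *.
rewrite -subr_ge0.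
rewrite [leRHS](_ : _ = (x * (x + 1) ^+ 2)^-1); last first.
  by set y := M.-1%:R^-1; field; rewrite !gt_eqF//; lra.
by rewrite invr_ge0 mulr_ge0 ?sqr_ge0 ?(ltW n0).
Qed.

Lemma zeta2_tail (M : nat) : (1 < M)%N ->
  \sum_(1 <= d < M) d%:R ^- 2 <= (zeta 2 : R) <= \sum_(1 <= d < M) d%:R ^- 2 + (M.-1%:R)^-1.
Proof.
move=> M1; have [cv _] := @cvg_zeta R 1 isT.
have nd : nondecreasing_seq (fun N => \sum_(1 <= d < N) (d%:R ^- 2 : R)).
  apply/nondecreasing_seqP => -[|n]; first by rewrite !big_geq.
  by rewrite [leRHS]big_nat_recr//= lerDl invr_ge0 exprn_ge0.
rewrite -(cvg_lim (@Rhausdorff R) cv); apply/andP; split.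
  by apply: nondecreasing_cvgn_le => //; exact: cvgP cv.
apply: limr_le; first exact: cvgP cv.
near=> N; have MN : (M <= N)%N by near: N; exact: nbhs_infty_ge.
rewrite (big_cat_nat _ MN)//=; last exact: ltnW.
rewrite lerD2l (le_trans (sum_invsqr_le M1 MN))// lerBlDr lerDl invr_ge0//.
Unshelve. all: end_near. Qed.

Lemma zeta2_gt0 : 0 < zeta 2 :> R.
Proof.
have /andP[h _] := zeta2_tail (isT : (1 < 2)%N); apply: lt_le_trans h.
by rewrite big_nat1 expr1n invr1.
Qed.

(** The identity of [cnt_sum_prim] is inverted without the Moebius function. The error [psi r] is a
    small term minus the sum of [psi (r / d)] over d >= 2; this relation contracts the best constant
    in |psi r| <= e r^2, and iterating it brings the constant below any positive number. *)
Lemma dens_prim P (c : R) :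
  (forall d a b, (0 < d)%N -> P ((d * a)%N, (d * b)%N) = P (a, b)) -> ~~ P (0, 0)%N ->
  0 <= c -> dens P c -> dens (fun v => P v && prim v) (c / zeta 2).
Proof.
move=> PZ P0 c0 Pc; set c' := c / zeta 2.
have z0 := zeta2_gt0.
have c'0 : 0 <= c' by rewrite divr_ge0// ltW.
have cE : c = c' * zeta 2 by rewrite divfK// gt_eqF.
clearbody c'.
pose g r := (cnt (fun v => P v && prim v) (Num.truncn r).+1 r)%:R : R.
pose psi r := g r - c' * r ^+ 2.
have trunc_lt r : 0 <= r -> r < (Num.truncn r).+1%:R by move=> /truncn_itv/andP[].
have gE r (N : nat) : 0 <= r -> r < N%:R -> (cnt (fun v => P v && prim v) N r)%:R = g r.
  by move=> r0 rN; rewrite (cnt_indep _ rN (trunc_lt _ r0)).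
pose K := 4 + c'.
have K0 : 0 < K by rewrite /K; lra.
have psiK r : 0 <= r -> `|psi r| <= K * r ^+ 2.
  move=> r0; have := cnt_prim_le P r0; rewrite -/(g r) => h.
  have g0 : 0 <= g r by rewrite /g.
  have : 0 <= c' * r ^+ 2 by rewrite mulr_ge0 ?sqr_ge0.
  have := sqr_ge0 r.
  by rewrite /psi /K ler_norml mulrDl => ? ?; apply/andP; split; lra.
clearbody K.
pose S e := exists r0, forall r, r0 <= r -> `|psi r| <= e * r ^+ 2.
(* [psi] is controlled by its values at [r / d], [d >= 2], and the total weight of
   these is at most [zeta 2 - 1 <= 3/4]. *)
have step e : 0 < e -> S e -> S (7 / 8 * e).
  move=> e0 [r0 H]; have e24 : 0 < e / 24 by lra.
  have [r1 H1] := Pc _ e24.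
  pose rho := Num.max 1 r0.
  have rho1 : 1 <= rho by rewrite le_max lexx.
  have {}H r : rho <= r -> `|psi r| <= e * r ^+ 2.
    by move=> h; apply: H; apply: le_trans h; rewrite le_max lexx orbT.
  (* Three errors of e / 24 each: the density of [P], the tail of zeta 2, and the d with r / d
     possibly below [rho]. Together with the weight 3/4 of the other d they give 3/4 + 3/24 =
     7/8. *)
  exists (Num.max (rho * (2 + 24 * K / e)) (Num.max r1 (2 + 24 * c' / e))) => r.
  rewrite !ge_max => /and3P[ra rb rc].
  have Ke : 0 < 24 * K / e by rewrite divr_gt0// mulr_gt0.
  have ce : 0 <= 24 * c' / e by rewrite divr_ge0 ?mulr_ge0// ltW.
  have r2 : 2 <= r by lra.
  have r00 : 0 <= r by lra.
  have r20 := sqr_ge0 r.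
  pose M := (Num.truncn r).+1; have rM := trunc_lt _ r00; rewrite -/M in rM.
  have M1 : (1 < M)%N by rewrite -(ltr_nat R); lra.
  have rrho : 2 + 24 * K / e <= r / rho by rewrite ler_pdivlMr ?(mulrC _ rho)//; lra.
  have rrho0 : 0 <= r / rho by lra.
  (* For d < D the radius r / d is at least [rho] and the bound to be improved applies; for d >= D
     only the crude bound [psiK] is available, but these d carry little weight. *)
  pose D := (Num.truncn (r / rho)).+1.
  have /andP[D1 D2] := truncn_itv rrho0; rewrite -/D in D2.
  have D3 : (1 < D)%N by rewrite -(ltr_nat R); lra.
  have DM : (D <= M)%N.
    rewrite /D /M ltnS; apply: le_truncn; rewrite ler_pdivrMr; last lra.
    by rewrite ler_peMr.
  have id : (cnt P M r)%:R = \sum_(1 <= d < M) g (r / d%:R) :> R.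
    rewrite (cnt_sum_prim rM rM PZ P0) natr_sum big_nat_cond [RHS]big_nat_cond.
    apply: eq_bigr => d /andP[/andP[d1 _] _]; apply: gE; first by rewrite divr_ge0.
    by apply: le_lt_trans rM; rewrite ler_pdivrMr ?ltr0n// ler_peMr// ler1n.
  pose s := \sum_(1 <= d < M) (d%:R ^- 2 : R).
  have psiE : psi r = ((cnt P M r)%:R - c * r ^+ 2) + c' * r ^+ 2 * (zeta 2 - s)
      - \sum_(2 <= d < M) psi (r / d%:R).
    have : \sum_(1 <= d < M) psi (r / d%:R) = (cnt P M r)%:R - c' * r ^+ 2 * s.
      rewrite id /s mulr_sumr -sumrB; apply: eq_bigr => d _.
      by rewrite /psi expr_div_n mulrA.
    rewrite big_ltn// divr1 => /eqP; rewrite -subr_eq0 => /eqP h.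
    rewrite [in c * _]cE; lra.
  have A1 : `|(cnt P M r)%:R - c * r ^+ 2| <= e / 24 * r ^+ 2 by exact: H1.
  have A2 : `|c' * r ^+ 2 * (zeta 2 - s)| <= e / 24 * r ^+ 2.
    have /andP[s1 s2] := zeta2_tail M1; rewrite -/s in s1 s2.
    rewrite ger0_norm ?mulr_ge0 ?subr_ge0// mulrAC ler_wpM2r//.
    have M10 : 0 < M.-1%:R :> R by rewrite ltr0n -ltnS prednK// ltnW.
    apply: (@le_trans _ _ (c' / M.-1%:R)); first by rewrite ler_wpM2l//; lra.
    rewrite ler_pdivrMr//; have : 24 * c' / e <= M.-1%:R.
      have : M%:R = M.-1%:R + 1 :> R by rewrite -natr1.
      lra.
    by rewrite ler_pdivrMr//; lra.
  have A3 : `|\sum_(2 <= d < M) psi (r / d%:R)| <= 3 / 4 * e * r ^+ 2 + e / 24 * r ^+ 2.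
    apply: le_trans (ler_norm_sum _ _ _) _; rewrite (big_cat_nat _ DM)//=.
    apply: lerD.
      apply: (@le_trans _ _ (e * r ^+ 2 * \sum_(2 <= d < D) (d%:R ^- 2))).
        rewrite mulr_sumr big_nat_cond [leRHS]big_nat_cond; apply: ler_sum => d /andP[/andP[d2 dD] _].
        have d0 : 0 < d%:R :> R by rewrite ltr0n ltnW.
        rewrite -mulrA -expr_div_n; apply: H; rewrite ler_pdivlMr// mulrC -ler_pdivlMr; last lra.
        by apply: le_trans D1; rewrite ler_nat -ltnS.
      rewrite (_ : 3 / 4 * e * r ^+ 2 = e * r ^+ 2 * (3 / 4)); last by ring.
      rewrite ler_wpM2l ?mulr_ge0 ?(ltW e0)//.
      case: (ltnP 2 D) => D4; last by rewrite big_geq// divr_ge0.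
      have : \sum_(3 <= d < D) d%:R ^- 2 <= 2^-1 :> R.
        apply: le_trans (sum_invsqr_le (isT : (1 < 3)%N) D4) _.
        by rewrite lerBlDr lerDl invr_ge0.
      move=> h; rewrite big_ltn//; lra.
    apply: (@le_trans _ _ (K * r ^+ 2 * \sum_(D <= d < M) (d%:R ^- 2))).
      rewrite mulr_sumr; apply: ler_sum => d _.
      by rewrite -mulrA -expr_div_n; apply: psiK; rewrite divr_ge0.
    rewrite mulrAC ler_wpM2r//.
    apply: (@le_trans _ _ (K / D.-1%:R)).
      rewrite ler_wpM2l ?(ltW K0)//; apply: le_trans (sum_invsqr_le D3 DM) _.
      by rewrite lerBlDr lerDl invr_ge0.
    have D10 : 0 < D.-1%:R :> R by rewrite ltr0n -ltnS prednK// ltnW.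
    rewrite ler_pdivrMr//; have : 24 * K / e <= D.-1%:R.
      have : D%:R = D.-1%:R + 1 :> R by rewrite -natr1.
      lra.
    by rewrite ler_pdivrMr//; lra.
  rewrite psiE; apply: le_trans (ler_normB _ _) _.
  apply: le_trans (lerD (ler_normD _ _) (lexx _)) _; lra.
have Spow (j : nat) : S (K * (7 / 8) ^+ j).
  elim: j => [|j IH]; first by exists 0 => r r0; rewrite expr0 mulr1; exact: psiK.
  rewrite exprS mulrCA; apply: step => //; rewrite mulr_gt0// exprn_gt0//; lra.
move=> e e0.
have : (fun j => K * (7 / 8) ^+ j) @ \oo --> (0 : R).
  by apply: cvg_geometric; rewrite ger0_norm; lra.
move=> /cvgr0Pnorm_lt /(_ _ e0) [j _ /(_ j (leqnn j))/= he].
have [r0 H] := Spow j; exists (Num.max 0 r0) => r N; rewrite ge_max => /andP[r00 r0r] rN.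
rewrite gE//; apply: le_trans (H _ r0r) _; rewrite ler_wpM2r ?sqr_ge0//.
by apply: ltW; apply: le_lt_trans he; exact: ler_norm.
Qed.
End Primitive.

(** * Sums over lattice vectors as integrals *)

Section MainSum.
Context {R : realType}.
Local Notation mu := (@lebesgue_measure R).
Local Notation nrm := (@nrm R).
Implicit Types P : pred (nat * nat).

Lemma Rintegral_sum (D : set R) (I : Type) (s : seq I) (P : pred I) (F : I -> R -> R) :
  measurable D -> (forall i, P i -> mu.-integrable D (EFin \o F i)) ->
  mu.-integrable D (EFin \o (fun t => \sum_(i <- s | P i) F i t)) /\
  \int[mu]_(t in D) (\sum_(i <- s | P i) F i t) = \sum_(i <- s | P i) \int[mu]_(t in D) F i t.
Proof.
move=> mD iF; elim: s => [|i s [i1 e1]].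
  rewrite big_nil (_ : (fun t => _) = fun=> 0); last by apply/funext => t; rewrite big_nil.
  by split; [exact: integrable0|rewrite Rintegral_cst// mul0r].
rewrite big_cons (_ : (fun t => \sum_(j <- i :: s | P j) F j t) =
    if P i then (fun t => F i t + \sum_(j <- s | P j) F j t) else (fun t => \sum_(j <- s | P j) F j t)); last first.
  by apply/funext => t; rewrite big_cons; case: (P i).
case: (boolP (P i)) => // Pi; split; first by apply: integrable_add => //; exact: iF.
by rewrite RintegralD// ?e1//; exact: iF.
Qed.

(** Logarithm of 1 + l (e^(-x) + e^(-2x) + ...): the factor of a primitive vector whose multiplicity
    is unbounded. *)
Definition logf (l x : R) : R := ln (1 + l / (expR x - 1)).

Lemma integral_bose_cond l x : 0 < l -> 0 < x ->
  mu.-integrable `]0, +oo[ (EFin \o (fun t => if x <= t then bose l t else 0)) /\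
  \int[mu]_(t in `]0, +oo[) (if x <= t then bose l t else 0) = logf l x.
Proof.
move=> l0 x0; have [ib eb] := integral_bose l0 x0.
have E : (fun t => if x <= t then bose l t else 0) = (bose l) \_ `[x, +oo[%classic.
  by apply/funext => t; rewrite /patch mem_setE in_itv/= andbT.
have sub : (`]0, +oo[ `&` `[x, +oo[ = `[x, +oo[ :> set R)%classic.
  by apply/setIidr => t /=; rewrite !in_itv/= !andbT; exact: lt_le_trans.
have ic : mu.-integrable `[x, +oo[ (EFin \o bose l).
  have x2 : 0 < x / 2 by rewrite divr_gt0.
  have [i2 _] := integral_bose l0 x2; apply: integrableS i2 => //.
  by apply: subset_itvr; rewrite bnd_simp; lra.
split.
  rewrite E -restrict_EFin; apply: (@integrableS _ _ _ _ setT) => //.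
  by apply: (proj1 (integrable_mkcond _ _)) => //; exact: measurable_itv.
rewrite E -(Rintegral_mkcondr mu `]0, +oo[%classic `[x, +oo[%classic) sub.
by rewrite -Rintegral_itv_obnd_cbnd.
Qed.

Lemma cnt_le4 P (N : nat) (r : R) : (forall v, P v -> v != (0, 0)%N) -> 0 <= r ->
  (cnt P N r)%:R <= 4 * r ^+ 2.
Proof.
move=> P0 r0; case: (ltP r 1) => r1.
  rewrite (_ : cnt _ _ _ = 0)%N ?mulr_ge0 ?sqr_ge0//.
  rewrite /cnt big1// => i _; rewrite big1// => j _; apply/eqP; rewrite eqb0.
  by apply/negP => /andP[/P0/(@nrm_ge1 R)]; lra.
have /andP[h1 h2] := truncn_itv r0.
set M := (Num.truncn r).+1 in h2; have NR : M%:R <= 2 * r by rewrite /M -natr1; lra.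
apply: (@le_trans _ _ (M%:R * M%:R)); last by have : 0 <= M%:R :> R by []; nra.
rewrite -natrM ler_nat; apply: (@leq_trans (cnt P (N + M) r)).
  rewrite /cnt big_split_ord/=; apply: leq_trans (leq_addr _ _).
  by apply: leq_sum => i _; rewrite big_split_ord/= leq_addr.
rewrite addnC cnt_addN// cntE; apply: leq_trans (max_card _) _.
by rewrite card_prod card_ord.
Qed.

Definition pt (N : nat) (v : 'I_N * 'I_N) : nat * nat := (v.1 : nat, v.2 : nat).

(** Abel summation in integral form: [logf l x] is the integral of [bose l] over t > x, and
    exchanging the finite sum with the integral leaves the number of vectors with b |v| <= t. *)
Lemma sum_logf_integral P (N : nat) (l b : R) : 0 < l -> 0 < b ->
  (forall v, P v -> v != (0, 0)%N) ->
  mu.-integrable `]0, +oo[ (EFin \o (fun t => (cnt P N (t / b))%:R * bose l t)) /\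
  \int[mu]_(t in `]0, +oo[) ((cnt P N (t / b))%:R * bose l t) =
  \sum_(v : 'I_N * 'I_N | P (pt v)) logf l (b * nrm (pt v)).
Proof.
move=> l0 b0 P0.
pose F (v : 'I_N * 'I_N) t := if b * nrm (pt v) <= t then bose l t else 0.
have pos (v : 'I_N * 'I_N) : P (pt v) -> 0 < b * nrm (pt v).
  by move=> /P0/(@nrm_ge1 R) h; rewrite mulr_gt0//; lra.
have [] := @Rintegral_sum `]0, +oo[%classic _ (index_enum _) (fun v : 'I_N * 'I_N => P (pt v)) F.
- by [].
- by move=> v Pv; have [] := integral_bose_cond l0 (pos _ Pv).
have E t : \sum_(v : 'I_N * 'I_N | P (pt v)) F v t = (cnt P N (t / b))%:R * bose l t.
  rewrite /cnt natr_sum; under [in RHS]eq_bigr do rewrite natr_sum.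
  rewrite pair_big/= mulr_suml big_mkcond/=; apply: eq_bigr => v _.
  rewrite /F /pt ler_pdivlMr// (mulrC _ b); case: (P _); rewrite ?mul0r//=.
  by case: ifP; rewrite ?mul1r ?mul0r.
rewrite (_ : (fun t => _) = (fun t => (cnt P N (t / b))%:R * bose l t)); last exact/funext.
move=> i e; split=> //; rewrite e; apply: eq_bigr => v Pv.
by have [] := integral_bose_cond l0 (pos _ Pv).
Qed.

(** After [sum_logf_integral], be^2 times the count at radius t / be tends to c t^2 and is at most 4
    t^2, so convergence is dominated. The condition that n be(n) tends to infinity ensures that the
    box of side n + 2 eventually contains each disc of radius t / be(n). *)
Lemma main_sum P (c l : R) (be : nat -> R) : dens P c ->
  (forall v, P v -> v != (0, 0)%N) -> 0 < l -> (forall n, 0 < be n) ->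
  be n @[n --> \oo] --> (0 : R) -> (n%:R * be n) @[n --> \oo] --> +oo ->
  (be n ^+ 2 * \sum_(v : 'I_n.+2 * 'I_n.+2 | P (pt v))
      logf l (be n * nrm (pt v))) @[n --> \oo] -->
  2 * c * (zeta 3 - Li 3 (1 - l)).
Proof.
move=> Pc P0 l0 be0 bec /cvgryPgt nbe.
pose f_ n t := be n ^+ 2 * ((cnt P n.+2 (t / be n))%:R * bose l t).
have [ix2 ex2] := integral_x2bose l0.
have [n| | | |n t t0|_ cv] := @Rintegral_dominated R f_ (fun t => c * (t ^+ 2 * bose l t))
   (fun t => 4 * (t ^+ 2 * bose l t)).
- apply/measurable_EFinP; apply: (@measurable_int _ _ _ mu).
  by apply: integrable_scale => //; have [] := sum_logf_integral n.+2 l0 (be0 n) P0.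
- by apply/measurable_EFinP; apply: (@measurable_int _ _ _ mu); exact: integrable_scale.
- move=> t t0; apply/cvgrPdist_le => e e0.
  pose K := t ^+ 2 * bose l t; have K0 : 0 <= K by exact: mulr_ge0 (sqr_ge0 _) (bose_ge0 l0 t0).
  have e1 : 0 < e / (K + 1) by rewrite divr_gt0//; lra.
  have [r0 H] := Pc _ e1.
  near=> n.
  have bn := be0 n.
  have r0t : r0 <= t / be n.
    have : be n * Num.max 1 r0 < t.
      rewrite -ltr_pdivlMr ?lt_max ?ltr01//.
      near: n; apply: (@cvgr_lt R _ _ _ _ 0) => //.
      by rewrite divr_gt0// lt_max ltr01.
    rewrite ler_pdivlMr// mulrC => h; apply: le_trans (ltW h).
    by rewrite ler_wpM2r ?(ltW bn)// le_max lexx orbT.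
  have tn : t / be n < n.+2%:R.
    rewrite ltr_pdivrMr//; apply: (@lt_le_trans _ _ (n%:R * be n)).
      near: n; exact: nbe.
    by rewrite ler_wpM2r ?(ltW bn)// ler_nat -addn2 leq_addr.
  have := H _ _ r0t tn; set C := (cnt _ _ _)%:R => h.
  rewrite /f_ -/C distrC.
  have -> : be n ^+ 2 * (C * bose l t) - c * (t ^+ 2 * bose l t) =
     be n ^+ 2 * bose l t * (C - c * (t / be n) ^+ 2) by field; rewrite gt_eqF.
  have b2 : 0 <= be n ^+ 2 * bose l t by exact: mulr_ge0 (sqr_ge0 _) (bose_ge0 l0 t0).
  rewrite normrM (ger0_norm b2).
  apply: (@le_trans _ _ (be n ^+ 2 * bose l t * (e / (K + 1) * (t / be n) ^+ 2))).
    by rewrite ler_wpM2l.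
  have -> : be n ^+ 2 * bose l t * (e / (K + 1) * (t / be n) ^+ 2) = e / (K + 1) * K.
    by set w := e / (K + 1); rewrite /K; field; rewrite gt_eqF.
  by rewrite mulrAC ler_pdivrMr ?ler_wpM2l ?(ltW e0)//; lra.
- exact: integrable_scale.
- have bn := be0 n; have b1 := bose_ge0 l0 t0.
  have f0 : 0 <= f_ n t by rewrite /f_ (mulr_ge0 (sqr_ge0 _))// mulr_ge0.
  rewrite (ger0_norm f0) /f_.
  have := @cnt_le4 P n.+2 (t / be n) P0; rewrite divr_ge0 ?(ltW t0) ?(ltW bn)// => /(_ isT) h.
  set y := bose l t in b1 *.
  have -> : 4 * (t ^+ 2 * y) = be n ^+ 2 * (4 * (t / be n) ^+ 2 * y) by field; rewrite gt_eqF.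
  by rewrite ler_wpM2l ?sqr_ge0// ler_wpM2r.
move: cv; rewrite RintegralZl// ex2 mulrA (mulrC c).
apply: cvg_trans; apply: near_eq_cvg; apply: nearW => n.
have [i1 e1] := sum_logf_integral n.+2 l0 (be0 n) P0.
by rewrite /f_ RintegralZl// e1.
Unshelve. all: end_near. Qed.
End MainSum.

(** * Chains as multiplicity functions *)

Section ChainsOmega.
Variable n : nat.
Local Notation Q := ('I_n.+2 * 'I_n.+2)%type.
Implicit Types (om : {ffun Q -> 'I_n.+2}) (e f : int * int).

Definition edge (m : nat) (v : nat * nat) : int * int := ((m * v.1)%:Z, (m * v.2)%:Z).

(** Cross-multiplication stays correct for vertical edges, of slope +oo, because a nonzero quadrant
    edge of abscissa 0 has positive ordinate. *)
Lemma slope_lt e f : quadrant_edge e -> quadrant_edge f ->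
  (slope e < slope f)%O = (f.1 * e.2 < e.1 * f.2).
Proof.
case: e f => [a b] [a' b'] /and3P[/= e0 a0 b0] /and3P[/= f0 a0' b0'].
have pos (c d : int) : (c, d) != 0 -> c = 0 -> 0 <= d -> 0 < d.
  by move=> + c0; rewrite c0 lt0r => + ->; rewrite andbT; apply: contraNneq => ->.
rewrite /slope /=; case: (eqVneq a 0) => [az|a1]; case: (eqVneq a' 0) => [az'|a1'].
- by rewrite az az' !mul0r !ltxx.
- rewrite az mul0r ltNge leey/=; apply/esym/negbTE; rewrite -leNgt mulr_ge0//.
- rewrite az' mul0r ltey/= mulr_gt0 ?lt0r ?a1//.
  by have := pos _ _ f0 az' b0'; rewrite lt0r.
have a2 : 0 < a by rewrite lt0r a1.
have a2' : 0 < a' by rewrite lt0r a1'.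
rewrite lte_fin ltr_pdivrMr ?ltr0z// mulrAC ltr_pdivlMr ?ltr0z//.
by rewrite -!intrM ltr_int mulrC (mulrC b').
Qed.

Lemma edge_quadrant m v : (0 < m)%N -> prim v -> quadrant_edge (edge m v).
Proof.
case: v => a b m0 pv; rewrite /quadrant_edge /edge/= !lez_nat !leq0n !andbT.
apply: contraTneq pv => -[] /eqP + /eqP; rewrite !muln_eq0 !eqn0Ngt m0/= -!eqn0Ngt.
by move=> /eqP -> /eqP ->.
Qed.

Lemma prim_proportional v w : prim v -> prim w ->
  (v.1 * w.2 = w.1 * v.2)%N -> v = w.
Proof.
case: v w => [a b] [c d] /= pv pw e.
have ac : (a %| c)%N by rewrite -(Gauss_dvdl _ pv) -e dvdn_mulr.
have ca : (c %| a)%N by rewrite -(Gauss_dvdl _ pw) e dvdn_mulr.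
have {}ac : a = c by apply/eqP; rewrite eqn_dvd ac.
subst c; congr pair; move/eqP: e; case: (posnP a) => a0; last by rewrite eqn_pmul2l// => /eqP.
by move: pv pw; rewrite /prim /= a0 /coprime !gcd0n => /eqP -> /eqP ->.
Qed.

Lemma edge_slope m m' v w : (0 < m)%N -> (0 < m')%N -> prim v -> prim w ->
  slope (edge m v) = slope (edge m' w) -> v = w.
Proof.
move=> m0 m0' pv pw e; have q1 := edge_quadrant m0 pv; have q2 := edge_quadrant m0' pw.
apply: prim_proportional => //; apply/eqP.
have := slope_lt q1 q2; have := slope_lt q2 q1; rewrite e ltxx /= -!PoszM !ltz_nat.
move=> /esym/negbT; rewrite -leqNgt => h1 /esym/negbT; rewrite -leqNgt => h2.
have : (m * v.1 * (m' * w.2) == m' * w.1 * (m * v.2))%N by rewrite eqn_leq h1 h2.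
by rewrite mulnACA (mulnACA m') (mulnC m') eqn_pmul2l// muln_gt0 m0.
Qed.

(** A chain of length at most n + 1 has coordinates and multiplicities of edges at most n + 1; hence
    finite functions from [Q] to ['I_n.+2] suffice to describe it. *)
Definition primsupp om := [forall v, (0 < om v)%N ==> prim (pt v)].

Definition eseq om : seq (int * int) :=
  [seq edge (om v) (pt v) | v <- enum {: Q} & (0 < om v)%N].

Lemma pt_inj (N : nat) : injective (@pt N).
Proof. by move=> [a b] [c d] [/val_inj -> /val_inj ->]. Qed.

Lemma mem_eseq om e : reflect (exists2 v, (0 < om v)%N & e = edge (om v) (pt v)) (e \in eseq om).
Proof.
apply: (iffP mapP) => -[v]; first by rewrite mem_filter => /andP[v0 _] ->; exists v.
by move=> v0 ->; exists v => //; rewrite mem_filter v0; exact: mem_enum.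
Qed.

Lemma eseq_slope om : primsupp om -> uniq [seq slope e | e <- eseq om].
Proof.
move=> /forallP ps; rewrite -map_comp map_inj_in_uniq; first by apply: filter_uniq; exact: enum_uniq.
move=> v w; rewrite mem_filter => /andP[v0 _]; rewrite mem_filter => /andP[w0 _] /=.
move=> /edge_slope => /(_ v0 w0 (implyP (ps v) v0) (implyP (ps w) w0)); exact: pt_inj.
Qed.

Lemma eseq_quadrant om : primsupp om -> all quadrant_edge (eseq om).
Proof.
move=> /forallP ps; apply/allP => e /mem_eseq[v v0 ->].
by apply: edge_quadrant => //; exact: implyP (ps v) v0.
Qed.

Lemma eseq_inj om om' : primsupp om -> primsupp om' -> eseq om =i eseq om' -> om = om'.
Proof.
move=> p1 p2 E; wlog suff H : om om' p1 p2 E / forall v, (0 < om v)%N -> om v = om' v.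
  apply/ffunP => v; case: (posnP (om v)) => [v0|]; last exact: H.
  case: (posnP (om' v)) => [v0'|v0']; first by apply: val_inj; rewrite /= v0 v0'.
  by rewrite (H om' om)// => e; rewrite E.
move=> v v0; have : edge (om v) (pt v) \in eseq om' by rewrite -E; apply/mem_eseq; exists v.
have pv := implyP (forallP p1 v) v0.
move=> /mem_eseq[w w0 ew]; have pw := implyP (forallP p2 w) w0.
have /pt_inj vw : pt v = pt w by apply: (edge_slope v0 w0 pv pw); rewrite ew.
subst w; case: ew => /eqP e1 /eqP e2; apply/val_inj/eqP.
case: (posnP (pt v).1) => h1; last by rewrite -(eqn_pmul2r h1).
case: (posnP (pt v).2) => h2; last by rewrite -(eqn_pmul2r h2).
by move: pv; rewrite /prim h1 h2.
Qed.

Lemma edges_scanl (t : seq (int * int)) : edges (scanl +%R 0 t) = t.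
Proof. by rewrite /edges (@scanlK _ _ (fun p q => q - p))// => x y; rewrite addrC addKr. Qed.

Lemma edges_inj : injective edges.
Proof.
apply: (can_inj (g := scanl +%R 0)) => s.
by rewrite /edges (@pairmapK _ _ (fun p q => q - p) +%R)// => x y; rewrite addrC subrK.
Qed.

Lemma sorted_slope (t : seq (int * int)) :
  sorted (fun e f => (slope e < slope f)%O) t =
  uniq [seq slope e | e <- t] && sorted (fun e f => (slope e <= slope f)%O) t.
Proof.
rewrite -[LHS](@sorted_map _ _ slope (fun x y => (x < y)%O)) lt_sorted_uniq_le.
by rewrite sorted_map.
Qed.

Definition chain_of om : seq (int * int) :=
  scanl +%R 0 (sort (fun e f => (slope e <= slope f)%O) (eseq om)).

Lemma edges_chain_of om : perm_eq (edges (chain_of om)) (eseq om).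
Proof. by rewrite edges_scanl perm_sort. Qed.

Lemma convex_chain_of om : primsupp om -> convex_chain (chain_of om).
Proof.
move=> ps; rewrite /convex_chain (perm_all _ (edges_chain_of om)) eseq_quadrant//= edges_scanl.
rewrite sorted_slope.
rewrite (perm_uniq (perm_map slope (permEl (perm_sort _ _)))) eseq_slope//=.
by apply: sort_sorted => e f; exact: le_total.
Qed.

Lemma chain_of_inj om om' : primsupp om -> primsupp om' -> chain_of om = chain_of om' -> om = om'.
Proof.
move=> p1 p2 E; apply: eseq_inj => // e.
by rewrite -(perm_mem (edges_chain_of om)) E (perm_mem (edges_chain_of om')).
Qed.

(** A strictly sorted sequence is determined by its set of elements, and a chain by its edges. *)
Lemma convex_chain_perm s s' : convex_chain s -> convex_chain s' ->
  edges s =i edges s' -> s = s'.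
Proof.
move=> /andP[_ h1] /andP[_ h2] E; apply: edges_inj; apply: irr_sorted_eq h1 h2 E.
- by move=> e f g; exact: lt_trans.
- by move=> e; exact: ltxx.
Qed.

Lemma convex_slope_inj s e f : convex_chain s -> e \in edges s -> f \in edges s ->
  slope e = slope f -> e = f.
Proof.
move=> /andP[_]; rewrite sorted_slope => /andP[u _] es fs ef.
have := nth_uniq +oo%E (_ : (index e (edges s) < size [seq slope e | e <- edges s])%N)
  (_ : (index f (edges s) < size [seq slope e | e <- edges s])%N) u.
rewrite !size_map !index_mem => /(_ es fs).
rewrite !(nth_map 0) ?index_mem// !nth_index// ef eqxx => /esym/eqP.
by move=> /(congr1 (nth 0 (edges s))); rewrite !nth_index.
Qed.

Section WithR.
Context {R : realType}.

Lemma norm2_edge m v : norm2 (to_plane (edge m v) : R * R) = m%:R * nrm v.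
Proof. by rewrite /norm2/= -[RHS](@nrmM R m v.1 v.2). Qed.

Lemma chains_edge_bound (k : nat) s e : s \in chains R n k -> e \in edges s ->
  exists a b : nat, [/\ e = (a%:Z, b%:Z), (a < n.+2)%N, (b < n.+2)%N & (a, b) != (0, 0)%N].
Proof.
rewrite inE => -[/andP[q _] _ [_ len]] es; have := allP q _ es.
case: e es => [[a|a] [b|b]] es /and3P[/= e0 //= _ _].
have le : norm2 (to_plane (a%:Z, b%:Z) : R * R) <= n.+1%:R.
  apply: le_trans len; rewrite /chain_length (big_rem _ es)/= lerDl.
  by apply: sumr_ge0 => ? _; exact: sqrtr_ge0.
exists a, b; split=> //.
- rewrite ltnS -(ler_nat R); apply: le_trans le; exact: (@nrm_fst R (a, b)).
- rewrite ltnS -(ler_nat R); apply: le_trans le; exact: (@nrm_snd R (a, b)).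
Qed.

Lemma chains_eseq (k : nat) s : s \in chains R n k ->
  exists om, primsupp om /\ perm_eq (edges s) (eseq om).
Proof.
move=> sc; have cs : convex_chain s by move: sc; rewrite inE => -[].
(* At most one multiple of a given primitive vector is an edge, since slopes increase strictly; the
   [pick] therefore finds the only candidate, and the default [ord0] means that the direction is
   absent. *)
pose om : {ffun Q -> 'I_n.+2} := [ffun v => if prim (pt v) then
  odflt ord0 [pick m : 'I_n.+2 | (0 < m)%N && (edge m (pt v) \in edges s)] else ord0].
have omP v : (0 < om v)%N -> prim (pt v) /\ edge (om v) (pt v) \in edges s.
  rewrite ffunE; case: ifP => // pv; case: pickP => //= m /andP[m0 ms] _; by split.
have ps : primsupp om by apply/forallP => v; apply/implyP => /omP[].
exists om; split => //; apply: uniq_perm.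
- case/andP: cs => _; rewrite sorted_slope => /andP[u _]; exact: map_uniq u.
- exact: map_uniq (eseq_slope ps).
move=> e; apply/idP/mem_eseq => [es|[v v0 ->]]; last by have [] := omP v v0.
have [a [b [eE an bn ab0]]] := chains_edge_bound sc es.
pose d := gcdn a b.
have d0 : (0 < d)%N.
  by rewrite gcdn_gt0; move: ab0; case: (a) (b) => [|?] [|?].
have da : (d * (a %/ d) = a)%N by rewrite mulnC divnK// dvdn_gcdl.
have db : (d * (b %/ d) = b)%N by rewrite mulnC divnK// dvdn_gcdr.
have an' : (a %/ d < n.+2)%N by rewrite (leq_ltn_trans (leq_div _ _)).
have bn' : (b %/ d < n.+2)%N by rewrite (leq_ltn_trans (leq_div _ _)).
have dn : (d < n.+2)%N.
  case: (posnP a) => a0; first by rewrite /d a0 gcd0n.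
  by apply: leq_ltn_trans an; apply: dvdn_leq (dvdn_gcdl _ _).
pose v : Q := (Ordinal an', Ordinal bn').
have ev : e = edge d (pt v) by rewrite eE /edge/= da db.
have pv : prim (pt v).
  by rewrite /prim /coprime/= -(eqn_pmul2l d0) muln_gcdr da db muln1.
have v0 : (0 < om v)%N.
  rewrite ffunE pv; case: pickP => [m /andP[]//|/(_ (Ordinal dn))/=].
  by rewrite d0 -ev es.
exists v => //; have [_ oms] := omP v v0.
apply: (convex_slope_inj cs es oms); rewrite ev.
have q1 := edge_quadrant d0 pv; have q2 := edge_quadrant v0 pv.
apply/eqP; rewrite eq_le !leNgt !slope_lt// /edge/= -!PoszM !ltz_nat.
have E x y : (om v * x * (d * y) = d * x * (om v * y))%N.
  by rewrite mulnACA (mulnC (om v)) mulnACA.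
by rewrite -!leqNgt !E !leqnn.
Qed.

Lemma sum_eseq om (w : int * int -> R) :
  \sum_(e <- eseq om) w e = \sum_(v | (0 < om v)%N) w (edge (om v) (pt v)).
Proof. by rewrite big_map big_filter big_enum_cond. Qed.

Lemma size_eseq om : size (eseq om) = #|[pred v | (0 < om v)%N]|.
Proof. by rewrite -sum1_size big_map big_filter big_enum_cond sum1_card. Qed.

Definition omlen om : R := \sum_v (om v)%:R * nrm (pt v).

Lemma chain_length_perm s om : perm_eq (edges s) (eseq om) -> chain_length s = omlen om.
Proof.
move=> p; rewrite /chain_length (perm_big _ p)/= sum_eseq /omlen big_mkcond/=.
apply: eq_bigr => v _; rewrite norm2_edge; case: posnP => // ->; by rewrite mul0r.
Qed.

Lemma size_perm s om : perm_eq (edges s) (eseq om) -> size s = #|[pred v | (0 < om v)%N]|.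
Proof. by move=> /perm_size; rewrite size_pairmap size_eseq. Qed.

End WithR.
End ChainsOmega.

(** * Gibbs weights *)

Section Gibbs.
Context {R : realType} (n : nat).
Local Notation Q := ('I_n.+2 * 'I_n.+2)%type.
Local Notation nrm := (@nrm R).
Implicit Types (om : {ffun Q -> 'I_n.+2}) (P : pred (nat * nat)) (l b : Q -> R).

Definition supported P om := [forall v, (0 < om v)%N ==> P (pt v)].

(** [l] and [b] depend on the direction so that a tilt may act on some directions only. A
    configuration using a direction outside [P] gets weight 0, which lets sums run over all [om] and
    factorize. *)
Definition gw P l b om : R := \prod_v (if om v == 0%N :> nat then 1 else
  if P (pt v) then l v * expR (- (b v * ((om v)%:R * nrm (pt v)))) else 0).

(** Truncated because multiplicities lie in ['I_n.+2]; the distance to 1 / (e^x - 1) is the error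
    term of [gZ_ge]. *)
Definition geom (x : R) : R := \sum_(1 <= m < n.+2) expR (- (m%:R * x)).

Definition gZ P l b : R := \prod_(v | P (pt v)) (1 + l v * geom (b v * nrm (pt v))).

Lemma sum_gw P l b : \sum_om gw P l b om = gZ P l b.
Proof.
rewrite /gw -(bigA_distr_bigA (fun v (m : 'I_n.+2) => if m == 0%N :> nat then 1 else
  if P (pt v) then l v * expR (- (b v * (m%:R * nrm (pt v)))) else 0)).
rewrite /gZ [RHS]big_mkcond; apply: eq_bigr => v _.
rewrite big_ord_recl/=; case: (P _); last by rewrite big1 ?addr0.
congr (1 + _); rewrite /geom big_add1/= big_mkord mulr_sumr; apply: eq_bigr => m _.
by congr (_ * expR _); rewrite /bump/= add1n; ring.
Qed.

Lemma gw_ge0 P l b om : (forall v, 0 <= l v) -> 0 <= gw P l b om.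
Proof.
move=> l0; apply: prodr_ge0 => v _; case: ifP => // _; case: ifP => // _.
by rewrite mulr_ge0 ?expR_ge0.
Qed.

Definition energy l b om : R :=
  \sum_(v | (0 < om v)%N) ln (l v) - \sum_v b v * ((om v)%:R * nrm (pt v)).

Lemma gw_supported P l b om : (forall v, 0 < l v) -> supported P om ->
  gw P l b om = expR (energy l b om).
Proof.
move=> l0 /forallP sP; rewrite /gw /energy [X in X - _]big_mkcond/= -sumrB expR_sum.
apply: eq_bigr => v _; case: posnP => v0.
  by rewrite v0 mul0r mulr0 subr0 expR0.
by rewrite (implyP (sP v) v0) expRD lnK ?posrE.
Qed.

Lemma gw_unsupported P l b om : ~~ supported P om -> gw P l b om = 0.
Proof.
move=> /forallPn[v]; rewrite negb_imply => /andP[v0 /negbTE Pv].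
by rewrite /gw (bigD1 v)//= gtn_eqF// Pv mul0r.
Qed.

(** Change of measure: on [E] each weight is at most e^(-c) times the tilted weight, and the tilted
    weights are then summed over all configurations. *)
Lemma chernoff P l b l' b' (E : pred {ffun Q -> 'I_n.+2}) (c : R) :
  (forall v, 0 < l v) -> (forall v, 0 < l' v) ->
  (forall om, supported P om -> E om -> c + energy l b om <= energy l' b' om) ->
  \sum_(om | E om) gw P l b om <= expR (- c) * gZ P l' b'.
Proof.
move=> l0 l0' H; rewrite -sum_gw mulr_sumr [leRHS](bigID E)/=.
rewrite -[leLHS]addr0; apply: lerD; last first.
  by apply: sumr_ge0 => om _; rewrite mulr_ge0 ?expR_ge0// gw_ge0// => v; exact: ltW.
apply: ler_sum => om Eom; case: (boolP (supported P om)) => sP; last first.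
  by rewrite !gw_unsupported// mulr0.
rewrite !gw_supported// -expRD ler_expR; have := H _ sP Eom; lra.
Qed.

Lemma count_le P l b (E : pred {ffun Q -> 'I_n.+2}) (c : R) :
  (forall v, 0 < l v) ->
  (forall om, supported P om -> E om -> c <= energy l b om) ->
  #|[pred om | supported P om && E om]|%:R <= expR (- c) * gZ P l b.
Proof.
move=> l0 H; rewrite -sum_gw mulr_sumr -sum1_card natr_sum.
rewrite [leRHS](bigID (fun om => supported P om && E om))/=.
rewrite -[leLHS]addr0; apply: lerD; last first.
  by apply: sumr_ge0 => om _; rewrite mulr_ge0 ?expR_ge0// gw_ge0// => v; exact: ltW.
apply: ler_sum => om /andP[sP Eom].
rewrite gw_supported// -expRD -expR0 ler_expR; have := H _ sP Eom; lra.
Qed.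

Lemma geomE x : 0 < x -> geom x = (1 - expR (- (n.+1%:R * x))) / (expR x - 1).
Proof.
move=> x0; have e1 := expRB_gt0 (lexx 1) x0; have e0 := expR_gt0 x.
apply: (@mulIf _ (expR x - 1)); rewrite ?gt_eqF// divfK ?gt_eqF//.
rewrite /geom big_add1/= big_mkord.
under eq_bigr do rewrite -mulrN expRM_natl exprS.
rewrite -mulrN expRM_natl; set y := expR (- x).
have y1 : y * expR x = 1 by rewrite /y -expRD addNr expR0.
suff H m : (\sum_(i < m) y * y ^+ i) * (expR x - 1) = 1 - y ^+ m by exact: H.
elim: m => [|m IH]; first by rewrite big_ord0 mul0r expr0 subrr.
rewrite big_ord_recr/= mulrDl IH exprS.
have -> : y * y ^+ m * (expR x - 1) = y ^+ m * (y * expR x) - y * y ^+ m by ring.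
rewrite y1; ring.
Qed.

Lemma geom_ge0 x : 0 <= geom x.
Proof. by apply: sumr_ge0 => m _; exact: expR_ge0. Qed.

Lemma geom_le x : 0 < x -> geom x <= (expR x - 1)^-1.
Proof.
move=> x0; rewrite geomE// ler_piMl ?invr_ge0 ?ltW ?expRB_gt0//.
by have := expR_gt0 (- (n.+1%:R * x)); lra.
Qed.

Lemma gZ_le P l b : (forall v, 0 < l v) -> (forall v, P (pt v) -> 0 < b v * nrm (pt v)) ->
  gZ P l b <= expR (\sum_(v | P (pt v)) logf (l v) (b v * nrm (pt v))).
Proof.
move=> l0 b0; rewrite expR_sum; apply: ler_prod => v Pv.
have bv := b0 _ Pv; have e1 := expRB_gt0 (lexx 1) bv.
rewrite addr_ge0 ?mulr_ge0 ?geom_ge0 ?(ltW (l0 _))//= /logf lnK; last first.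
  by rewrite posrE addr_gt0// divr_gt0.
by rewrite lerD2l ler_wpM2l ?(ltW (l0 _))// geom_le.
Qed.

(** [err] bounds the loss by truncation for every direction, since b |v| >= b and e^x - 1 >= b;
    there are at most (n + 2)^2 directions. *)
Lemma gZ_ge P (l b : R) : 0 < l -> 0 < b -> (forall v, P v -> v != (0, 0)%N) ->
  expR (\sum_(v : Q | P (pt v)) logf l (b * nrm (pt v))
    - n.+2%:R ^+ 2 * (l * expR (- (n.+1%:R * b)) / b)) <= gZ P (fun=> l) (fun=> b).
Proof.
move=> l0 b0 P0; set err := l * _ / b.
have err0 : 0 <= err by rewrite divr_ge0 ?mulr_ge0 ?expR_ge0 ?ltW.
have -> : n.+2%:R ^+ 2 * err = \sum_(v : Q) err.
  by rewrite sumr_const card_prod card_ord -[err *+ _]mulr_natl natrM expr2.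
apply: (@le_trans _ _ (expR (\sum_(v : Q | P (pt v)) (logf l (b * nrm (pt v)) - err)))).
  rewrite ler_expR sumrB lerD2l lerN2 [leRHS](bigID (fun v : Q => P (pt v)))/=.
  by rewrite lerDl; apply: sumr_ge0.
rewrite expR_sum; apply: ler_prod => v Pv; rewrite expR_ge0/=.
have n1 := @nrm_ge1 R _ (P0 _ Pv).
set x := b * nrm (pt v); have bx : b <= x by rewrite ler_peMr// ltW.
have x0 : 0 < x by lra.
have e1 := expRB_gt0 (lexx 1) x0; have eb := expRB_gt0 (lexx 1) b0.
have xb : b <= expR x - 1 by have := expR_ge1Dx x; lra.
have g0 := geom_ge0 x.
have y0 : 0 < 1 + l * geom x by rewrite ltr_wpDr// mulr_ge0// ltW.
have z0 : 0 < 1 + l / (expR x - 1) by rewrite addr_gt0// divr_gt0.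
rewrite expRD /logf lnK ?posrE// expRN ler_pdivrMr ?expR_gt0//.
have err1 : 1 + err <= expR err by exact: expR_ge1Dx.
apply: (@le_trans _ _ ((1 + l * geom x) * (1 + err))); last by rewrite ler_pM2l.
have -> : l / (expR x - 1) = l * geom x + l * expR (- (n.+1%:R * x)) / (expR x - 1).
  by rewrite geomE//; field; rewrite gt_eqF.
have errx : l * expR (- (n.+1%:R * x)) / (expR x - 1) <= err.
  rewrite /err; apply: ler_pM.
  - by rewrite mulr_ge0 ?expR_ge0 ?ltW.
  - by rewrite invr_ge0 ltW.
  - by rewrite ler_pM2l// ler_expR lerN2 ler_pM2l ?ltr0n.
  - by rewrite lef_pV2 ?posrE.
have : 0 <= l * geom x * err by exact: mulr_ge0 (mulr_ge0 (ltW l0) g0) err0.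
lra.
Qed.

(** Doubling [l] at v multiplies its factor y = 1 + l q by 2 - 1/y, where y is at most [p] = 1 + l /
    (e^x0 - 1) on [D]; and 2 - 1/p = 2 (1 - 1/(2p)) <= 2 e^(-1/(2p)). The gain over the factor 2 is
    what [zeros_tail] exploits. *)
Lemma gZ_double P (D : pred Q) (l b x0 : R) : 0 < l -> 0 < b -> 0 < x0 ->
  (forall v, P v -> v != (0, 0)%N) ->
  (forall v, D v -> P (pt v)) -> (forall v, D v -> x0 <= b * nrm (pt v)) ->
  gZ P (fun v => if D v then 2 * l else l) (fun=> b) <=
  2 ^+ #|D| * expR (- (#|D|%:R / (2 * (1 + l / (expR x0 - 1))))) * gZ P (fun=> l) (fun=> b).
Proof.
move=> l0 b0 x00 P0 DP Dx; rewrite /gZ; set p := 1 + _.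
have ex0 := expRB_gt0 (lexx 1) x00.
have p0 : 0 < p by rewrite /p addr_gt0// divr_gt0.
have -> : 2 ^+ #|D| * expR (- (#|D|%:R / (2 * p))) =
    \prod_(v | P (pt v)) (if D v then 2 * expR (- (2 * p)^-1) else 1).
  rewrite -big_mkcondr/= (eq_bigl D); last first.
    by move=> v; rewrite andb_idl// => /DP.
  by rewrite (prodr_const D) exprMn -expRM_natl mulrN.
rewrite -big_split/=; apply: ler_prod => v Pv.
have n1 := @nrm_ge1 R _ (P0 _ Pv).
have g0 := geom_ge0 (b * nrm (pt v)).
case: ifP => Dv; last by rewrite mul1r lexx andbT addr_ge0// mulr_ge0// ltW.
rewrite addr_ge0 ?mulr_ge0 ?(ltW l0)//=.
set q := geom _ in g0 *.
have bn : 0 < b * nrm (pt v) by rewrite mulr_gt0//; lra.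
have qp : 1 + l * q <= p.
  rewrite lerD2l ler_wpM2l ?(ltW l0)//; apply: le_trans (geom_le bn) _.
  by rewrite lef_pV2 ?posrE ?expRB_gt0// lerD2r ler_expR Dx.
have e1 : 1 - (2 * p)^-1 <= expR (- (2 * p)^-1) by exact: expR_ge1Dx.
have y0 : 0 < 1 + l * q by rewrite ltr_wpDr// mulr_ge0// ltW.
apply: (@le_trans _ _ (2 * (1 - (2 * p)^-1) * (1 + l * q))); last first.
  by rewrite ler_pM2r// ler_pM2l.
have -> : 2 * (1 - (2 * p)^-1) = 2 - p^-1 by field; rewrite gt_eqF.
have : p^-1 * (1 + l * q) <= 1 by rewrite mulrC ler_pdivrMr// mul1r.
lra.
Qed.
End Gibbs.

(** * Counting chains through configurations, and completing configurations *)

Section CountChains.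
Context {R : realType} (n : nat).
Local Notation Q := ('I_n.+2 * 'I_n.+2)%type.
Local Notation nrm := (@nrm R).
Local Notation omlen := (@omlen n R).
Implicit Types (om : {ffun Q -> 'I_n.+2}) (P : pred (nat * nat)).

Lemma chains_card_le (k : nat) (C : set (seq (int * int))) (E : pred {ffun Q -> 'I_n.+2}) :
  C `<=` chains R n k ->
  (forall s om, C s -> primsupp om -> perm_eq (edges s) (eseq om) -> E om) ->
  (#|` fset_set C| <= #|[pred om | supported prim om && E om]|)%N.
Proof.
move=> CC CE; have finC := sub_finite_set CC (finite_chains R n k).
have H s : exists om, s \in chains R n k -> primsupp om /\ perm_eq (edges s) (eseq om).
  case: (boolP (s \in chains R n k)) => sc; last by exists [ffun=> ord0].
  by have [om h] := chains_eseq sc; exists om.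
have [f fP] := choice H.
have fC s : s \in fset_set C -> C s /\ (primsupp (f s) /\ perm_eq (edges s) (eseq (f s))).
  rewrite in_fset_set// => /set_mem Cs; split=> //; apply: fP; exact/mem_set/CC.
rewrite -(size_map f) cardE; apply: uniq_leq_size.
  rewrite map_inj_in_uniq ?fset_uniq// => s s' /fC[Cs [p1 e1]] /fC[Cs' [p2 e2]] ff.
  have [c1 _ _] := CC _ Cs; have [c2 _ _] := CC _ Cs'.
  apply: convex_chain_perm => // e.
  by rewrite (perm_mem e1) (perm_mem e2) ff.
move=> om /mapP[s /fC[Cs [p1 e1]] ->]; rewrite mem_enum inE /=.
by apply/andP; split; [exact: p1|exact: CE Cs p1 e1].
Qed.

Lemma chains_card_ge (k : nat) (E : pred {ffun Q -> 'I_n.+2}) :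
  (forall om, E om -> [/\ primsupp om, #|[pred v | (0 < om v)%N]| = k &
     n%:R <= omlen om <= n.+1%:R]) ->
  (#|E| <= pJ R n k)%N.
Proof.
move=> EP; rewrite /pJ cardE -(size_map (@chain_of n)).
apply: uniq_leq_size.
  rewrite map_inj_in_uniq ?enum_uniq// => om om'; rewrite !mem_enum => /EP[p1 _ _] /EP[p2 _ _].
  exact: chain_of_inj.
move=> s /mapP[om]; rewrite mem_enum => /EP[p1 e1 e2] ->.
rewrite in_fset_set; last exact: finite_chains.
apply/mem_set; have pe := edges_chain_of om.
split; first exact: convex_chain_of.
  by rewrite (size_perm pe).
by rewrite (chain_length_perm pe); apply/andP.
Qed.

Definition zeros (D : pred Q) om : pred Q := [pred v | D v && (om v == 0 :> nat)].

Definition nedges om : nat := #|[pred v | (0 < om v)%N]|.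

(** The direction reserved for the final correction: its primitive vector has norm 1, so that a
    multiple of it can bring the length into any window of width 1. *)
Definition v10 : Q := (inord 1, ord0).

Lemma pt_v10 : pt v10 = (1, 0)%N.
Proof. by rewrite /pt /v10/= inordK. Qed.

Section Completion.
Variables (D : pred Q) (k : nat).

(** [k.-1] rather than [k]: one edge is kept for the horizontal direction. *)
Definition added om : seq Q := take (k.-1 - nedges om) (enum (zeros D om)).

Definition partlen om : R := omlen om + \sum_(v <- added om) nrm (pt v).

(* [om] can be recovered from its completion and the set [added om], because
   [v10] is not in the support of an extendable [om]: hence the factor
   [2 ^ #|D|] in [card_extendable]. *)
Definition completion om : {ffun Q -> 'I_n.+2} :=
  [ffun v => if v == v10 then inord (Num.truncn (n%:R - partlen om)).+1
             else if v \in added om then inord 1 else om v].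

(** [T] stands for a bound of the norms on [D]; the last condition then ensures that the added edges
    do not push the length beyond n. *)
Definition extendable (T : R) om : bool :=
  [&& supported [pred v | prim v & v != (1, 0)%N] om, (nedges om <= k.-1)%N,
      (k.-1 - nedges om <= #|zeros D om|)%N &
      omlen om + (k.-1 - nedges om)%:R * T <= n%:R].

Lemma card_extendable (T : R) : (0 < k)%N ->
  (forall v, D v -> [/\ prim (pt v), pt v != (1, 0)%N & nrm (pt v) <= T]) ->
  (#|extendable T| <= 2 ^ #|D| * pJ R n k)%N.
Proof.
move=> k0 DP.
pose A om : {ffun Q -> bool} := [ffun v => v \in added om].
have addedP om v : v \in added om -> D v /\ om v = 0%N :> nat.
  by move=> /mem_take; rewrite mem_enum => /andP[? /eqP].
have uadd om : uniq (added om) by rewrite take_uniq// enum_uniq.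
have sadd om : extendable T om -> size (added om) = (k.-1 - nedges om)%N.
  by move=> /and4P[_ _ h _]; rewrite /added size_takel// -cardE.
have v10D : ~~ D v10 by apply/negP => /DP[_]; rewrite pt_v10.
have v10add om : v10 \notin added om by apply: contra v10D => /addedP[].
have v10om om : extendable T om -> om v10 = 0%N :> nat.
  move=> /and4P[/forallP/(_ v10) h _ _ _]; apply/eqP; rewrite -leqn0 leqNgt.
  by apply: contraL h => ->; rewrite inE pt_v10 eqxx andbF.
have plen om : extendable T om -> 0 <= partlen om <= n%:R.
  move=> eo; have /and4P[_ _ _ h] := eo; apply/andP; split.
    rewrite addr_ge0//; first by apply: sumr_ge0 => v _; rewrite mulr_ge0 ?nrm_ge0.
    by apply: sumr_ge0 => v _; exact: nrm_ge0.
  apply: le_trans h; rewrite lerD2l -(sadd _ eo) -sum1_size natr_sum mulr_suml.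
  by rewrite big_seq [leRHS]big_seq; apply: ler_sum => v /addedP[/DP[_ _ vT] _]; rewrite mul1r.
(* The successor has two effects: the horizontal edge is really present, so the count of edges is
   exact, and the total length, the partial length plus floor(n - partial length) + 1, lies between
   n and n + 1. *)
have aval om : extendable T om ->
    completion om v10 = (Num.truncn (n%:R - partlen om)).+1 :> nat.
  move=> eo; rewrite ffunE eqxx inordK// !ltnS.
  have /andP[p0 pn] := plen _ eo.
  rewrite -(ler_nat R); apply: (@le_trans _ _ (n%:R - partlen om)); last by rewrite gerBl.
  by rewrite truncn_le subr_ge0.
have cval om v : extendable T om -> completion om v =
    (om v + (v \in added om) + (v == v10) * (Num.truncn (n%:R - partlen om)).+1)%N :> nat.
  move=> eo; case: (eqVneq v v10) => [->|vv].
    by rewrite aval// v10om// (negbTE (v10add om)) mul1n.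
  rewrite ffunE (negbTE vv) mul0n addn0; case: ifP => va; last by rewrite addn0.
  by have [_ ->] := addedP _ _ va; rewrite inordK.
have n10 : nrm (pt v10) = 1 by rewrite pt_v10 /nrm/= expr1n expr0n addr0 sqrtr1.
have inj : {in extendable T &, injective (fun om => (A om, completion om))}.
  move=> om om' eo eo' [eA ec]; apply/ffunP => v; apply/val_inj.
  have /(congr1 (fun f : {ffun Q -> bool} => f v)) := eA; rewrite !ffunE => eAv.
  have /(congr1 (fun f : {ffun Q -> 'I_n.+2} => f v : nat)) := ec; rewrite !cval//.
  case: (eqVneq v v10) => [->|_]; first by rewrite /= !v10om.
  by rewrite !mul0n !addn0 eAv => /addIn.
have : (#|[seq (A om, completion om) | om in extendable T]| <=
    #|[predX (pffun_on false D predT : pred {ffun Q -> bool}) & [seq completion om | om in extendable T]]|)%N.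
  apply: subset_leq_card; apply/fintype.subsetP => x /fintype.imageP[om eo ->].
  rewrite !inE; apply/andP; split; last by apply/fintype.imageP; exists om.
  apply/pffun_onP; split=> //.
  by apply/fintype.subsetP => v; rewrite inE ffunE eqbF_neg negbK => /addedP[].
rewrite card_in_image// cardX card_pffun_on card_bool => /leq_trans; apply.
rewrite leq_mul2l; apply/orP; right.
apply: (@leq_trans #|[pred om' | om' \in [seq completion om | om in extendable T]]|).
  exact: subset_leq_card.
apply: chains_card_ge => om' /fintype.imageP[om eo ->].
have /and4P[so kk _ _] := eo.
have a1 : prim (pt v10) by rewrite pt_v10.
split.
- apply/forallP => v; apply/implyP; rewrite cval//.
  case: (eqVneq v v10) => [->//|_]; rewrite mul0n addn0.
  case: (boolP (v \in added om)) => [/addedP[/DP[]]//|_]; rewrite addn0 => v0.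
  by have := implyP (forallP so v) v0 => /andP[].
- rewrite -sum1_card big_mkcond/=.
  under eq_bigr => v _.
    rewrite (_ : (if _ then _ else _) = ((0 < om v) + (v \in added om) + (v == v10))%N); last first.
      rewrite inE cval//; case: (eqVneq v v10) => [->|_].
        by rewrite v10om// (negbTE (v10add om)).
      rewrite mul0n !addn0; case: (boolP (v \in added om)) => [/addedP[_ ->]//|_].
      by rewrite addn0; case: (0 < om v)%N.
    over.
  rewrite !big_split/=.
  have -> : (\sum_(v : Q) (v == v10) = 1)%N.
    by rewrite (bigD1 v10)//= eqxx big1// => v /negbTE ->.
  have -> : (\sum_(v : Q) (v \in added om) = size (added om))%N.
    by rewrite -big_mkcond/= sum1_card; exact/card_uniqP.
  have -> : (\sum_(v : Q) (0 < om v) = nedges om)%N.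
    by rewrite -big_mkcond/= sum1_card.
  by rewrite sadd// subnKC// addn1 prednK.
- have -> : omlen (completion om) = partlen om + (Num.truncn (n%:R - partlen om)).+1%:R :> R.
    have := fun v => cval om v eo; set t := (Num.truncn _).+1 => cv.
    clearbody t; rewrite /partlen /omlen; under eq_bigr do rewrite cv !natrD !mulrDl.
    rewrite !big_split/=; congr (_ + _ + _).
      rewrite [RHS]big_uniq//= [RHS]big_mkcond/=; apply: eq_bigr => v _.
      by case: (v \in added om); rewrite ?mul1r ?mul0r.
    rewrite (bigD1 v10)//= eqxx mul1n n10 mulr1 big1 ?addr0// => v /negbTE ->.
    by rewrite mul0n mul0r.
  have /andP[p0 pn] := plen _ eo; have pn' : 0 <= n%:R - partlen om by lra.
  have /andP[t1 t2] := truncn_itv pn'.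
  by rewrite -(natr1 n) -natr1 in t2 *; apply/andP; split; lra.
Qed.

End Completion.
End CountChains.

(** * Asymptotics of the number of chains *)

Section PartitionFunction.
Context {R : realType}.
Local Notation nrm := (@nrm R).
Implicit Types (P : pred (nat * nat)) (l : R).

(** The maximum with 1 alters only n = 0 and makes [rt n] at least 1 for every n. *)
Definition rt (n : nat) : R := Num.max 1 (n%:R `^ (1 / 3)).

Lemma rt_ge1 n : 1 <= rt n. Proof. by rewrite le_max lexx. Qed.

Lemma rt_gt0 n : 0 < rt n. Proof. exact: lt_le_trans (rt_ge1 n). Qed.

Lemma powR13X3 (x : R) : 0 <= x -> (x `^ (1 / 3)) ^+ 3 = x.
Proof.
move=> x0; rewrite -powR_mulrn ?powR_ge0// -powRrM (_ : 1 / 3 * 3%:R = 1) ?powRr1//.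
by field.
Qed.

Lemma powR23E (x : R) : 0 <= x -> x `^ (2 / 3) = (x `^ (1 / 3)) ^+ 2.
Proof.
by move=> x0; rewrite -powR_mulrn ?powR_ge0// -powRrM; congr (_ `^ _); field.
Qed.

Lemma rtE n : (0 < n)%N -> rt n = n%:R `^ (1 / 3).
Proof.
move=> n0; rewrite /rt; apply/max_idPr.
rewrite -[leLHS](powRr0 n%:R); apply: ler_powR; first by rewrite ler1n.
by rewrite divr_ge0.
Qed.

Lemma rtX3 n : (0 < n)%N -> rt n ^+ 3 = n%:R.
Proof. by move=> n0; rewrite rtE// powR13X3. Qed.

Lemma rtX2 n : (0 < n)%N -> rt n ^+ 2 = n%:R `^ (2 / 3).
Proof. by move=> n0; rewrite rtE// powR23E. Qed.

Lemma cvg_rt : rt n @[n --> \oo] --> +oo.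
Proof.
apply/cvgryPge => M; near=> n.
have n0 : (0 < n)%N by near: n; exact: nbhs_infty_gt.
have M3 : Num.max 1 M ^+ 3 <= n%:R by near: n; exact: nbhs_infty_ger.
apply: (@le_trans _ _ (Num.max 1 M)); first by rewrite le_max lexx orbT.
rewrite -(@ler_pXn2r _ 3)// ?nnegrE ?le_max ?ler01 ?(ltW (rt_gt0 _))//.
by rewrite rtX3.
Unshelve. all: end_near. Qed.

Lemma near_gt0 : \forall n \near \oo, (0 < n)%N.
Proof. exact: nbhs_infty_gt. Qed.

Lemma cvg_rtV : (rt n)^-1 @[n --> \oo] --> (0 : R).
Proof. by apply/gtr0_cvgV0; [apply: nearW => n; exact: rt_gt0|exact: cvg_rt]. Qed.

(* [dprim] is the asymptotic density of primitive vectors in the quadrant, [b0 l]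
   the critical inverse temperature. *)
Definition zA l : R := zeta 3 - Li 3 (1 - l).

Definition dprim : R := pi / 4 / zeta 2.

Lemma dprim_gt0 : 0 < dprim.
Proof. by rewrite /dprim divr_gt0 ?zeta2_gt0// divr_gt0// pi_gt0. Qed.

Definition b0 l : R := (4 * dprim * zA l) `^ (1 / 3).

Lemma zA_gt0 l : 0 < l -> 0 < zA l. Proof. exact: zeta3BLi3_gt0. Qed.

Lemma b0_gt0 l : 0 < l -> 0 < b0 l.
Proof. by move=> l0; apply/powR_gt0/(mulr_gt0 (mulr_gt0 _ dprim_gt0) (zA_gt0 l0)). Qed.

(** The criticality equation: minus the derivative of 2 dprim zA / b^2 in b is 4 dprim zA / b^3,
    which is the mean length divided by n. *)
Lemma b0X3 l : 0 < l -> b0 l ^+ 3 = 4 * dprim * zA l.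
Proof. by move=> l0; rewrite powR13X3//; apply/ltW/(mulr_gt0 (mulr_gt0 _ dprim_gt0) (zA_gt0 l0)). Qed.

Definition kap l : R := pi `^ (1 / 3) / 2 * c_param l.
Definition ent l : R := pi `^ (1 / 3) / 2 * e_entropy l.

Lemma powR_div (x y r : R) : 0 <= x -> 0 <= y -> (x / y) `^ r = x `^ r / y `^ r.
Proof.
move=> x0 y0; rewrite powRM ?invr_ge0// -[y^-1]powR_inv1// -powRrM mulN1r powRN.
by [].
Qed.

Lemma b0E l : 0 < l -> b0 l = pi `^ (1 / 3) * zA l `^ (1 / 3) / zeta 2 `^ (1 / 3).
Proof.
move=> l0; have A0 := zA_gt0 l0; have z0 := @zeta2_gt0 R; have p0 := pi_gt0 R.
rewrite /b0 (_ : 4 * dprim * zA l = pi * zA l / zeta 2); last first.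
  by rewrite /dprim; field; rewrite gt_eqF.
by rewrite powR_div ?powRM ?mulr_ge0// ltW.
Qed.

(** The right-hand side is [l] times the derivative in [l] of 2 dprim zA / b^2 at b = [b0 l]: the
    mean number of edges divided by n^(2/3). *)
Lemma kapE l : 0 < l -> kap l = 2 * dprim * (l * Li2_ratio l) / b0 l ^+ 2.
Proof.
move=> l0; have A0 := zA_gt0 l0; have z0 := @zeta2_gt0 R; have p0 := pi_gt0 R.
rewrite /kap /c_param -/(zA l) b0E// powR23E ?(ltW A0)//.
have := powR_gt0 (1 / 3) A0; set a := _ `^ _ => a0.
have := powR_gt0 (1 / 3) z0; have := powR13X3 (ltW z0).
have := powR_gt0 (1 / 3) p0; have := powR13X3 (ltW p0).
rewrite /dprim; set p := pi `^ _; set z := zeta 2 `^ _ => <- p0' <- z0'.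
by field; rewrite !gt_eqF.
Qed.

(** Entropy as the exponent of the partition function, which is b0 / 2 at the critical point, minus
    the exponent kap ln l - b0 of the common weight. *)
Lemma entE l : 0 < l -> ent l = 3 / 2 * b0 l - kap l * ln l.
Proof.
move=> l0; have A0 := zA_gt0 l0; have z0 := @zeta2_gt0 R; have p0 := pi_gt0 R.
rewrite /ent /kap /e_entropy /c_param -/(zA l) b0E//.
have -> : (zA l / zeta 2) `^ (1 / 3) = zA l `^ (1 / 3) / zeta 2 `^ (1 / 3).
  by rewrite powR_div// ltW.
have := powR_gt0 (1 / 3) z0; set z := zeta 2 `^ _ => z0'.
have := powR_gt0 (2 / 3) A0; set a2 := zA l `^ (2 / 3) => a20.
by field; rewrite !gt_eqF.
Qed.

Lemma kap_gt0 l : 0 < l -> 0 < kap l.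
Proof.
move=> l0; rewrite kapE// divr_gt0 ?exprn_gt0 ?b0_gt0// mulr_gt0//.
  by rewrite mulr_gt0// dprim_gt0.
by rewrite mulr_gt0// Li2_ratio_gt0.
Qed.

Definition Slog (n : nat) P l (b : R) : R :=
  \sum_(v : 'I_n.+2 * 'I_n.+2 | P (pt v)) logf l (b / rt n * nrm (pt v)).

Lemma cvg_Slog P (c l b : R) : dens P c -> (forall v, P v -> v != (0, 0)%N) ->
  0 < l -> 0 < b ->
  Slog n P l b / rt n ^+ 2 @[n --> \oo] --> 2 * c * zA l / b ^+ 2.
Proof.
move=> Pc P0 l0 bp.
have be0 n : 0 < b / rt n by rewrite divr_gt0// rt_gt0.
have be1 : b / rt n @[n --> \oo] --> (0 : R).
  by rewrite -(mulr0 b); apply: cvgMr; exact: cvg_rtV.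
have be2 : n%:R * (b / rt n) @[n --> \oo] --> +oo.
  apply/cvgryPge => M; near=> n.
  have n0 : (0 < n)%N by near: n; exact: nbhs_infty_gt.
  rewrite -rtX3// (_ : rt n ^+ 3 * _ = b * rt n ^+ 2); last first.
    by field; rewrite gt_eqF ?rt_gt0.
  have h : M / b <= rt n by near: n; move/cvgryPge: cvg_rt; exact.
  rewrite ler_pdivrMr// in h; apply: le_trans h _.
  by rewrite mulrC ler_pM2l// expr2 ler_peMr ?rt_ge1// ltW ?rt_gt0.
have := main_sum Pc P0 l0 be0 be1 be2 => h.
rewrite (_ : _ / b ^+ 2 = (b ^+ 2)^-1 * (2 * c * zA l)); last by rewrite mulrC.
rewrite (_ : (fun n => _) = (fun n => (b ^+ 2)^-1 * ((b / rt n) ^+ 2 *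
  \sum_(v : 'I_n.+2 * 'I_n.+2 | P (pt v)) logf l (b / rt n * nrm (pt v))))).
  exact: cvgMr.
apply/funext => n; rewrite /Slog; set S := \sum_(v | _) _.
by field; rewrite !gt_eqF ?rt_gt0.
Unshelve. all: end_near. Qed.
End PartitionFunction.

(** * Upper bounds on numbers of chains *)

Section UpperBound.
Context {R : realType}.
Local Notation nrm := (@nrm R).
Local Notation dprim := (@dprim R).
Local Notation rt := (@rt R).
Implicit Types (P : pred (nat * nat)) (l : R).

Definition seclen P (s : seq (int * int)) : R :=
  \sum_(e <- edges s | P (`|e.1|%N, `|e.2|%N)) norm2 (to_plane e).

Definition scale_invariant P := forall d a b, (0 < d)%N -> P ((d * a)%N, (d * b)%N) = P (a, b).

Lemma seclen_perm (n : nat) P s (om : {ffun 'I_n.+2 * 'I_n.+2 -> 'I_n.+2}) :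
  scale_invariant P -> perm_eq (edges s) (eseq om) ->
  seclen P s = \sum_(v | P (pt v)) (om v)%:R * nrm (pt v).
Proof.
move=> PZ p; rewrite /seclen big_mkcond/= (perm_big _ p)/= sum_eseq.
rewrite big_mkcond [RHS]big_mkcond/=; apply: eq_bigr => v _.
case: posnP => v0; first by rewrite v0 mul0r; case: ifP.
by rewrite PZ// norm2_edge.
Qed.

Lemma energy_tilt (n : nat) P l (b1 b2 : R) (om : {ffun 'I_n.+2 * 'I_n.+2 -> 'I_n.+2}) :
  energy (fun=> l) (fun v => if P (pt v) then b1 else b2) om =
  (nedges om)%:R * ln l - b2 * omlen om + (b2 - b1) * \sum_(v | P (pt v)) (om v)%:R * nrm (pt v).
Proof.
rewrite /energy sumr_const -[ln l *+ _]mulr_natl -addrA; congr (_ + _).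
rewrite /omlen !mulr_sumr -!sumrN [X in _ + X]big_mkcond/= -big_split/=.
by apply: eq_bigr => v _; case: ifP => _; ring.
Qed.

(** Directions in [P] get the smaller inverse temperature [b1], so a length at least [M] in [P]
    raises the energy by (b2 - b1) M / rt n. [count_le] is applied with the resulting lower bound on
    the energy, and the partition function splits over [P] and its complement. *)
Lemma card_upper (n k : nat) P l (b1 b2 M : R) (C : set (seq (int * int))) :
  scale_invariant P -> 0 < l -> 0 < b1 -> b1 <= b2 -> C `<=` chains R n k ->
  (forall s, C s -> M <= seclen P s) ->
  #|` fset_set C|%:R <= expR (
    - (k%:R * ln l) + b2 / rt n * n.+1%:R - (b2 - b1) / rt n * M
    + Slog n [pred v | prim v & P v] l b1 + Slog n [pred v | prim v & ~~ P v] l b2) :> R.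
Proof.
move=> PZ l0 b10 b12 CC CM.
have r0 := @rt_gt0 R n.
pose E (om : {ffun 'I_n.+2 * 'I_n.+2 -> 'I_n.+2}) := [&& nedges om == k,
  omlen om <= n.+1%:R :> R & M <= \sum_(v | P (pt v)) (om v)%:R * nrm (pt v)].
pose bb (v : 'I_n.+2 * 'I_n.+2) := if P (pt v) then b1 / rt n else b2 / rt n.
pose y := k%:R * ln l - b2 / rt n * n.+1%:R + (b2 - b1) / rt n * M.
have h1 : (#|` fset_set C| <= #|[pred om | supported prim om && E om]|)%N.
  apply: (chains_card_le CC) => s om Cs _ pe; have [_ sk [_ len]] := CC _ Cs.
  apply/and3P; split.
  - by rewrite -sk (size_perm pe).
  - by rewrite -(chain_length_perm pe).
  - by rewrite -(seclen_perm PZ pe); exact: CM.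
have h2 : #|[pred om | supported prim om && E om]|%:R <= expR (- y) * gZ prim (fun=> l) bb.
  apply: count_le => // om _ /and3P[/eqP kE L1 M1].
  rewrite energy_tilt kE /y.
  have b2r : 0 <= b2 / rt n by rewrite divr_ge0//; lra.
  have bbr : 0 <= (b2 - b1) / rt n by rewrite divr_ge0//; lra.
  have := ler_wpM2l b2r L1; have := ler_wpM2l bbr M1.
  by rewrite -mulrBl; lra.
have h3 : gZ prim (fun=> l) bb <= expR (Slog n [pred v | prim v & P v] l b1 + Slog n [pred v | prim v & ~~ P v] l b2).
  apply: le_trans (gZ_le _ _) _ => //.
    move=> v pv; rewrite mulr_gt0//; first by rewrite /bb; case: ifP => _; rewrite divr_gt0//; lra.
    have : pt v != (0, 0)%N by apply: contraTneq pv => ->.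
    by move=> /(@nrm_ge1 R); lra.
  rewrite ler_expR (bigID (fun v => P (pt v)))/= /Slog le_eqVlt; apply/orP; left; apply/eqP.
  congr (_ + _); apply: eq_bigr => v /andP[_].
    by rewrite /bb => ->.
  by rewrite /bb => /negbTE ->.
rewrite -(ler_nat R) in h1; apply: le_trans h1 _; apply: le_trans h2 _.
apply: le_trans (ler_wpM2l (expR_ge0 _) h3) _.
by rewrite -expRD ler_expR /y; lra.
Qed.

(** Second-order cost of multiplying an inverse temperature by 1 - s. It holds for both signs of s,
    so it serves the upper and the lower tail of the length. *)
Lemma tilt_ineq (s : R) : `|s| <= 4^-1 -> ((1 - s) ^- 2 - 1) / 2 - s <= 3 * s ^+ 2.
Proof.
rewrite ler_norml => /andP[s1 s2]; have h : 0 < 1 - s by lra.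
rewrite lerBlDr ler_pdivrMr// lerBlDr.
rewrite -[leLHS]mul1r ler_pdivrMr ?exprn_gt0//.
have -> : ((3 * s ^+ 2 + s) * 2 + 1) * (1 - s) ^+ 2 = 1 + s ^+ 2 * (3 - 10 * s + 6 * s ^+ 2) by ring.
by rewrite lerDl mulr_ge0 ?sqr_ge0//; have := sqr_ge0 s; lra.
Qed.

Section Sequence.
Variables (l : R) (k : nat -> nat).
Hypothesis l0 : 0 < l.
Hypothesis hk : (k n)%:R / rt n ^+ 2 @[n --> \oo] --> kap l.
Local Notation b0 := (b0 l).
Local Notation E := (ent l).

Lemma cvg_np1 : n.+1%:R / rt n ^+ 3 @[n --> \oo] --> (1 : R).
Proof.
have h : 1 + (rt n)^-1 * ((rt n)^-1 * (rt n)^-1) @[n --> \oo] --> (1 + 0 * (0 * 0) : R).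
  by apply: cvgD; [exact: cvg_cst|apply: cvgM; [exact: cvg_rtV|apply: cvgM; exact: cvg_rtV]].
rewrite mul0r addr0 in h; apply: cvg_trans h; apply: near_eq_cvg.
near=> n; have n0 : (0 < n)%N by near: n; exact: near_gt0.
by rewrite -natr1 -(rtX3 n0); field; rewrite gt_eqF ?rt_gt0.
Unshelve. all: end_near. Qed.

Lemma cvg_n : n%:R / rt n ^+ 3 @[n --> \oo] --> (1 : R).
Proof.
apply: (@cvg_trans _ ((fun=> 1) @ \oo)); last exact: cvg_cst.
apply: near_eq_cvg; near=> n; have n0 : (0 < n)%N by near: n; exact: near_gt0.
by rewrite -(rtX3 n0) divff// gt_eqF// exprn_gt0// rt_gt0.
Unshelve. all: end_near. Qed.

(** [phi] is the share of the length imposed on [P], while c1 / dprim is its share of the primitive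
    vectors. To first order in s the correction is b0 s (c1 / dprim - phi), negative as soon as [P]
    carries more than its share. *)
Lemma upper_exponent P (c1 s phi : R) : `|s| <= 4^-1 -> 0 <= s ->
  dens [pred v | prim v & P v] c1 -> dens [pred v | prim v & ~~ P v] (dprim - c1) ->
  (- ((k n)%:R * ln l) + b0 / rt n * n.+1%:R - (b0 - b0 * (1 - s)) / rt n * (phi * n%:R)
    + Slog n [pred v | prim v & P v] l (b0 * (1 - s)) + Slog n [pred v | prim v & ~~ P v] l b0)
    / rt n ^+ 2 @[n --> \oo] -->
  E + b0 * (c1 / dprim * (((1 - s) ^- 2 - 1) / 2) - s * phi).
Proof.
move: (l0) (hk) => ? ? s1 s0 d1 d2.
have [bp A0 d0] : [/\ 0 < b0, 0 < zA l & 0 < dprim].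
  by split; [exact: b0_gt0|exact: zA_gt0|exact: dprim_gt0].
have s4 : 0 < 1 - s by move: s1; rewrite ler_norml; lra.
have P1 v : [pred v | prim v & P v] v -> v != (0, 0)%N.
  by move=> /andP[pv _]; apply: contraTneq pv => ->.
have P2 v : [pred v | prim v & ~~ P v] v -> v != (0, 0)%N.
  by move=> /andP[pv _]; apply: contraTneq pv => ->.
have bs : 0 < b0 * (1 - s) by rewrite mulr_gt0.
have H1 := cvg_Slog d1 P1 l0 bs; have H2 := cvg_Slog d2 P2 l0 bp.
have -> : E + b0 * (c1 / dprim * (((1 - s) ^- 2 - 1) / 2) - s * phi) =
  - (kap l * ln l) + b0 * 1 - (b0 * s * phi) * 1 + 2 * c1 * zA l / (b0 * (1 - s)) ^+ 2
   + 2 * (dprim - c1) * zA l / b0 ^+ 2.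
  rewrite entE//; have Ae : zA l = b0 ^+ 3 / (4 * dprim) by rewrite b0X3//; field; rewrite gt_eqF.
  rewrite Ae; set bb := b0 in bp *; set kk := kap l * _.
  by field; rewrite !gt_eqF.
rewrite (_ : (fun n => _) = (fun n => - ((k n)%:R / rt n ^+ 2 * ln l)
  + b0 * (n.+1%:R / rt n ^+ 3) - b0 * s * phi * (n%:R / rt n ^+ 3)
  + Slog n [pred v | prim v & P v] l (b0 * (1 - s)) / rt n ^+ 2
  + Slog n [pred v | prim v & ~~ P v] l b0 / rt n ^+ 2)).
  apply: cvgD => //; apply: cvgD => //; apply: cvgB; last by apply: cvgMr; exact: cvg_n.
  apply: cvgD; last by apply: cvgMr; exact: cvg_np1.
  by apply: cvgN; apply: cvgMl.
apply/funext => n; have r0 := @rt_gt0 R n.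
by set S1 := Slog _ _ _ _; set S2 := Slog _ _ _ _; set bb := b0; field; rewrite gt_eqF.
Qed.

Lemma few_long_sectors P (c1 dl : R) : scale_invariant P -> 0 <= c1 <= dprim -> 0 < dl ->
  dens [pred v | prim v & P v] c1 -> dens [pred v | prim v & ~~ P v] (dprim - c1) ->
  exists2 ga : R, 0 < ga & \forall n \near \oo, forall C : set (seq (int * int)),
    C `<=` chains R n (k n) -> (forall s, C s -> (c1 / dprim + dl) * n%:R <= seclen P s) ->
    #|` fset_set C|%:R <= expR ((E - ga) * rt n ^+ 2) :> R.
Proof.
move: (l0) (hk) => ? ? PZ /andP[c10 c1d] dl0 d1 d2.
have bp := b0_gt0 l0; have d0 := @dprim_gt0 R.
(* s <= dl / 6 makes the second-order cost 3 s^2 at most half of the gain s dl. The exponent drops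
   by b0 s dl / 2, and half of this is kept as the final rate. *)
pose s := Num.min 4^-1 (dl / 6).
have s0 : 0 < s by rewrite lt_min; lra.
have s4 : s <= 4^-1 by rewrite ge_min lexx.
have s6 : s <= dl / 6 by rewrite ge_min lexx orbT.
have s1 : `|s| <= 4^-1 by rewrite ger0_norm// ltW.
have u1 : c1 / dprim <= 1 by rewrite ler_pdivrMr// mul1r.
have u0 : 0 <= c1 / dprim by rewrite divr_ge0// ltW.
have U := @upper_exponent P c1 s (c1 / dprim + dl) s1 (ltW s0) d1 d2.
have lim : E + b0 * (c1 / dprim * (((1 - s) ^- 2 - 1) / 2) - s * (c1 / dprim + dl)) <= E - b0 * (s * dl / 2).
  rewrite lerD2l -[leRHS]mulrN ler_pM2l//.
  have := ler_wpM2l u0 (tilt_ineq s1); have : 3 * s ^+ 2 <= s * dl / 2 by nra.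
  have := sqr_ge0 s; nra.
have g0 : 0 < b0 * (s * dl / 4) by rewrite mulr_gt0// divr_gt0// mulr_gt0.
exists (b0 * (s * dl / 4)) => //.
near=> n => C CC CM.
have bs0 : 0 < b0 * (1 - s) by rewrite mulr_gt0//; lra.
have bs1 : b0 * (1 - s) <= b0 by rewrite ler_piMr ?(ltW bp)//; lra.
apply: le_trans (card_upper PZ l0 bs0 bs1 CC CM) _.
rewrite ler_expR -ler_pdivrMr ?exprn_gt0 ?rt_gt0//; apply: ltW.
near: n; apply: (cvgr_lt _ U).
by apply: le_lt_trans lim _; rewrite ltrD2l ltrN2 ltr_pM2l//; nra.
Unshelve. all: end_near. Qed.

(** The case s = 0 of [upper_exponent], without tilt: all directions are in [P] and the constraint
    on their length is void. *)
Lemma chains_card_upper (ep : R) : 0 < ep ->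
  dens [pred v | prim v & v != (0, 0)%N] dprim ->
  \forall n \near \oo, (pJ R n (k n))%:R <= expR ((E + ep) * rt n ^+ 2) :> R.
Proof.
move: (l0) (hk) => ? ? ep0 d1.
have bp := b0_gt0 l0; have d0 := @dprim_gt0 R.
have d2 : dens [pred v | prim v & ~~ (v != (0, 0)%N)] (dprim - dprim).
  have := dens_diff d1 d1; rewrite subrr => /(_ (fun v => id)).
  by apply: eq_dens => v /=; case: eqP => [->|]; rewrite ?andbF ?andbN.
have s1 : `|0 : R| <= 4^-1 by rewrite normr0 invr_ge0.
have U := @upper_exponent (fun v => v != (0, 0)%N) dprim 0 0 s1 (lexx 0) d1 d2.
have PZ : scale_invariant (fun v => v != (0, 0)%N).
  by move=> d a b d0'; rewrite !xpair_eqE !muln_eq0 (gtn_eqF d0').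
have b1 : b0 * (1 - 0) <= b0 by rewrite subr0 mulr1.
have b2 : 0 < b0 * (1 - 0) by rewrite subr0 mulr1.
near=> n.
have sub : chains R n (k n) `<=` chains R n (k n) by [].
have M0 s : chains R n (k n) s -> 0 * n%:R <= seclen (fun v => v != (0, 0)%N) s.
  by move=> _; rewrite mul0r; apply: sumr_ge0 => e _; exact: sqrtr_ge0.
apply: le_trans (card_upper PZ l0 b2 b1 sub M0) _.
rewrite ler_expR -ler_pdivrMr ?exprn_gt0 ?rt_gt0//; apply: ltW.
near: n; apply: (cvgr_lt _ U).
by rewrite subr0 expr1n invr1 subrr mul0r !mulr0 subr0 mulr0 addr0 ltrDl.
Unshelve. all: end_near. Qed.

End Sequence.
End UpperBound.

(** * Lower bound on the number of chains *)

Section ReducedVectors.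
Context {R : realType}.
Local Notation nrm := (@nrm R).
Local Notation dprim := (@dprim R).
Local Notation rt := (@rt R).
Implicit Types (P : pred (nat * nat)) (l : R).

(** (1, 0) is left free for the horizontal edge of the completion; removing one vector does not
    change the density. *)
Definition reduced : pred (nat * nat) := [pred v | prim v & v != (1, 0)%N].

Lemma reduced_neq0 v : reduced v -> v != (0, 0)%N.
Proof. by move=> /andP[pv _]; apply: contraTneq pv => ->. Qed.

Lemma dens_point (w : nat * nat) : dens (fun v => v == w) (0 : R).
Proof.
move=> e e0; exists (Num.max 1 (e^-1)) => r N; rewrite ge_max => /andP[r1 re] rN.
have : (cnt (fun v => v == w) N r <= 1)%N.
  rewrite cntE; apply/card_le1_eqP => -[a b] [a' b']; rewrite !inE/=.
  by move=> /andP[/eqP <- _] /andP[/eqP[/val_inj -> /val_inj ->] _].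
rewrite -(ler_nat R) mul0r subr0 ger0_norm// => /le_trans; apply.
have : e * e^-1 <= e * r by rewrite ler_pM2l.
by rewrite mulfV ?gt_eqF// => h; nra.
Qed.

Lemma scale_invariant_neq0 : scale_invariant (fun v => v != (0, 0)%N).
Proof. by move=> d a b d0; rewrite !xpair_eqE !muln_eq0 (gtn_eqF d0). Qed.

Lemma dens_allprim : dens [pred v | prim v & v != (0, 0)%N] dprim.
Proof.
have p4 : 0 <= pi / 4 :> R by rewrite divr_ge0// ltW// pi_gt0.
have := @dens_prim R _ _ scale_invariant_neq0 _ p4 (@dens_quadrant R).
by move=> /(_ isT); apply: eq_dens => v /=; rewrite andbC.
Qed.

Lemma dens_reduced : dens reduced dprim.
Proof.
have sub v : v == (1, 0)%N -> [pred v | prim v & v != (0, 0)%N] v by move=> /eqP ->.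
have := dens_diff dens_allprim (@dens_point (1, 0)%N) sub; rewrite subr0.
by apply: eq_dens => v /=; case: (eqVneq v (0, 0)%N) => [->|]; rewrite ?andbT.
Qed.

Section LowerBound.
Variables (l : R) (k : nat -> nat) (eta x0 : R).
Hypotheses (l0 : 0 < l) (hk : (k n)%:R / rt n ^+ 2 @[n --> \oo] --> kap l).
Hypotheses (eta0 : 0 < eta) (x00 : 0 < x0).
Local Notation b0 := (b0 l).
Let b := (1 + eta) * b0.
Let be n := b / rt n.
Let X := 2 * dprim * zA l / b ^+ 2.
Let gwn n (om : {ffun 'I_n.+2 * 'I_n.+2 -> 'I_n.+2}) : R := gw reduced (fun=> l) (fun=> be n) om.

Let bp : 0 < b. Proof. by rewrite mulr_gt0 ?b0_gt0// addr_gt0. Qed.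
Let be0 n : 0 < be n. Proof. by rewrite divr_gt0// rt_gt0. Qed.

Let XE : X = b0 / 2 / (1 + eta) ^+ 2.
Proof.
have h1 : 0 < 1 + eta by rewrite addr_gt0.
have h2 := b0_gt0 l0; have d0 := @dprim_gt0 R.
have Ae : zA l = b0 ^+ 3 / (4 * dprim) by rewrite b0X3//; field; rewrite gt_eqF.
by rewrite /X /b Ae; set bb := b0 in h2 *; field; rewrite !gt_eqF.
Qed.

Let cS (l' b' : R) : 0 < l' -> 0 < b' ->
  Slog n reduced l' b' / rt n ^+ 2 @[n --> \oo] --> 2 * dprim * zA l' / b' ^+ 2.
Proof. by move=> h1 h2; apply: cvg_Slog => //; [exact: dens_reduced|exact: reduced_neq0]. Qed.

Let gZle n (l' b' : R) : 0 < l' -> 0 < b' ->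
  gZ reduced (fun _ : 'I_n.+2 * 'I_n.+2 => l') (fun=> b' / rt n) <= expR (Slog n reduced l' b').
Proof.
move=> h1 h2; apply: gZ_le => // v /reduced_neq0/(@nrm_ge1 R) h.
by rewrite mulr_gt0 ?divr_gt0 ?rt_gt0//; lra.
Qed.

Lemma gZ_lower (ga : R) : 0 < ga ->
  \forall n \near \oo, expR ((X - ga) * rt n ^+ 2) <=
    gZ reduced (fun _ : 'I_n.+2 * 'I_n.+2 => l) (fun=> be n).
Proof.
move: (l0) (bp) => ? ? ga0.
have c1 := cS l0 bp.
(* The truncation error of [gZ_ge] divided by rt^2: bound n + 2 by 2 (n + 1) and e^(-y) by 6 / y^3
   at y = (n + 1) b / rt, then use rt^3 = n. *)
have c2 : 24 * l / b ^+ 4 * (rt n)^-1 @[n --> \oo] --> (24 * l / b ^+ 4 * 0 : R).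
  by apply: cvgMr; exact: cvg_rtV.
rewrite mulr0 in c2.
have c3 : Slog n reduced l b / rt n ^+ 2 - 24 * l / b ^+ 4 * (rt n)^-1 @[n --> \oo] --> X - 0.
  exact: cvgB c1 c2.
rewrite subr0 in c3.
near=> n.
have n0 : (0 < n)%N by near: n; exact: near_gt0.
have r0 := @rt_gt0 R n; have ben := be0 n.
apply: le_trans (gZ_ge n l0 ben reduced_neq0); rewrite ler_expR -/(Slog n reduced l b).
rewrite -ler_pdivlMr ?exprn_gt0// mulrBl.
apply: (@le_trans _ _ (Slog n reduced l b / rt n ^+ 2 - 24 * l / b ^+ 4 * (rt n)^-1)).
  apply: ltW; near: n; apply: (cvgr_gt _ c3); lra.
rewrite lerD2l lerN2.
have n1 : 0 < n.+1%:R :> R by rewrite ltr0n.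
have y0 : 0 < n.+1%:R * be n by rewrite mulr_gt0.
have e3 := expRN_le 3 y0; rewrite (_ : 3`!%:R = 6 :> R)// in e3.
apply: (@le_trans _ _ ((2 * n.+1%:R) ^+ 2 * (l * (6 / (n.+1%:R * be n) ^+ 3) / be n) / rt n ^+ 2)).
  rewrite ler_pM2r ?invr_gt0 ?exprn_gt0//; apply: ler_pM.
  - by rewrite exprn_ge0.
  - exact: divr_ge0 (mulr_ge0 (ltW l0) (expR_ge0 _)) (ltW ben).
  - by rewrite lerXn2r ?nnegrE ?mulr_ge0// -natrM ler_nat mul2n -addnn addSn ltnS leq_addl.
  - by rewrite ler_pM2r ?invr_gt0// ler_pM2l.
have -> : (2 * n.+1%:R) ^+ 2 * (l * (6 / (n.+1%:R * be n) ^+ 3) / be n) / rt n ^+ 2 =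
   24 * l / b ^+ 4 * (rt n ^+ 2 / n.+1%:R).
  have bn : b != 0 by rewrite gt_eqF.
  by rewrite /be; set bb := b in bn *; field; rewrite ?bn ?gt_eqF.
have q0 : 0 < 24 * l / b ^+ 4 by apply: divr_gt0 (exprn_gt0 _ bp); rewrite mulr_gt0.
rewrite ler_pM2l// ler_pdivrMr// -ler_pdivrMl ?invr_gt0// invrK.
by rewrite -exprS rtX3// ler_nat.
Unshelve. all: end_near. Qed.

(** Chernoff bound with [b] replaced by b (1 - s), around the typical length n / (1 + eta)^3. The
    sign of s selects the tail: s > 0 for too long, s < 0 for too short, in which case u < 0. *)
Lemma length_tail (u s : R) : `|s| <= 4^-1 -> 3 * s ^+ 2 < s * u ->
  exists2 ga : R, 0 < ga & \forall n \near \oo,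
  \sum_(om : {ffun 'I_n.+2 * 'I_n.+2 -> 'I_n.+2} |
    s * ((1 + u) / (1 + eta) ^+ 3 * n%:R) <= s * omlen om) gwn om <= expR ((X - ga) * rt n ^+ 2).
Proof.
move: (l0) (bp) (XE) => ? ? XE' s1 su.
have h1 : 0 < 1 + eta by rewrite addr_gt0.
have s2 : 0 < 1 - s by move: s1; rewrite ler_norml; lra.
have bs : 0 < b * (1 - s) by rewrite mulr_gt0.
have X0 : 0 < X by rewrite XE' divr_gt0 ?exprn_gt0// divr_gt0// b0_gt0.
pose g := 2 * X * (s * u - 3 * s ^+ 2).
have g0 : 0 < g by apply: mulr_gt0; [exact: mulr_gt0|rewrite subr_gt0].
have c1 : Slog n reduced l (b * (1 - s)) / rt n ^+ 2
    - s * b * ((1 + u) / (1 + eta) ^+ 3) * (n%:R / rt n ^+ 3) @[n --> \oo] -->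
    2 * dprim * zA l / (b * (1 - s)) ^+ 2 - s * b * ((1 + u) / (1 + eta) ^+ 3) * 1.
  by apply: cvgB; [exact: cS|apply: cvgMr; exact: cvg_n].
exists (g / 2); first by rewrite divr_gt0.
near=> n.
have r0 := @rt_gt0 R n; have ben := be0 n.
pose c := s * be n * ((1 + u) / (1 + eta) ^+ 3 * n%:R).
apply: le_trans (@chernoff _ _ reduced (fun=> l) _ (fun=> l) (fun=> b * (1 - s) / rt n) _ c _ _ _) _ => //.
  move=> om _ Eom; rewrite /energy -!mulr_sumr -/(omlen om).
  set K := \sum_(v | _) _; set L := omlen om in Eom *.
  have := ler_wpM2l (ltW ben) Eom; rewrite /c /be; set t := (rt n)^-1.
  by set a := (1 + u) / _ * _; lra.
apply: le_trans (ler_wpM2l (expR_ge0 _) (gZle n l0 bs)) _.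
rewrite -expRD ler_expR -ler_pdivrMr ?exprn_gt0//.
have -> : (- c + Slog n reduced l (b * (1 - s))) / rt n ^+ 2 =
  Slog n reduced l (b * (1 - s)) / rt n ^+ 2 - s * b * ((1 + u) / (1 + eta) ^+ 3) * (n%:R / rt n ^+ 3).
  by rewrite /c /be; set S := Slog _ _ _ _; set bb := b; field; rewrite !gt_eqF.
apply: ltW; near: n; apply: (cvgr_lt _ c1).
have -> : 2 * dprim * zA l / (b * (1 - s)) ^+ 2 = X * (1 - s) ^- 2.
  by rewrite /X exprMn invfM mulrA.
have -> : s * b * ((1 + u) / (1 + eta) ^+ 3) * 1 = 2 * X * (s * (1 + u)).
  by rewrite XE' /b; set bb := b0; field; rewrite gt_eqF.
have gE : g = 2 * X * (s * u - 3 * s ^+ 2) by [].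
have := ler_wpM2l (ltW X0) (tilt_ineq s1); move: gE g0; clearbody g X.
by set w := (1 - s) ^- 2; lra.
Unshelve. all: end_near. Qed.

Lemma expR_le2 (s : R) : s <= 2^-1 -> expR s - 1 <= s + 2 * s ^+ 2.
Proof.
move=> s2; have h : 0 < 1 - s by lra.
have : expR s * (1 - s) <= 1.
  have := expR_ge1Dx (- s); rewrite expRN => h'.
  by rewrite -ler_pdivlMl ?expR_gt0// mulr1.
have := sqr_ge0 s; have e0 := expR_gt0 s; set E := expR s => ? ?.
have : E * (1 - s) <= (1 + s + 2 * s ^+ 2) * (1 - s) by nra.
by rewrite ler_pM2r//; lra.
Qed.

(** Chernoff bound with [l] replaced by l e^s, around the typical number k / (1 + eta)^2 of edges.
    The new partition function is compared with the old one by [zeta3BLi3_concave]; again the sign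
    of s selects the tail. *)
Lemma edges_tail (u s : R) : s <= 2^-1 -> 2 * s ^+ 2 < s * u ->
  exists2 ga : R, 0 < ga & \forall n \near \oo,
  \sum_(om : {ffun 'I_n.+2 * 'I_n.+2 -> 'I_n.+2} | s * ((1 + u) / (1 + eta) ^+ 2 * (k n)%:R) <= s * (nedges om)%:R) gwn om
   <= expR ((X - ga) * rt n ^+ 2).
Proof.
move: (l0) (bp) (XE) (hk) => ? ? XE' hk' s1 su.
have h1 : 0 < 1 + eta by rewrite addr_gt0.
have kp := kap_gt0 l0; have bb0 := b0_gt0 l0; have d0 := @dprim_gt0 R.
have B0 := Li2_ratio_gt0 l0.
have le0 : 0 < l * expR s by rewrite mulr_gt0 ?expR_gt0.
pose g := kap l / (1 + eta) ^+ 2 * (s * u - 2 * s ^+ 2).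
have g0 : 0 < g.
  by apply: mulr_gt0; [exact: divr_gt0 kp (exprn_gt0 _ h1)|rewrite subr_gt0].
have c1 : Slog n reduced (l * expR s) b / rt n ^+ 2
    - s * ((1 + u) / (1 + eta) ^+ 2) * ((k n)%:R / rt n ^+ 2) @[n --> \oo] -->
    2 * dprim * zA (l * expR s) / b ^+ 2 - s * ((1 + u) / (1 + eta) ^+ 2) * kap l.
  by apply: cvgB; [exact: cS|apply: cvgMr].
exists (g / 2); first by rewrite divr_gt0.
near=> n.
have r0 := @rt_gt0 R n; have ben := be0 n.
pose c := s * ((1 + u) / (1 + eta) ^+ 2 * (k n)%:R).
apply: le_trans (@chernoff _ _ reduced (fun=> l) _ (fun=> l * expR s) (fun=> be n) _ c _ _ _) _ => //.
  move=> om _ Eom; rewrite /energy addrA lerD2r !sumr_const lnM ?posrE ?expR_gt0// expRK mulrnDl.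
  by rewrite addrC lerD2l -mulr_natr.
apply: le_trans (ler_wpM2l (expR_ge0 _) (gZle n le0 bp)) _.
rewrite -expRD ler_expR -ler_pdivrMr ?exprn_gt0//.
have -> : (- c + Slog n reduced (l * expR s) b) / rt n ^+ 2 =
  Slog n reduced (l * expR s) b / rt n ^+ 2 - s * ((1 + u) / (1 + eta) ^+ 2) * ((k n)%:R / rt n ^+ 2).
  by rewrite /c mulrDl mulNr addrC; congr (_ - _); rewrite !mulrA.
apply: ltW; near: n; apply: (cvgr_lt _ c1).
have A1 : zA (l * expR s) <= zA l + (l * expR s - l) * Li2_ratio l by exact: zeta3BLi3_concave.
have A2 : (l * expR s - l) * Li2_ratio l <= l * Li2_ratio l * (s + 2 * s ^+ 2).
  have -> : (l * expR s - l) * Li2_ratio l = l * Li2_ratio l * (expR s - 1) by ring.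
  by rewrite ler_wpM2l ?expR_le2//; exact: mulr_ge0 (ltW l0) (ltW B0).
have q0 : 0 <= 2 * dprim / b ^+ 2 by apply: divr_ge0 (exprn_ge0 _ (ltW bp)); rewrite pmulr_rge0// ltW.
have A3 : 2 * dprim * zA (l * expR s) / b ^+ 2 <= X + kap l / (1 + eta) ^+ 2 * (s + 2 * s ^+ 2).
  have -> : X + kap l / (1 + eta) ^+ 2 * (s + 2 * s ^+ 2) =
      2 * dprim / b ^+ 2 * (zA l + l * Li2_ratio l * (s + 2 * s ^+ 2)).
    rewrite /X kapE// /b; set bb := b0 in bb0 *; set A := zA l; set B := Li2_ratio l.
    by field; rewrite !gt_eqF.
  by rewrite mulrAC ler_wpM2l//; lra.
apply: (@le_lt_trans _ _ (X + kap l / (1 + eta) ^+ 2 * (s + 2 * s ^+ 2) - s * ((1 + u) / (1 + eta) ^+ 2) * kap l)).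
  by rewrite lerD2r.
have -> : X + kap l / (1 + eta) ^+ 2 * (s + 2 * s ^+ 2) - s * ((1 + u) / (1 + eta) ^+ 2) * kap l = X - g.
  by rewrite /g; set kk := kap l; field; rewrite gt_eqF.
lra.
Unshelve. all: end_near. Qed.

(** Bounds the factor of every direction with be |v| >= x0. Under the normalized weight such a
    direction thus has multiplicity 0 with probability at least 1 / cut. *)
Let cut : R := 1 + l / (expR x0 - 1).
(** The pool of directions for the added edges. The upper radius keeps these edges short; the lower
    one is needed because very short directions are almost always occupied when [n] is large. *)
Let annulus n : pred ('I_n.+2 * 'I_n.+2) :=
  [pred v | reduced (pt v) & x0 < be n * nrm (pt v) <= 2 * x0].

Lemma cvg_cnt (y : R) : 0 < y ->
  (cnt reduced n.+2 (y / be n))%:R / rt n ^+ 2 @[n --> \oo] --> dprim * y ^+ 2 / b ^+ 2.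
Proof.
move: (bp) => ? y0; apply/cvgrPdist_le => e e0.
pose e' := e * b ^+ 2 / y ^+ 2.
have e'0 : 0 < e' by apply: divr_gt0; rewrite ?exprn_gt0// mulr_gt0 ?exprn_gt0.
have [r0 H] := dens_reduced e'0.
near=> n.
have n0 : (0 < n)%N by near: n; exact: near_gt0.
have rn := @rt_gt0 R n; have ben := be0 n.
have yE : y / be n = y / b * rt n by rewrite /be invf_div mulrA mulrAC.
have yb : 0 < y / b by rewrite divr_gt0.
have h1 : Num.max r0 0 / (y / b) <= rt n by near: n; move/cvgryPge: (@cvg_rt R); exact.
have h2 : y / b <= rt n by near: n; move/cvgryPge: (@cvg_rt R); exact.
have h3 : r0 <= y / be n.
  by rewrite yE; rewrite ler_pdivrMr// mulrC in h1; apply: le_trans h1; rewrite le_max lexx.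
have h4 : y / be n < n.+2%:R.
  apply: (@le_lt_trans _ _ n%:R); last by rewrite ltr_nat.
  rewrite yE -(rtX3 n0) exprSr ler_pM2r// expr2; apply: le_trans h2 _.
  by rewrite ler_peMl ?rt_ge1// ltW.
have := H _ _ h3 h4; set C := (cnt _ _ _)%:R => h.
rewrite distrC (_ : C / rt n ^+ 2 - _ = (C - dprim * (y / be n) ^+ 2) / rt n ^+ 2); last first.
  have bn : b != 0 by rewrite gt_eqF.
  by rewrite yE; set bb := b in bn *; field; rewrite ?bn ?gt_eqF.
rewrite normrM normfV (ger0_norm (exprn_ge0 _ (ltW rn))) ler_pdivrMr ?exprn_gt0//.
apply: le_trans h _; rewrite /e' yE.
rewrite le_eqVlt; apply/orP; left; apply/eqP.
have bn : b != 0 by rewrite gt_eqF.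
by set bb := b in bn *; field; rewrite ?bn ?gt_eqF.
Unshelve. all: end_near. Qed.

Let dD : R := 3 * dprim * x0 ^+ 2 / b ^+ 2.

Lemma cvg_card_annulus : #|@annulus n|%:R / rt n ^+ 2 @[n --> \oo] --> dD.
Proof.
have x2 : 0 < 2 * x0 by rewrite mulr_gt0.
rewrite (_ : dD = dprim * (2 * x0) ^+ 2 / b ^+ 2 - dprim * x0 ^+ 2 / b ^+ 2); last first.
  by rewrite /dD -mulrBl; congr (_ / _); ring.
rewrite (_ : (fun n => _) = fun n => (cnt reduced n.+2 (2 * x0 / be n))%:R / rt n ^+ 2 -
   (cnt reduced n.+2 (x0 / be n))%:R / rt n ^+ 2).
  by apply: cvgB; exact: cvg_cnt.
apply/funext => n; rewrite -mulrBl; congr (_ / _).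
apply/eqP; rewrite eq_sym subr_eq -natrD eqr_nat !cntE; apply/eqP.
rewrite -!sum1_card [X in _ = (X + _)%N]big_mkcond [X in _ = (_ + X)%N]big_mkcond -big_split/= [LHS]big_mkcond/=; apply: eq_bigr => v _.
rewrite !inE !ler_pdivlMr// -/(pt v) !(mulrC (nrm _)); case: (reduced _) => //=.
case: (leP (be n * nrm (pt v)) x0) => h1; case: (leP (be n * nrm (pt v)) (2 * x0)) => h2 //=.
by exfalso; have := x00; lra.
Qed.

(** Exponentially small compared with the partition function, whose exponent is [X] by
    [gZ_lower]. *)
Definition negl (E : forall n, pred {ffun 'I_n.+2 * 'I_n.+2 -> 'I_n.+2}) :=
  exists2 ga : R, 0 < ga & \forall n \near \oo,
  \sum_(om : {ffun 'I_n.+2 * 'I_n.+2 -> 'I_n.+2} | E n om) gwn om <= expR ((X - ga) * rt n ^+ 2).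

Let gwn_ge0 n (om : {ffun 'I_n.+2 * 'I_n.+2 -> 'I_n.+2}) : 0 <= gwn om.
Proof. by apply: gw_ge0 => v; exact: ltW. Qed.

Lemma near_expR_ge2 (g : R) : 0 < g -> \forall n \near \oo, 2 <= expR (g * rt n ^+ 2).
Proof.
move=> g0; near=> n; apply: le_trans (expR_ge1Dx _).
have h : g^-1 <= rt n by near: n; move/cvgryPge: (@cvg_rt R); exact.
have r1 := @rt_ge1 R n; have : 1 <= g * rt n.
  by rewrite -ler_pdivrMl// mulr1.
have := @rt_gt0 R n; rewrite expr2; nra.
Unshelve. all: end_near. Qed.

Lemma negl_or E F : negl E -> negl F -> negl (fun n om => E n om || F n om).
Proof.
move=> [g1 g10 H1] [g2 g20 H2]; pose g := Num.min g1 g2.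
have g0 : 0 < g by rewrite lt_min g10.
exists (g / 2); first by rewrite divr_gt0.
have g2' : 0 < g / 2 by rewrite divr_gt0.
near=> n.
have r2 : 0 <= rt n ^+ 2 by exact: sqr_ge0.
have B (g' : R) : g <= g' -> expR ((X - g') * rt n ^+ 2) <= expR ((X - g) * rt n ^+ 2).
  by move=> gg; rewrite ler_expR ler_wpM2r// lerD2l lerN2.
apply: (@le_trans _ _ (2 * expR ((X - g) * rt n ^+ 2))).
  rewrite mulr_natl mulr2n; apply: (@le_trans _ _ (\sum_(om : {ffun 'I_n.+2 * 'I_n.+2 -> 'I_n.+2} | E n om) gwn om +
     \sum_(om : {ffun 'I_n.+2 * 'I_n.+2 -> 'I_n.+2} | F n om) gwn om)).
    rewrite big_mkcond [X in _ <= X + _]big_mkcond [X in _ <= _ + X]big_mkcond -big_split/=.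
    apply: ler_sum => om _; have := gwn_ge0 om.
    by case: (E n om); case: (F n om) => /= ?; lra.
  apply: lerD.
    apply: (@le_trans _ _ (expR ((X - g1) * rt n ^+ 2))); first by near: n.
    by apply: B; rewrite ge_min lexx.
  apply: (@le_trans _ _ (expR ((X - g2) * rt n ^+ 2))); first by near: n.
  by apply: B; rewrite ge_min lexx orbT.
have -> : (X - g / 2) * rt n ^+ 2 = g / 2 * rt n ^+ 2 + (X - g) * rt n ^+ 2 by field.
rewrite expRD ler_pM2r ?expR_gt0//; near: n; exact: near_expR_ge2.
Unshelve. all: end_near. Qed.

Lemma negl_compl E (ga : R) : negl E -> 0 < ga -> \forall n \near \oo,
  expR ((X - ga) * rt n ^+ 2) <= \sum_(om : {ffun 'I_n.+2 * 'I_n.+2 -> 'I_n.+2} | ~~ E n om) gwn om.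
Proof.
move=> [g1 g10 H1] ga0; pose g := Num.min g1 ga.
have g0 : 0 < g by rewrite lt_min g10.
have g1' : g <= g1 by rewrite ge_min lexx.
have ga' : g <= ga by rewrite ge_min lexx orbT.
have g2' : 0 < g / 2 by rewrite divr_gt0.
near=> n.
have r2 : 0 <= rt n ^+ 2 by exact: sqr_ge0.
have B (g' : R) : g <= g' -> expR ((X - g') * rt n ^+ 2) <= expR ((X - g) * rt n ^+ 2).
  by move=> gg; rewrite ler_expR ler_wpM2r// lerD2l lerN2.
have h1 : expR ((X - g / 2) * rt n ^+ 2) <= gZ reduced (fun _ : 'I_n.+2 * 'I_n.+2 => l) (fun=> be n).
  by near: n; exact: gZ_lower.
have h2 : \sum_(om : {ffun 'I_n.+2 * 'I_n.+2 -> 'I_n.+2} | E n om) gwn om <= expR ((X - g1) * rt n ^+ 2).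
  by near: n.
have h3 : 2 <= expR (g / 2 * rt n ^+ 2) by near: n; exact: near_expR_ge2.
have h4 : expR ((X - g / 2) * rt n ^+ 2) = expR (g / 2 * rt n ^+ 2) * expR ((X - g) * rt n ^+ 2).
  by rewrite -expRD; congr expR; field.
rewrite h4 -sum_gw (bigID (E n))/= in h1.
have := B _ g1'; have := B _ ga'; have := expR_gt0 ((X - g) * rt n ^+ 2).
set w := expR ((X - g) * rt n ^+ 2) in h1 *; move=> w0 w1 w2.
have := ler_wpM2r (ltW w0) h3.
have := le_trans h2 w2; move: h1; rewrite -/(gwn _) => h1 h5 h6.
apply: (le_trans w1).
have : 2 * w <= \sum_(om : {ffun 'I_n.+2 * 'I_n.+2 -> 'I_n.+2} | E n om) gwn om
   + \sum_(om : {ffun 'I_n.+2 * 'I_n.+2 -> 'I_n.+2} | ~~ E n om) gwn om by exact: le_trans h6 h1.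
by lra.
Unshelve. all: end_near. Qed.

(** Double [l] on the annulus, of cardinal A. With fewer than A / (4 cut) zeros the weight grows by
    at least 2^(A - A / (4 cut)), whereas by [gZ_double] the partition function grows by at most 2^A
    e^(-A / (2 cut)). As ln 2 <= 1, a factor e^(-A / (4 cut)) remains. *)
Lemma zeros_tail : negl (fun n om => #|zeros (@annulus n) om|%:R < #|@annulus n|%:R / (4 * cut)).
Proof.
move: (l0) (bp) (x00) => ? ? x0p.
have ex0 := expRB_gt0 (lexx 1) x0p.
have p0 : 0 < cut by rewrite addr_gt0// divr_gt0.
have dD0 : 0 < dD.
  by apply: divr_gt0; rewrite ?exprn_gt0// mulr_gt0 ?exprn_gt0// mulr_gt0// dprim_gt0.
have d4 : 0 < dD / (4 * cut) by rewrite divr_gt0// mulr_gt0.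
exists (dD / (4 * cut) / 2); first by rewrite divr_gt0.
have c1 : Slog n reduced l b / rt n ^+ 2 - #|@annulus n|%:R / rt n ^+ 2 / (4 * cut) @[n --> \oo] -->
    X - dD / (4 * cut).
  by apply: cvgB; [exact: cS|apply: cvgMl; exact: cvg_card_annulus].
near=> n.
have r0 := @rt_gt0 R n; have ben := be0 n.
set dn := #|@annulus n|%:R.
have dn0 : 0 <= dn by rewrite /dn.
pose c := ln 2 * (dn - dn / (4 * cut)).
have l20 : 0 <= ln 2 :> R by apply: ln_ge0; lra.
have l21 : ln 2 <= 1 :> R by have := @le_ln1Dx R 1; rewrite (_ : 1 + 1 = 2 :> R)//; apply; lra.
apply: le_trans (@chernoff _ _ reduced (fun=> l) _ (fun v => if @annulus n v then 2 * l else l) (fun=> be n) _ c _ _ _) _ => //.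
- by move=> v; case: ifP => _ //; rewrite mulr_gt0.
- move=> om _ Eom; rewrite /energy addrA lerD2r.
  have -> : \sum_(v | (0 < om v)%N) ln (if @annulus n v then 2 * l else l) =
      \sum_(v | (0 < om v)%N) ln l + ln 2 * (dn - #|zeros (@annulus n) om|%:R).
    have cc : dn = #|zeros (@annulus n) om|%:R + #|[pred v | @annulus n v & (0 < om v)%N]|%:R.
      rewrite /dn -natrD; congr _%:R; rewrite -!sum1_card [X in _ = (X + _)%N]big_mkcond.
      rewrite [X in _ = (_ + X)%N]big_mkcond -big_split/= [LHS]big_mkcond/=.
      by apply: eq_bigr => v _; rewrite /zeros /annulus !inE /=; case: (reduced (pt v) && _) => //=; case: (om v : nat).
    have -> : dn - #|zeros (@annulus n) om|%:R = #|[pred v | @annulus n v & (0 < om v)%N]|%:R.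
      by rewrite cc addrC addKr.
    rewrite -sum1_card natr_sum mulr_sumr addrC.
    rewrite [X in _ = X + _]big_mkcond/= [X in _ = _ + X]big_mkcond/= -big_split/= big_mkcond/=.
    apply: eq_bigr => v _; rewrite inE; case: (0 < om v)%N; last by rewrite andbF addr0.
    rewrite andbT; case: ifP => _; last by rewrite add0r.
    by rewrite mulr1 lnM ?posrE.
  rewrite addrC lerD2l /c ler_wpM2l// lerD2l lerN2; exact: ltW.
have nz v : reduced v -> v != (0, 0)%N by exact: reduced_neq0.
have H := @gZ_double _ n reduced (@annulus n) l (be n) x0 l0 ben x0p nz.
apply: le_trans (ler_wpM2l (expR_ge0 _) (H _ _)) _.
- by move=> v /andP[].
- by move=> v /andP[_ /andP[h _]]; exact: ltW.
apply: le_trans (ler_wpM2l (expR_ge0 _) (ler_wpM2l _ (gZle n l0 bp))) _.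
  by rewrite mulr_ge0 ?expR_ge0// exprn_ge0.
rewrite -/cut -/dn.
have -> : 2 ^+ #|@annulus n| = expR (ln 2 * dn) :> R.
  by rewrite /dn mulrC expRM_natl lnK// posrE.
rewrite -!expRD ler_expR -ler_pdivrMr ?exprn_gt0//.
apply: (@le_trans _ _ (Slog n reduced l b / rt n ^+ 2 - #|@annulus n|%:R / rt n ^+ 2 / (4 * cut))); last first.
  apply: ltW; near: n; apply: (cvgr_lt _ c1); lra.
rewrite -/dn mulrAC -mulrBl ler_pM2r ?invr_gt0 ?exprn_gt0//.
have -> : dn / (2 * cut) = 2 * (dn / (4 * cut)) by field; rewrite gt_eqF.
set w := dn / (4 * cut); have w0 : 0 <= w by rewrite /w divr_ge0// mulr_ge0// ltW.
have lw : ln 2 * w <= w by rewrite ler_piMl.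
rewrite /c -/w mulrBr opprB addrA -subr_ge0.
rewrite [leRHS](_ : _ = w - ln 2 * w) ?subr_ge0//; ring.
Unshelve. all: end_near. Qed.

(** For x = k edges wanted and K present: one edge at least remains for the horizontal direction,
    since K <= (1 - eta / 2) x and eta x / 2 >= 1, and at most 3 eta x are missing. *)
Lemma edges_window (x K : R) : 0 < eta -> eta <= 3^-1 -> 0 < x -> 2 / eta <= x ->
  K < (1 + eta) / (1 + eta) ^+ 2 * x -> (1 + - eta) / (1 + eta) ^+ 2 * x < K ->
  K <= x - 1 /\ (1 - 3 * eta) * x <= K.
Proof.
move=> e0 e3 x_gt0; have h1 : 0 < 1 + eta by rewrite addr_gt0.
have -> : (1 + eta) / (1 + eta) ^+ 2 = (1 + eta)^-1 by field; rewrite gt_eqF.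
rewrite ler_pdivrMr// => xe.
have i3 : 1 - 3 * eta <= (1 + - eta) / (1 + eta) ^+ 2.
  by rewrite ler_pdivlMr ?exprn_gt0//; nra.
have i4 : (1 + eta)^-1 <= 1 - eta / 2.
  by rewrite -[leLHS]mul1r ler_pdivrMr//; nra.
have := ler_wpM2r (ltW x_gt0) i3; have := ler_wpM2r (ltW x_gt0) i4.
by set u := (1 + eta)^-1 * x; set v := _ / _ * x => *; split; lra.
Qed.

Lemma gap_le (x K : R) : (1 - 3 * eta) * x <= K -> x - 1 - K <= 3 * eta * x.
Proof. by lra. Qed.

Lemma edges_log_le (x K L : R) : K <= x - 1 -> (1 - 3 * eta) * x <= K ->
  K * L <= x * L + 3 * eta * x * `|L|.
Proof.
move=> K1 K2; have a0 : 0 <= x - K by lra.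
have a1 : x - K <= 3 * eta * x by lra.
have a2 : - L <= `|L| by rewrite -normrN ler_norm.
have a3 := ler_wpM2l a0 a2; have a4 := ler_wpM2r (normr_ge0 L) a1; lra.
Qed.

(** The third hypothesis provides enough zeros in the annulus for the at most 3 eta k missing edges;
    the fourth makes these edges, of norm at most 2 x0 / be, fit in the length left free. In the
    loss, 2 ga is slack, the last term is the factor 2 per vector of the annulus, and the rest is
    the effect of eta on the weight. *)
Lemma chains_card_lower_aux (ga : R) : 0 < ga -> eta <= 3^-1 ->
  3 * eta * kap l < dD / (4 * cut) -> 6 * eta * kap l * x0 / b < 1 - (1 + eta) ^- 2 ->
  \forall n \near \oo, expR ((ent l - (2 * ga + eta * (4 * b0 + 3 * kap l * `|ln l|)
    + 3 * dprim * x0 ^+ 2 / b0 ^+ 2)) * rt n ^+ 2) <= (pJ R n (k n))%:R.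
Proof.
move: (l0) (bp) (x00) (hk) (eta0) => ? bp' x0p hk' etap ga0 eta3 H1 H2.
have h1 : 0 < 1 + eta by rewrite addr_gt0.
have kp := kap_gt0 l0; have bb0 := b0_gt0 l0.
(* Small enough for the conditions 3 s^2 < s u and 2 s^2 < s u of the four tails, with s = s1, u =
   eta or s = - s1, u = - eta. *)
pose s1 := Num.min 4^-1 (eta / 7).
have s10 : 0 < s1 by rewrite lt_min; lra.
have s14 : s1 <= 4^-1 by rewrite ge_min lexx.
have s17 : s1 <= eta / 7 by rewrite ge_min lexx orbT.
have n1 : negl (fun n om => s1 * ((1 + eta) / (1 + eta) ^+ 3 * n%:R) <= s1 * omlen om).
  by apply: length_tail; [rewrite ger0_norm// ltW|nra].
have n2 : negl (fun n om => - s1 * ((1 + - eta) / (1 + eta) ^+ 3 * n%:R) <= - s1 * omlen om).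
  by apply: length_tail; [rewrite normrN ger0_norm// ltW|nra].
have n3 : negl (fun n om => s1 * ((1 + eta) / (1 + eta) ^+ 2 * (k n)%:R) <= s1 * (nedges om)%:R).
  by apply: edges_tail; [lra|nra].
have n4 : negl (fun n om => - s1 * ((1 + - eta) / (1 + eta) ^+ 2 * (k n)%:R) <= - s1 * (nedges om)%:R).
  by apply: edges_tail; [lra|nra].
have F1 := negl_compl (negl_or (negl_or (negl_or n1 n2) (negl_or n3 n4)) zeros_tail) ga0.
have cD := cvg_card_annulus.
have c1 : X - ga - ((k n)%:R / rt n ^+ 2 * ln l + 3 * eta * `|ln l| * ((k n)%:R / rt n ^+ 2))
    + b * ((1 - eta) / (1 + eta) ^+ 3) * (n%:R / rt n ^+ 3) - #|@annulus n|%:R / rt n ^+ 2 @[n --> \oo] -->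
   X - ga - (kap l * ln l + 3 * eta * `|ln l| * kap l) + b * ((1 - eta) / (1 + eta) ^+ 3) * 1 - dD.
  apply: cvgB => //; apply: cvgD; last by apply: cvgMr; exact: cvg_n.
  apply: cvgB; first exact: cvg_cst.
  by apply: cvgD; [exact: cvgMl|exact: cvgMr].
have c2 : 3 * eta * ((k n)%:R / rt n ^+ 2) - #|@annulus n|%:R / rt n ^+ 2 / (4 * cut) @[n --> \oo] -->
    3 * eta * kap l - dD / (4 * cut).
  by apply: cvgB; [exact: cvgMr|exact: cvgMl].
have c3 : 6 * eta * x0 / b * ((k n)%:R / rt n ^+ 2) + (1 + eta) ^- 2 * (n%:R / rt n ^+ 3) @[n --> \oo] -->
    6 * eta * x0 / b * kap l + (1 + eta) ^- 2 * 1.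
  by apply: cvgD; apply: cvgMr => //; exact: cvg_n.
near=> n.
have n0 : (0 < n)%N by near: n; exact: near_gt0.
have r0 := @rt_gt0 R n; have ben := be0 n.
have r20 : 0 < rt n ^+ 2 by rewrite exprn_gt0.
have r3 := @rtX3 R n n0.
have kbig : 2 / eta <= (k n)%:R :> R.
  have a1 : kap l / 2 <= (k n)%:R / rt n ^+ 2.
    by apply: ltW; near: n; apply: (cvgr_gt _ hk'); lra.
  have a2 : 4 / (eta * kap l) <= rt n by near: n; move/cvgryPge: (@cvg_rt R); exact.
  have r1 := @rt_ge1 R n.
  rewrite ler_pdivlMr// in a1; rewrite ler_pdivrMr ?(mulr_gt0 etap kp)// in a2.
  rewrite ler_pdivrMr//; have : rt n <= rt n ^+ 2 by rewrite expr2 ler_peMr// ltW.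
  move=> a3; have a4 : kap l / 2 * rt n <= (k n)%:R by apply: le_trans a1; rewrite ler_pM2l// divr_gt0.
  have := ler_wpM2r (ltW etap) a4; lra.
have k0 : (0 < k n)%N.
  by rewrite -(ltr_nat R); apply: (lt_le_trans _ kbig); rewrite divr_gt0.
have kpred : (k n).-1%:R = (k n)%:R - 1 :> R by rewrite -[in RHS](prednK k0) -natr1 addrK.
have k0' : 0 < (k n)%:R :> R by rewrite ltr0n.
pose T := 2 * x0 / be n.
have DP v : @annulus n v -> [/\ prim (pt v), pt v != (1, 0)%N & nrm (pt v) <= T].
  move=> /andP[/andP[? ?] /andP[_ h]]; split=> //.
  by rewrite /T ler_pdivlMr// mulrC.
have B1 := card_extendable k0 DP.
(* Upper bound for the energy outside the exceptional events. There every configuration of nonzero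
   weight is extendable, so their total weight is at most e^y times the number of extendable
   configurations. The absolute value covers both signs of ln l, since only K <= k and K >= (1 - 3
   eta) k are known of the number K of edges. *)
set y := (k n)%:R * ln l + 3 * eta * (k n)%:R * `|ln l| - be n * ((1 - eta) / (1 + eta) ^+ 3 * n%:R).
have F2 : \sum_(om : {ffun 'I_n.+2 * 'I_n.+2 -> 'I_n.+2} | ~~ ((((s1 * ((1 + eta) / (1 + eta) ^+ 3 * n%:R) <= s1 * omlen om)
   || (- s1 * ((1 + - eta) / (1 + eta) ^+ 3 * n%:R) <= - s1 * omlen om))
   || ((s1 * ((1 + eta) / (1 + eta) ^+ 2 * (k n)%:R) <= s1 * (nedges om)%:R)
   || (- s1 * ((1 + - eta) / (1 + eta) ^+ 2 * (k n)%:R) <= - s1 * (nedges om)%:R)))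
   || (#|zeros (@annulus n) om|%:R < #|@annulus n|%:R / (4 * cut)))) gwn om
   <= #|extendable (@annulus n) (k n) T|%:R * expR y.
  rewrite -[#|extendable _ _ _|]sum1_card natr_sum mulr_suml big_mkcond [leRHS]big_mkcond/=; apply: ler_sum => om _.
  case: ifP; last by move=> _; case: ifP => _; rewrite ?mul1r ?expR_ge0.
  rewrite !negb_or -!ltNge -leNgt => /andP[/andP[/andP[e1 e2] /andP[e3 e4]] e5].
  case: (boolP (supported reduced om)) => sp; last first.
    by rewrite [gwn om]gw_unsupported//; case: ifP => _; rewrite ?mul1r ?expR_ge0.
  rewrite ltr_pM2l// in e1; rewrite !mulNr ltrN2 ltr_pM2l// in e2.
  rewrite ltr_pM2l// in e3; rewrite !mulNr ltrN2 ltr_pM2l// in e4.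
  have i1 : (1 + eta) / (1 + eta) ^+ 3 = (1 + eta) ^- 2 by field; rewrite gt_eqF.
  rewrite i1 in e1.
  have [K1 K2] := edges_window eta0 eta3 k0' kbig e3 e4.
  have K1' : (nedges om <= (k n).-1)%N by rewrite -(ler_nat R) kpred.
  have K3 : ((k n).-1 - nedges om)%:R <= 3 * eta * (k n)%:R :> R.
    by rewrite natrB// kpred; exact: gap_le K2.
  have ext : extendable (@annulus n) (k n) T om.
    apply/and4P; split=> //.
      rewrite -(ler_nat R); apply: le_trans K3 _; apply: le_trans e5.
      rewrite -subr_le0 -(pmulr_lle0 _ (_ : 0 < (rt n ^+ 2)^-1)) ?invr_gt0// mulrBl.
      rewrite (_ : 3 * eta * (k n)%:R / rt n ^+ 2 - _ = 3 * eta * ((k n)%:R / rt n ^+ 2) - #|@annulus n|%:R / rt n ^+ 2 / (4 * cut)).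
        by apply: ltW; near: n; apply: (cvgr_lt _ c2); lra.
      by set a := #|_|%:R; set kk := (k n)%:R; set t := (rt n ^+ 2)^-1; set q := (4 * cut)^-1; ring.
    have T0 : 0 <= T by rewrite divr_ge0// ltW// mulr_gt0.
    apply: le_trans (lerD (ltW e1) (ler_wpM2r T0 K3)) _.
    rewrite -(ler_pM2r (_ : 0 < (rt n ^+ 3)^-1)) ?invr_gt0 ?exprn_gt0//.
    rewrite [leLHS](_ : _ = 6 * eta * x0 / b * ((k n)%:R / rt n ^+ 2) + (1 + eta) ^- 2 * (n%:R / rt n ^+ 3)).
      rewrite [leRHS](_ : _ = 1); last by rewrite -r3 divff// gt_eqF// exprn_gt0.
      apply: ltW; near: n; apply: (cvgr_lt _ c3).
      by rewrite mulr1 (mulrAC _ _ (kap l)) (mulrAC (6 * eta)); lra.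
    have bn : b != 0 by rewrite gt_eqF.
    by rewrite /T /be; set bb := b in bn *; set kk := (k n)%:R; set nn := n%:R; field; rewrite ?bn ?gt_eqF.
  rewrite -topredE/= ext mul1r [gwn om]gw_supported// ler_expR.
  rewrite /energy sumr_const -[ln l *+ _]mulr_natl -/(nedges om) -mulr_sumr -/(omlen om).
  apply: lerB; last by rewrite ler_pM2l// ltW.
  by have := edges_log_le (ln l) K1 K2; exact.
have F1n : expR ((X - ga) * rt n ^+ 2) <= #|extendable (@annulus n) (k n) T|%:R * expR y.
  by apply: le_trans F2; near: n.
rewrite -(ler_nat R) natrM natrX in B1.
have F3 : expR ((X - ga) * rt n ^+ 2) <= 2 ^+ #|@annulus n| * (pJ R n (k n))%:R * expR y.
  by apply: le_trans F1n _; rewrite ler_pM2r ?expR_gt0.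
have l2 : 2 <= expR 1 :> R by have := expR_ge1Dx (1 : R).
have F4 : 2 ^+ #|@annulus n| <= expR #|@annulus n|%:R :> R.
  by rewrite -[X in expR X]mulr1 expRM_natl lerXn2r// ?nnegrE ?expR_ge0.
have F5 : expR ((X - ga) * rt n ^+ 2 - y - #|@annulus n|%:R) <= (pJ R n (k n))%:R.
  rewrite !expRD !expRN ler_pdivrMr ?expR_gt0// ler_pdivrMr ?expR_gt0//.
  apply: le_trans F3 _; rewrite ler_pM2r ?expR_gt0// mulrC ler_wpM2l//.
apply: le_trans F5; rewrite ler_expR -ler_pdivlMr//.
rewrite [leRHS](_ : _ = X - ga - ((k n)%:R / rt n ^+ 2 * ln l + 3 * eta * `|ln l| * ((k n)%:R / rt n ^+ 2))
    + b * ((1 - eta) / (1 + eta) ^+ 3) * (n%:R / rt n ^+ 3) - #|@annulus n|%:R / rt n ^+ 2); last first.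
  rewrite /y /be; set a := #|_|%:R; set bb := b; set XX := X; set L1 := ln l; set L2 := `|_|.
  by set kk := (k n)%:R; set nn := n%:R; field; rewrite !gt_eqF.
apply: ltW; near: n; apply: (cvgr_gt _ c1).
rewrite mulr1 entE// XE.
(* Origin of the coefficient 4 b0: [j1] costs b0 eta in [X], which is b0 / 2 / (1 + eta)^2, and [j2]
   costs 3 b0 eta in the length term. *)
have j1 : 1 - 2 * eta <= (1 + eta) ^- 2.
  by rewrite -[leRHS]mul1r ler_pdivlMr ?exprn_gt0//; nra.
have j2 : 1 - 3 * eta <= (1 - eta) / (1 + eta) ^+ 2.
  by rewrite ler_pdivlMr ?exprn_gt0//; nra.
have j3 : b * ((1 - eta) / (1 + eta) ^+ 3) = b0 * ((1 - eta) / (1 + eta) ^+ 2).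
  by rewrite /b; set bb := b0; field; rewrite gt_eqF.
have j4 : dD <= 3 * dprim * x0 ^+ 2 / b0 ^+ 2.
  rewrite /dD ler_wpM2l//.
    by apply: mulr_ge0 (sqr_ge0 _); apply: mulr_ge0 (ltW (@dprim_gt0 R)).
  rewrite lef_pV2 ?posrE ?exprn_gt0// lerXn2r ?nnegrE ?(ltW bb0) ?(ltW bp')//.
  by rewrite /b ler_peMl ?(ltW bb0)// lerDl ltW.
rewrite j3; have := ler_wpM2l (ltW bb0) j1; have := ler_wpM2l (ltW bb0) j2.
move: j4 ga0; set q1 := (1 - eta) / _; set q2 := (1 + eta) ^- 2; set q3 := _ / b0 ^+ 2; set q4 := `|_|.
set kk := kap l; set q5 := ln l; clear F1 n1 n2 n3 n4 c1 c2 c3; lra.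
Unshelve. all: end_near. Qed.

End LowerBound.
End ReducedVectors.

Section Entropy.
Context {R : realType}.
Local Notation nrm := (@nrm R).
Local Notation dprim := (@dprim R).
Local Notation rt := (@rt R).
Implicit Types (P : pred (nat * nat)) (l : R).

Section Existence.
Variables (l : R) (k : nat -> nat).
Hypotheses (l0 : 0 < l) (hk : (k n)%:R / rt n ^+ 2 @[n --> \oo] --> kap l).

Lemma small_pos (u v : R) : 0 < u -> 0 < v -> exists2 x, 0 < x <= 1 & u * x <= v.
Proof.
move=> u0 v0; exists (Num.min 1 (v / u)).
  by rewrite ge_min lexx lt_min ltr01 divr_gt0.
by rewrite mulrC -ler_pdivlMr// ge_min lexx orbT.
Qed.

Lemma chains_card_lower (ep : R) : 0 < ep ->
  \forall n \near \oo, expR ((ent l - ep) * rt n ^+ 2) <= (pJ R n (k n))%:R.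
Proof.
move=> ep0; have kp := kap_gt0 l0; have bp := b0_gt0 l0; have d0 := @dprim_gt0 R.
have b20 : 0 < b0 l ^+ 2 by rewrite exprn_gt0.
(* [x1] limits the entropy cost of the annulus to ep / 4; [x2] makes 12 kap x0 <= b0, so that the
   added edges use a length at most (eta / 2) n up to lower order. Both are independent of eta. *)
have [x1 /andP[x10 x11] X1] := small_pos (divr_gt0 (mulr_gt0 (ltr0n _ 3) d0) b20) (divr_gt0 ep0 (ltr0n _ 4)).
have [x2 /andP[x20 x21] X2] := small_pos (mulr_gt0 (ltr0n _ 12) kp) bp.
pose x0 := x1 * x2.
have x00 : 0 < x0 by rewrite mulr_gt0.
have H0 : 3 * dprim * x0 ^+ 2 / b0 l ^+ 2 <= ep / 4.
  apply: le_trans X1; rewrite mulrAC ler_wpM2l//.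
    exact: divr_ge0 (mulr_ge0 (ler0n _ 3) (ltW d0)) (ltW b20).
  have xx : x0 <= x1 by rewrite /x0 ler_piMr// ltW.
  by apply: le_trans (xx); rewrite expr2 ler_piMr ?(le_trans xx)// ltW.
have H1 : 12 * kap l * x0 <= b0 l.
  apply: le_trans X2; apply: ler_wpM2l; first exact: mulr_ge0 (ler0n _ 12) (ltW kp).
  by rewrite /x0 ler_piMl// ltW.
pose cut := 1 + l / (expR x0 - 1).
have cut0 : 0 < cut by rewrite addr_gt0// divr_gt0// expRB_gt0.
(* Lower bound, free of eta, for the density of zeros in the annulus: 1 + eta is replaced by 2. It
   allows eta to be chosen after x0. *)
pose q := 3 * dprim * x0 ^+ 2 / (2 * b0 l) ^+ 2 / (4 * cut).
have q0 : 0 < q.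
  apply: divr_gt0; last exact: mulr_gt0.
  apply: divr_gt0; last by rewrite exprn_gt0// mulr_gt0.
  by apply: mulr_gt0; [exact: mulr_gt0|rewrite exprn_gt0].
have w0 : 0 < 4 * b0 l + 3 * kap l * `|ln l|.
  by apply: ltr_wpDr; [apply: mulr_ge0 => //; exact: mulr_ge0 (ltW kp)|exact: mulr_gt0].
have [e1 /andP[e10 e11] E1] := small_pos (mulr_gt0 (ltr0n _ 6) kp) q0.
have [e2 /andP[e20 e21] E2] := small_pos w0 (divr_gt0 ep0 (ltr0n _ 4)).
pose eta := e1 * e2 / 3.
have eta0 : 0 < eta by rewrite divr_gt0// mulr_gt0.
have eta3 : eta <= 3^-1 by rewrite /eta ler_piMl// mulr_ile1// ltW.
have h1 : 0 < 1 + eta by rewrite addr_gt0.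
have etae1 : 2 * eta <= e1.
  have : e1 * e2 <= e1 by rewrite ler_piMr// ltW.
  by rewrite /eta; lra.
have etae2 : eta <= e2.
  have : e1 * e2 <= e2 by rewrite ler_piMl// ltW.
  by rewrite /eta; lra.
have ep8 : 0 < ep / 8 by rewrite divr_gt0.
have J1 : 3 * eta * kap l < 3 * dprim * x0 ^+ 2 / ((1 + eta) * b0 l) ^+ 2 / (4 * cut).
  apply: (@lt_le_trans _ _ q).
    apply: lt_le_trans E1; rewrite mulrAC (_ : 6 * kap l * e1 = 3 * kap l * (2 * e1)); last by ring.
    by rewrite ltr_pM2l; [lra|exact: mulr_gt0].
  rewrite /q ler_pM2r ?invr_gt0 ?mulr_gt0// ler_pM2l; last first.
    by apply: mulr_gt0; [exact: mulr_gt0|rewrite exprn_gt0].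
  rewrite lef_pV2 ?posrE ?exprn_gt0 ?mulr_gt0// lerXn2r ?nnegrE ?mulr_ge0 ?ltW//.
  by rewrite ltr_pM2r//; lra.
have J2 : 6 * eta * kap l * x0 / ((1 + eta) * b0 l) < 1 - (1 + eta) ^- 2.
  apply: (@le_lt_trans _ _ (eta / 2)).
    rewrite ler_pdivrMr ?mulr_gt0//.
    have := ler_wpM2l (ltW eta0) H1; have : 0 < eta * (eta * b0 l) by rewrite !mulr_gt0.
    by lra.
  have : (1 + eta) ^- 2 * (1 + eta) ^+ 2 = 1 by rewrite mulVf// gt_eqF// exprn_gt0.
  have : 0 < (1 + eta) ^- 2 by rewrite invr_gt0 exprn_gt0.
  by set t := (1 + eta) ^- 2 => t0 tE; nra.
apply: filterS (chains_card_lower_aux l0 hk eta0 x00 ep8 eta3 J1 J2) => n; apply: le_trans.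
rewrite ler_expR ler_wpM2r ?sqr_ge0// lerD2l lerN2.
have : eta * (4 * b0 l + 3 * kap l * `|ln l|) <= ep / 4.
  by apply: le_trans E2; rewrite mulrC ler_pM2l.
by move: H0; set t1 := 3 * dprim * _ / _; set t2 := eta * _; lra.
Qed.

Lemma cvg_entropy : ln (pJ R n (k n))%:R / rt n ^+ 2 @[n --> \oo] --> ent l.
Proof.
apply/cvgrPdist_le => e e0; have U := chains_card_upper l0 hk e0 dens_allprim; near=> n.
have r20 : 0 < rt n ^+ 2 by rewrite exprn_gt0// rt_gt0.
have lo : expR ((ent l - e) * rt n ^+ 2) <= (pJ R n (k n))%:R by near: n; exact: chains_card_lower.
have up : (pJ R n (k n))%:R <= expR ((ent l + e) * rt n ^+ 2).
  by near: n; exact: U.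
have p0 : 0 < (pJ R n (k n))%:R :> R by apply: lt_le_trans lo; exact: expR_gt0.
rewrite distrC ler_distl ler_pdivlMr// ler_pdivrMr//.
by rewrite -ler_expR -[X in _ && X]ler_expR !lnK ?posrE// lo up.
Unshelve. all: end_near. Qed.

End Existence.
End Entropy.

(** * Chains with equidistributed directions *)

Section Directions.
Context {R : realType}.
Implicit Types (s : seq (int * int)) (e : int * int).

Local Notation steps := (pairmap (fun p q : int * int => q - p)).

Lemma polyline_vertex (a : int * int) s m :
  polyline (to_plane a : R * R) (map to_plane s)
    (a.1%:~R + \sum_(e <- take m (steps a s)) e.1%:~R,
     a.2%:~R + \sum_(e <- take m (steps a s)) e.2%:~R).
Proof.
elim: s a m => [|q s ih] a m /=; first by rewrite !big_nil !addr0.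
case: m => [|m]; last first.
  rewrite !big_cons !addrA /= -!intrD !subrKC; right; exact: ih.
rewrite !big_nil !addr0; left; exists 0; first by rewrite /= in_itv/= lexx ler01.
by rewrite /to_plane/= !subr0 !mul1r !mul0r !addr0.
Qed.

(** Edges with nonnegative coordinates make the curve monotone in both coordinates, so each of its
    points is squeezed between two consecutive vertices. *)
Lemma polyline_between (a : int * int) s (p : R * R) :
  all (fun e => (0 <= e.1) && (0 <= e.2)) (steps a s) ->
  polyline (to_plane a) (map to_plane s) p -> exists m,
    a.1%:~R + \sum_(e <- take m (steps a s)) e.1%:~R <= p.1 <=
      a.1%:~R + \sum_(e <- take m.+1 (steps a s)) e.1%:~R /\
    a.2%:~R + \sum_(e <- take m (steps a s)) e.2%:~R <= p.2 <=
      a.2%:~R + \sum_(e <- take m.+1 (steps a s)) e.2%:~R.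
Proof.
elim: s a => [|q s ih] a /=.
  by move=> _ ->; exists 0%N; rewrite !big_nil !addr0 !lexx.
move=> /andP[/andP[q1 q2] al] [[t]|/(ih _ al)[m]]; last first.
  by exists m.+1; rewrite /= !big_cons !addrA -!intrD !subrKC.
rewrite /= in_itv/= => /andP[t0 t1] <-; exists 0%N.
rewrite !take0 !big_cons !big_nil !addr0 /to_plane/= -!intrD !subrKC.
rewrite subr_ge0 in q1; rewrite subr_ge0 in q2.
have {}q1 : a.1%:~R <= q.1%:~R :> R by rewrite ler_int.
have {}q2 : a.2%:~R <= q.2%:~R :> R by rewrite ler_int.
by split; apply/andP; split; nra.
Qed.

(** Applied to edges sorted by slope and to the edges below a given angle: these form an initial
    piece of the chain, so their sum is a vertex. *)
Lemma filter_prefix (T : eqType) (r : rel T) (U : pred T) (es : seq T) :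
  transitive r -> {in es &, forall x y, r x y -> U y -> U x} -> sorted r es ->
  [seq x <- es | U x] = take (count U es) es.
Proof.
move=> rt; elim: es => //= x es ih cl pes.
have cl' : {in es &, forall y z, r y z -> U z -> U y}.
  by move=> y z yes zes; apply: cl; rewrite inE ?yes ?zes orbT.
case: ifP => Ux; first by rewrite add1n ih ?(path_sorted pes).
have U0 : ~~ has U es.
  apply/hasPn => y yes; apply: contraFN Ux; apply: cl; rewrite ?inE ?eqxx ?yes ?orbT//.
  by move/allP: (order_path_min rt pes); exact.
by move: U0 (U0); rewrite {1}has_filter negbK has_count -leqNgt leqn0 => /eqP -> /eqP ->.
Qed.

Section Cones.
Variable J : nat.
Hypothesis J0 : (0 < J)%N.

Definition step : R := pi / (2 * J%:R).

Let Jr : 0 < J%:R :> R. Proof. by rewrite ltr0n. Qed.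

Lemma step_gt0 : 0 < step.
Proof. by move: (Jr) => ?; rewrite divr_gt0 ?pi_gt0// mulr_gt0. Qed.

Lemma stepJ : J%:R * step = pi / 2.
Proof. by rewrite /step; field; rewrite gt_eqF ?Jr. Qed.

Lemma step_le j : (j <= J)%N -> 0 <= j%:R * step <= pi / 2.
Proof.
have h := step_gt0; move=> jJ; rewrite -stepJ ler_pM2r// ler_nat jJ andbT.
by rewrite mulr_ge0// ltW.
Qed.

(* The strict inequality of [sector (pi / 2)] excludes the vertical vectors,
   whence the special case [j = J]. *)
Definition low_sector j (v : nat * nat) : bool :=
  if j == J then v != (0, 0)%N else sector (j%:R * step) v.

Definition cone j (v : nat * nat) : bool := low_sector j.+1 v && ~~ low_sector j v.

Lemma sector00 (th : R) : sector th (0, 0)%N = false.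
Proof. by rewrite /sector !mul0r ltxx. Qed.

Lemma low_sector0 v : low_sector 0 v = false.
Proof.
rewrite /low_sector (ltn_eqF J0) /sector mul0r cos0 sin0 mulr1 mulr0.
by rewrite ltNge ler0n.
Qed.

Lemma low_sector_neq0 j v : low_sector j v -> v != (0, 0)%N.
Proof. by rewrite /low_sector; case: ifP => // _; apply: contraTneq => ->; rewrite sector00. Qed.

Lemma low_sector_homo j v : (j < J)%N -> low_sector j v -> low_sector j.+1 v.
Proof.
move=> jJ b; rewrite /low_sector; case: ifP => [_|nJ]; first exact: low_sector_neq0 b.
move: b; rewrite /low_sector (ltn_eqF jJ); apply: sector_mono.
- by have /andP[] := step_le (ltnW jJ).
- by rewrite ler_pM2r ?step_gt0// ler_nat.
- by rewrite -stepJ ltr_pM2r ?step_gt0// ltr_nat ltn_neqAle nJ.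
Qed.

Lemma scale_invariant_low_sector j : scale_invariant (low_sector j).
Proof.
move=> d a b d0; rewrite /low_sector; case: ifP => _.
  by rewrite !xpair_eqE !muln_eq0 (gtn_eqF d0).
by rewrite /sector /= !natrM -!mulrA ltr_pM2l// ltr0n.
Qed.

Lemma scale_invariant_cone j : scale_invariant (cone j).
Proof. by move=> d a b d0; rewrite /cone !scale_invariant_low_sector. Qed.

Lemma dens_low_sector j : (j <= J)%N -> dens (low_sector j) (j%:R * step / 2).
Proof.
rewrite leq_eqVlt => /orP[/eqP ->|jJ].
  rewrite stepJ (_ : pi / 2 / 2 = pi / 4); last by field.
  by apply: eq_dens (@dens_quadrant R) => v; rewrite /low_sector eqxx.
apply: (@eq_dens _ (sector (j%:R * step))) => [v|]; first by rewrite /low_sector (ltn_eqF jJ).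
exact: dens_sector (step_le (ltnW jJ)).
Qed.

Lemma dens_cone j : (j < J)%N -> dens (cone j) (step / 2).
Proof.
move=> jJ; rewrite (_ : step / 2 = j.+1%:R * step / 2 - j%:R * step / 2).
  apply: dens_diff; [exact: dens_low_sector|exact: dens_low_sector (ltnW jJ)|].
  by move=> v; exact: low_sector_homo.
by rewrite -natr1; field.
Qed.

End Cones.
End Directions.

(** * Comparison of a chain with the circle, cone by cone *)

Section QuarterCircle.
Context {R : realType}.
Local Notation step := (@step R).
Local Notation cone := (@cone R).
Local Notation low_sector := (@low_sector R).
Implicit Types (s : seq (int * int)) (e : int * int).

Lemma polar_quadrant (x y : R) : 0 <= x -> 0 <= y -> x ^+ 2 + y ^+ 2 = 1 ->
  exists2 th, 0 <= th <= pi / 2 & x = cos th /\ y = sin th.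
Proof.
move=> x0 y0 xy; have pi0 := pi_gt0 R.
have x1 : x <= 1.
  by rewrite -(@expr_le1 _ 2)// -xy lerDl sqr_ge0.
have xi : x \in `[-1, 1] by rewrite in_itv/= x1 andbT; lra.
have xi' : -1 <= x <= 1 by rewrite x1 andbT; lra.
exists (acos x).
  rewrite acos_ge0//= leNgt; apply/negP => h.
  have : cos (acos x) < cos (pi / 2).
    by rewrite ltr_cos// in_itv/= ?(acos_ge0 xi') ?(acos_lepi xi')//; lra.
  by rewrite acosK// cos_pihalf; lra.
split; first by rewrite acosK.
by rewrite sin_acos// (_ : 1 - x ^+ 2 = y ^+ 2) ?sqrtr_sqr ?ger0_norm//; lra.
Qed.

Definition absedge (e : int * int) : nat * nat := (`|e.1|%N, `|e.2|%N).

Definition elen (e : int * int) : R := norm2 (to_plane e).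

(** The polar angle of such an edge is within [step J] of j times [step J], and sine and cosine are
    1-Lipschitz. *)
Lemma cone_direction J j e : (j < J)%N -> quadrant_edge e -> cone J j (absedge e) ->
  `|e.1%:~R - elen e * cos (j%:R * step J)| <= elen e * step J /\
  `|e.2%:~R - elen e * sin (j%:R * step J)| <= elen e * step J.
Proof.
move=> jJ /and3P[e0 e1 e2] /andP[b1 b2].
have J0 : (0 < J)%N by case: J jJ {b1 b2}.
have h0 := @step_gt0 R _ J0; have pi0 := pi_gt0 R.
have E1 : (`|e.1|%N)%:R = e.1%:~R :> R by rewrite -{2}(gez0_abs e1).
have E2 : (`|e.2|%N)%:R = e.2%:~R :> R by rewrite -{2}(gez0_abs e2).
set x := e.1%:~R in E1 *; set y := e.2%:~R in E2 *; set N := elen e.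
have x0 : 0 <= x by rewrite -E1.
have y0 : 0 <= y by rewrite -E2.
have N2 : N ^+ 2 = x ^+ 2 + y ^+ 2 by rewrite sqr_sqrtr// addr_ge0 ?sqr_ge0.
have N0 : 0 < N.
  rewrite lt_neqAle sqrtr_ge0 andbT eq_sym -sqrf_eq0 N2 paddr_eq0 ?sqr_ge0//.
  rewrite !sqrf_eq0 !intr_eq0; apply: contra e0 => /andP[/eqP a /eqP b].
  by rewrite [e]surjective_pairing a b.
have N00 : N != 0 by rewrite gt_eqF.
have [||| th /andP[th0 th1] [xE yE]] := @polar_quadrant (x / N) (y / N).
- by rewrite divr_ge0// ltW.
- by rewrite divr_ge0// ltW.
- by rewrite !expr_div_n -mulrDl -N2 divff// sqrf_eq0.
have {}xE : x = N * cos th by rewrite -xE mulrC divfK.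
have {}yE : y = N * sin th by rewrite -yE mulrC divfK.
have /andP[a0 a1] := @step_le R _ J0 _ (ltnW jJ); have /andP[c0 c1] := @step_le R _ J0 _ jJ.
have S : j.+1%:R * step J = j%:R * step J + step J by rewrite -natr1 mulrDl mul1r.
have th2 : j%:R * step J <= th.
  move: b2; rewrite /low_sector (ltn_eqF jJ) /sector /= E1 E2 -leNgt => b2.
  rewrite leNgt; apply/negP => h; have : 0 < sin (j%:R * step J - th) by apply: sin_gt0_pi; lra.
  rewrite sinB; have : 0 < N by [].
  by move: b2; rewrite xE yE; set A := sin _; set B := cos th; set C := cos _; set D := sin th; nra.
have th3 : th <= j.+1%:R * step J.
  move: b1; rewrite /low_sector; case: ifP => [/eqP <-|_]; first by rewrite stepJ.
  rewrite /sector /= E1 E2 => b1.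
  rewrite leNgt; apply/negP => h; have : 0 < sin (th - j.+1%:R * step J) by apply: sin_gt0_pi; lra.
  rewrite sinB; have : 0 < N by [].
  by move: b1; rewrite xE yE; set A := sin _; set B := cos th; set C := cos _; set D := sin th; nra.
have d : `|th - j%:R * step J| <= step J by rewrite ger0_norm; lra.
by rewrite xE yE -!mulrBr !normrM (gtr0_norm N0) !ler_pM2l//; split;
  apply: le_trans d; [exact: cos_lip|exact: sin_lip].
Qed.
End QuarterCircle.

Section InscribedPolygons.
Context {R : realType}.
Local Notation step := (@step R).
Local Notation cone := (@cone R).
Local Notation low_sector := (@low_sector R).
Implicit Types (s : seq (int * int)) (e : int * int).

Section Polygon.
Variables (J n : nat) (es : seq (int * int)).
Hypotheses (J0 : (0 < J)%N) (n0 : (0 < n)%N).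
Hypothesis qes : all quadrant_edge es.
Hypothesis len : n%:R <= \sum_(e <- es) (elen e : R) <= n.+1%:R.
Local Notation h := (step J).
Local Notation L j := (\sum_(e <- es | cone J j (absedge e)) (elen e : R)).
Hypothesis short : forall j, (j < J)%N -> L j <= (J%:R^-1 + h / J%:R) * n%:R.

Lemma sum_low_sector (f : int * int -> R) j : (j < J)%N ->
  \sum_(e <- es | low_sector J j.+1 (absedge e)) f e =
  \sum_(e <- es | low_sector J j (absedge e)) f e + \sum_(e <- es | cone J j (absedge e)) f e.
Proof.
move=> jJ; rewrite (bigID (fun e => low_sector J j (absedge e)))/=; congr (_ + _).
by apply: eq_bigl => e; apply/andb_idl; exact: low_sector_homo.
Qed.

Lemma sum_low_sectorJ (f : int * int -> R) :
  \sum_(e <- es | low_sector J J (absedge e)) f e = \sum_(e <- es) f e.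
Proof.
rewrite big_seq_cond [RHS]big_seq; apply: eq_bigl => e.
apply/andb_idr => /(allP qes) /and3P[e0 _ _]; rewrite /low_sector eqxx.
by apply: contra e0; rewrite /absedge !xpair_eqE !absz_eq0.
Qed.

Lemma sum_low_sector0 (f : int * int -> R) : \sum_(e <- es | low_sector J 0 (absedge e)) f e = 0.
Proof. by rewrite big1// => e; rewrite low_sector0. Qed.

Lemma sum_cones : \sum_(j < J) L j = \sum_(e <- es) elen e.
Proof.
rewrite -sum_low_sectorJ.
have H m : (m <= J)%N -> \sum_(j < m) L j = \sum_(e <- es | low_sector J m (absedge e)) elen e.
  elim: m => [|m ih] mJ; first by rewrite big_ord0 sum_low_sector0.
  by rewrite big_ord_recr/= ih ?(ltnW mJ)// sum_low_sector.
exact: H.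
Qed.

(** Upper bounds on all [L j] suffice for a two-sided estimate, because the [L j] add up to at least
    n: if x <= d with d >= 0 then |x| <= 2 d - x, and the sum of the x = L j - n / J is
    nonnegative. *)
Lemma sum_cone_dev : \sum_(j < J) `|L j - n%:R / J%:R| <= 2 * h * n%:R.
Proof.
move: (J0) (len) (short) => ? /andP[len1 _] short'; have h0 := @step_gt0 R _ J0.
have Jr : 0 < J%:R :> R by rewrite ltr0n.
set d := h / J%:R * n%:R.
have d0 : 0 <= d by exact: mulr_ge0 (divr_ge0 (ltW h0) (ltW Jr)) (ler0n _ _).
apply: (@le_trans _ _ (\sum_(j < J) (n%:R / J%:R + 2 * d - L j))).
  apply: ler_sum => j _; have := short' _ (ltn_ord j); rewrite mulrDl -/d (mulrC J%:R^-1).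
  by set u := n%:R / _; set v := L j => ?; rewrite ler_norml; lra.
rewrite sumrB sum_cones sumr_const card_ord -[_ *+ J]mulr_natr.
have -> : (n%:R / J%:R + 2 * d) * J%:R = n%:R + 2 * h * n%:R.
  by rewrite /d; field; rewrite gt_eqF.
lra.
Qed.

(** Serves both coordinates: [f] is cos with primitive sin for the first, sin with primitive 1 - cos
    for the second. After rescaling, each cone contributes about h f(j h), so a vertex is nearly a
    Riemann sum of [f]. *)
Lemma vertex_estimate (c : int * int -> int) (f F : R -> R) :
  (forall e j, (j < J)%N -> quadrant_edge e -> cone J j (absedge e) ->
    `|(c e)%:~R - elen e * f (j%:R * h)| <= elen e * h) ->
  (forall x, `|f x| <= 1) -> (forall x y, `|f x - f y| <= `|x - y|) ->
  (forall x : R, is_derive x 1 F (f x)) -> F 0 = 0 ->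
  forall j, (j <= J)%N ->
  `|pi / (2 * n%:R) * \sum_(e <- es | low_sector J j (absedge e)) (c e)%:~R - F (j%:R * h)|
   <= 3 * pi * h.
Proof.
move=> cf f1 flip dF F0 j jJ.
move: (J0) (n0) (len) (short) => ? ? /andP[len1 len2] short'; have h0 := @step_gt0 R _ J0.
have Jr : 0 < J%:R :> R by rewrite ltr0n.
have nr : 0 < n%:R :> R by rewrite ltr0n.
have pi0 := pi_gt0 R.
set a := pi / (2 * n%:R); have a0 : 0 < a by rewrite divr_gt0// mulr_gt0.
have L0 i : 0 <= L i by apply: sumr_ge0 => e _; exact: sqrtr_ge0.
have F1 x : `|F (x + h) - F x - h * f x| <= h * h.
  have xh : x <= x + h by rewrite lerDl ltW.
  have [|y] := @MVT_segment _ F f _ _ xh (fun x _ => dF x).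
    apply: continuous_subspaceT => y; apply/differentiable_continuous/derivable1_diffP.
    exact: ex_derive.
  rewrite in_itv/= => /andP[y0 y1] ->; rewrite addrAC subrr add0r [_ * h]mulrC -mulrBr normrM gtr0_norm//.
  by rewrite ler_pM2l//; apply: le_trans (flip _ _) _; rewrite ger0_norm; lra.
(* The three terms are the errors from replacing edges by the direction of their cone, from unequal
   lengths of the cones, and from the Riemann sum. They are at most pi h, pi h and pi h / 2. *)
have H m : (m <= J)%N -> `|a * \sum_(e <- es | low_sector J m (absedge e)) (c e)%:~R - F (m%:R * h)| <=
    a * h * \sum_(i < m) L i + a * \sum_(i < m) `|L i - n%:R / J%:R| + m%:R * (h * h).
  elim: m => [|m ih] mJ.
    by rewrite sum_low_sector0 mulr0 !big_ord0 !mul0r F0 subrr normr0 !mulr0 !addr0.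
  rewrite sum_low_sector// !big_ord_recr/= -natr1 !mulrDl mul1r.
  have {}ih := ih (ltnW mJ).
  have C : `|\sum_(e <- es | cone J m (absedge e)) (c e)%:~R - L m * f (m%:R * h)| <= L m * h.
    rewrite !mulr_suml -sumrB; apply: le_trans (ler_norm_sum _ _ _) _.
    rewrite big_seq_cond [leRHS]big_seq_cond; apply: ler_sum => e /andP[ees ec].
    by apply: cf => //; exact: allP qes _ ees.
  have := F1 (m%:R * h); have := f1 (m%:R * h).
  have ah : a * (n%:R / J%:R) = h by rewrite /a /step; field; rewrite !gt_eqF.
  move: ih C; set S := \sum_(e <- es | low_sector _ _ _) _; set T := \sum_(e <- es | cone _ _ _) _.
  set l := L m; set X := F (_ * h + h); set Y := F _; set g := f _; set q := n%:R / _ in ah *.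
  move=> ih C g1 XY.
  rewrite [X in `|X|](_ : _ = (a * S - Y) + a * (T - l * g) + a * ((l - q) * g) - (X - Y - h * g)); last first.
    by rewrite -ah; ring.
  apply: le_trans (ler_normB _ _) _; apply: le_trans (lerD (ler_normD _ _) XY) _.
  apply: le_trans (lerD (lerD (ler_normD _ _) (lexx _)) (lexx _)) _.
  rewrite (normrM a (T - l * g)) (normrM a ((l - q) * g)) (normrM (l - q)) (gtr0_norm a0).
  have w1 : a * `|T - l * g| <= a * h * l by rewrite -mulrA ler_pM2l// (mulrC h).
  have w2 : a * (`|l - q| * `|g|) <= a * `|l - q| by rewrite ler_pM2l// ler_piMr.
  by move: ih w1 w2; set s1 := \sum_(i < m) _; set s2 := \sum_(i < m) _; lra.
apply: le_trans (H j jJ) _.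
have M (G : nat -> R) : (forall i, 0 <= G i) -> \sum_(i < j) G i <= \sum_(i < J) G i.
  by move=> G0; rewrite (big_ord_widen _ G jJ) [leRHS](bigID (fun i : 'I_J => (i < j)%N))/= lerDl sumr_ge0.
have s1 : \sum_(i < j) L i <= n.+1%:R by apply: le_trans len2; rewrite -sum_cones; exact: (M (fun i => L i)).
have s2 : \sum_(i < j) `|L i - n%:R / J%:R| <= 2 * h * n%:R.
  by apply: le_trans sum_cone_dev; apply: (M (fun i => `|L i - n%:R / J%:R|)).
have t1 : a * h * \sum_(i < j) L i <= pi * h.
  apply: (@le_trans _ _ (a * h * (2 * n%:R))); last first.
    by rewrite le_eqVlt; apply/orP; left; apply/eqP; rewrite /a; field; rewrite gt_eqF.
  rewrite ler_pM2l; last exact: mulr_gt0 a0 h0.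
  apply: le_trans s1 _.
  by rewrite -natrM ler_nat mul2n -addnn -addn1 leq_add2l.
have t2 : a * \sum_(i < j) `|L i - n%:R / J%:R| <= pi * h.
  apply: (@le_trans _ _ (a * (2 * h * n%:R))); first by rewrite ler_pM2l.
  by rewrite le_eqVlt; apply/orP; left; apply/eqP; rewrite /a; field; rewrite gt_eqF.
have t3 : j%:R * (h * h) <= pi / 2 * h.
  by rewrite mulrA ler_pM2r// -(stepJ J0) ler_pM2r// ler_nat.
have : 0 < pi * h by rewrite mulr_gt0.
by lra.
Qed.

End Polygon.
End InscribedPolygons.

(** * Hausdorff distance between the rescaled chain and the arc *)

Section HausdorffDistance.
Context {R : realType}.
Local Notation step := (@step R).
Local Notation cone := (@cone R).
Local Notation low_sector := (@low_sector R).
Implicit Types (s : seq (int * int)) (e : int * int).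

Lemma norm2_le (p : R * R) d : `|p.1| <= d -> `|p.2| <= d -> norm2 p <= 2 * d.
Proof.
move=> p1 p2; have d0 : 0 <= 2 * d by have := normr_ge0 p.1; lra.
rewrite -[leRHS]ger0_norm// -sqrtr_sqr ler_wsqrtr//.
rewrite -(real_normK (num_real p.1)) -(real_normK (num_real p.2)).
have := normr_ge0 p.1; have := normr_ge0 p.2; nra.
Qed.

Lemma slope_sorted_trans : transitive (fun e f => (slope e < slope f)%O).
Proof. by move=> f e g; exact: lt_trans. Qed.

Lemma low_sector_downward J j e f : (0 < J)%N -> (j <= J)%N -> quadrant_edge e -> quadrant_edge f ->
  (slope e < slope f)%O -> low_sector J j (absedge f) -> low_sector J j (absedge e).
Proof.
move=> J0 jJ qe qf; rewrite slope_lt//.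
move: qe qf => /and3P[e0 e1 e2] /and3P[f0 f1 f2].
rewrite /low_sector; case: ifP => [_ _ _|nJ].
  by apply: contra e0; rewrite /absedge !xpair_eqE !absz_eq0.
have /andP[a0 a1] := @step_le R _ J0 _ jJ.
rewrite -(ltr_int R) !intrM /sector /= => sl fs.
have E1 (z : int) : 0 <= z -> (`|z|%N)%:R = z%:~R :> R by move=> z0; rewrite -{2}(gez0_abs z0).
rewrite !E1// in fs *.
have c0 : 0 <= cos (j%:R * step J) by rewrite cos_ge0_quadrant// a0.
have s0 : 0 <= sin (j%:R * step J) by rewrite sin_ge0_quadrant// a0.
have : 0 <= e.1%:~R :> R by rewrite ler0z.
have : 0 <= e.2%:~R :> R by rewrite ler0z.
have : 0 <= f.2%:~R :> R by rewrite ler0z.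
have : 0 <= f.1%:~R :> R by rewrite ler0z.
move: sl fs c0 s0; set x := e.1%:~R; set y := e.2%:~R; set x' := f.1%:~R; set y' := f.2%:~R.
set c := cos _; set s := sin _ => sl fs c0 s0 x'0 y'0 y0 x0.
have x'p : 0 < x' by rewrite lt_neqAle x'0 andbT; apply/eqP => z; move: fs; rewrite -z mul0r; nra.
have xp : 0 < x by rewrite lt_neqAle x0 andbT; apply/eqP => z; move: sl; rewrite -z mul0r; nra.
rewrite -(ltr_pM2l x'p).
apply: (@le_lt_trans _ _ (x * (y' * c))); last by rewrite [ltRHS]mulrCA ltr_pM2l.
by rewrite !mulrA ler_wpM2r// ltW.
Qed.

Section HausdorffBound.
Variables (J n k : nat) (s : seq (int * int)).
Hypotheses (J0 : (0 < J)%N) (n0 : (0 < n)%N) (sC : chains R n k s).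
Local Notation h := (step J).
Hypothesis short : forall j, (j < J)%N -> seclen (cone J j) s <= (J%:R^-1 + h / J%:R) * n%:R.

Let a : R := pi / (2 * n%:R).
Let es := edges s.
Let W (c : int * int -> int) j : R := \sum_(e <- es | low_sector J j (absedge e)) (c e)%:~R.
Let V (c : int * int -> int) m : R := \sum_(e <- take m es) (c e)%:~R.

Let qes : all quadrant_edge es. Proof. by case: sC => /andP[]. Qed.

(** [low_sector] is closed downward in slope, so its edges come first in the chain: the sums [W]
    over sectors are coordinates of vertices, to which [vertex_estimate] applies. *)
Let WV c j : (j <= J)%N -> W c j = V c (count (fun e => low_sector J j (absedge e)) es).
Proof.
move=> jJ; rewrite /W /V -big_filter (@filter_prefix _ _ _ _ slope_sorted_trans)//.
  by move=> e f /(allP qes) qe /(allP qes) qf; exact: low_sector_downward.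
by case: sC => /andP[].
Qed.

Let V_homo c m m' : (forall e, quadrant_edge e -> 0 <= c e) -> (m <= m')%N -> V c m <= V c m'.
Proof.
move=> c0 mm; rewrite /V -(subnKC mm) takeD big_cat/= lerDl big_seq sumr_ge0// => e /mem_take/mem_drop.
by move=> /(allP qes)/c0; rewrite ler0z.
Qed.

Let len : n%:R <= \sum_(e <- es) (elen e : R) <= n.+1%:R.
Proof. by case: sC => _ _ [h1 h2]; apply/andP. Qed.

Let est1 j : (j <= J)%N -> `|a * W fst j - sin (j%:R * h)| <= 3 * pi * h.
Proof.
apply: (vertex_estimate J0 n0 qes len short (f := cos)) => //.
- by move=> e i iJ qe /(cone_direction iJ qe)[].
- by move=> x; exact: cos_max.
- exact: cos_lip.
- exact: sin0.
Qed.

Let est2 j : (j <= J)%N -> `|a * W snd j - (1 - cos (j%:R * h))| <= 3 * pi * h.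
Proof.
apply: (vertex_estimate J0 n0 qes len short (f := sin) (F := fun x => 1 - cos x)) => //.
- by move=> e i iJ qe /(cone_direction iJ qe)[].
- by move=> x; exact: sin_max.
- exact: sin_lip.
- move=> x; have := is_deriveB (is_derive_cst (1 : R) x 1) (is_derive_cos x).
  by rewrite sub0r opprK.
- by rewrite cos0 subrr.
Qed.

Let curveE (p : R * R) : chain_curve s p = polyline (to_plane (0, 0)) (map to_plane s) p.
Proof. by []. Qed.

Lemma curve_near_arc (p : R * R) : chain_curve s p -> exists2 q, circle_arc q &
  norm2 ((a * p.1, a * p.2) - q) <= 2 * ((1 + 3 * pi) * h).
Proof.
have pi0 := pi_gt0 R; have h0 := @step_gt0 R _ J0.
have nr : 0 < n%:R :> R by rewrite ltr0n.
have a0 : 0 < a by rewrite divr_gt0// mulr_gt0.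
rewrite curveE => /polyline_between[].
  by apply/allP => e /(allP qes)/and3P[_ -> ->].
move=> m; rewrite !add0r -!/(V _ _) => -[/andP[x0 x1] /andP[y0 y1]].
(* The largest j whose sector ends at or before vertex m. The point then lies, in each coordinate,
   between the vertices ending sectors j and j + 1, whose rescalings are within 3 pi h of arc points
   that are h apart. *)
have [j jJ [jm mj]] : exists2 j, (j < J)%N &
    (count (fun e => low_sector J j (absedge e)) es <= m)%N /\
    forall c, (forall e, quadrant_edge e -> 0 <= c e) -> V c m.+1 <= W c j.+1.
  have ex : exists i, (i < J)%N && (count (fun e => low_sector J i (absedge e)) es <= m)%N.
    by exists 0%N; rewrite J0 (eq_count (a2 := pred0)) ?count_pred0// => e; rewrite low_sector0.
  have [|j /andP[jJ jm] mx] := @ex_maxnP _ J ex; first by move=> i /andP[/ltnW].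
  exists j => //; split=> // c c0; rewrite WV//; have [jJ'|jJ'] := ltnP j.+1 J.
    by apply: V_homo => //; rewrite ltnNge; apply/negP => le; have := mx j.+1; rewrite jJ' le ltnn => /(_ isT).
  have -> : j.+1 = J by apply/eqP; rewrite eqn_leq jJ.
  rewrite -WV// /W sum_low_sectorJ// /V -[in leRHS](cat_take_drop m.+1 es) big_cat/= lerDl.
  by rewrite big_seq sumr_ge0// => e /mem_drop/(allP qes)/c0; rewrite ler0z.
have F1 e : quadrant_edge e -> 0 <= e.1 by case/and3P.
have F2 e : quadrant_edge e -> 0 <= e.2 by case/and3P.
have /andP[t0 t1] := @step_le R _ J0 _ (ltnW jJ).
pose t := j%:R * h.
exists (sin t, 1 - cos t).
  have c0 : 0 <= cos t by rewrite cos_ge0_quadrant// t0.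
  have s0 : 0 <= sin t by rewrite sin_ge0_quadrant// t0.
  split=> /=; first by rewrite s0 sin_le1.
    by rewrite subr_ge0 cos_le1 lerBlDr lerDl.
  by rewrite -(cos2Dsin2 t); ring.
have S : j.+1%:R * h = t + h by rewrite -natr1 mulrDl mul1r.
have l1 : W fst j <= p.1 by apply: le_trans x0; rewrite WV 1?ltnW//; exact: V_homo.
have l2 : W snd j <= p.2 by apply: le_trans y0; rewrite WV 1?ltnW//; exact: V_homo.
have u1 : p.1 <= W fst j.+1 by apply: le_trans x1 _; exact: mj.
have u2 : p.2 <= W snd j.+1 by apply: le_trans y1 _; exact: mj.
have := est1 (ltnW jJ); have := est1 jJ; have := est2 (ltnW jJ); have := est2 jJ.
rewrite S -/t; have := sin_lip (t + h) t; have := cos_lip (t + h) t.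
rewrite addrAC subrr add0r (gtr0_norm h0).
have := ler_wpM2l (ltW a0) l1; have := ler_wpM2l (ltW a0) l2.
have := ler_wpM2l (ltW a0) u1; have := ler_wpM2l (ltW a0) u2.
move=> {x0 x1 y0 y1 mj l1 l2 u1 u2} u2 u1 l2 l1.
rewrite !ler_norml => /andP[? ?] /andP[? ?] /andP[? ?] /andP[? ?] /andP[? ?] /andP[? ?].
apply: norm2_le => /=; rewrite ler_norml; apply/andP; split; lra.
Qed.

(** Parametrize the arc as (sin t, 1 - cos t), round t down to a multiple j h and take the vertex
    that ends sector j. *)
Lemma arc_near_curve (q : R * R) : circle_arc q -> exists2 p, chain_curve s p &
  norm2 (q - (a * p.1, a * p.2)) <= 2 * ((1 + 3 * pi) * h).
Proof.
have pi0 := pi_gt0 R; have h0 := @step_gt0 R _ J0.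
move=> [/andP[q1 q1'] /andP[q2 q2'] qq].
have [||| t /andP[t0 t1] [qc qs]] := @polar_quadrant R (1 - q.2) q.1.
- by rewrite subr_ge0.
- by [].
- by rewrite -sqrrN opprB addrC.
pose j := Num.truncn (t / h).
have th0 : 0 <= t / h by exact: divr_ge0 t0 (ltW h0).
have /andP[j1 j2] := truncn_itv th0.
have jJ : (j <= J)%N.
  rewrite -(ler_nat R); apply: le_trans j1 _; rewrite ler_pdivrMr// stepJ//.
rewrite ler_pdivlMr// in j1; rewrite ltr_pdivrMr// -natr1 mulrDl mul1r in j2.
exists (W fst j, W snd j).
  by rewrite curveE !WV//; have := @polyline_vertex R (0, 0) s (count (fun e => low_sector J j (absedge e)) es); rewrite /= !add0r.
have := est1 jJ; have := est2 jJ.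
have := sin_lip t (j%:R * h); have := cos_lip t (j%:R * h).
rewrite (ger0_norm (_ : 0 <= t - j%:R * h)); last by rewrite subr_ge0.
rewrite -qc -qs !ler_norml => /andP[? ?] /andP[? ?] /andP[? ?] /andP[? ?].
apply: norm2_le => /=; rewrite ler_norml; apply/andP; split; lra.
Qed.

Lemma hausdorff_bound :
  (hausdorff_dist (rescale a (chain_curve s)) circle_arc <= (2 * ((1 + 3 * pi) * h))%:E)%E.
Proof.
rewrite /hausdorff_dist ge_max; apply/andP; split; apply: ge_ereal_sup => _ [p Pp <-].
  case: Pp => r /curve_near_arc[q arcq le] <-.
  by apply: le_trans (ereal_inf_lbound _) _; [exists q; [exact: arcq|reflexivity]|rewrite lee_fin].
have [r Cr le] := arc_near_curve Pp.
by apply: le_trans (ereal_inf_lbound _) _; [exists (a * r.1, a * r.2); [exists r|reflexivity]|rewrite lee_fin].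
Qed.

End HausdorffBound.
End HausdorffDistance.

(** * Limit shape *)

Section LimitShape.
Context {R : realType}.
Local Notation dprim := (@dprim R).
Local Notation rt := (@rt R).
Local Notation step := (@step R).
Local Notation cone := (@cone R).

Lemma dens_prim_cone J j : (j < J)%N -> dens [pred v | prim v & cone J j v] (dprim / J%:R).
Proof.
move=> jJ; have J0 : (0 < J)%N by case: J jJ.
have Jr : 0 < J%:R :> R by rewrite ltr0n.
have z0 := @zeta2_gt0 R; have h0 := @step_gt0 R _ J0.
have nz : ~~ cone J j (0, 0)%N.
  by rewrite negb_and; apply/orP; left; apply/negP => /(low_sector_neq0); rewrite eqxx.
have := @dens_prim R _ _ (@scale_invariant_cone R J j) nz
  (ltW (divr_gt0 h0 (ltr0n _ 2))) (dens_cone J0 jJ).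
rewrite (_ : step J / 2 / zeta 2 = dprim / J%:R); last first.
  by rewrite /step /dprim; field; rewrite !gt_eqF.
by apply: eq_dens => v /=; rewrite andbC.
Qed.

Lemma dens_prim_coneC J j : (j < J)%N ->
  dens [pred v | prim v & ~~ cone J j v] (dprim - dprim / J%:R).
Proof.
move=> jJ; have sub v : [pred v | prim v & cone J j v] v -> [pred v | prim v & v != (0, 0)%N] v.
  by move=> /andP[pv /andP[/(low_sector_neq0) nz _]]; apply/andP.
apply: eq_dens (dens_diff dens_allprim (dens_prim_cone jJ) sub) => v /=.
by case: (eqVneq v (0, 0)%N) => [->//|_]; rewrite andbT; case: (prim v).
Qed.

Lemma cvg_expRN_rt2 (g : R) : 0 < g -> expR (- (g * rt n ^+ 2)) @[n --> \oo] --> (0 : R).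
Proof.
move=> g0; have c : g^-1 * (rt n)^-1 @[n --> \oo] --> (g^-1 * 0 : R) by apply: cvgMr; exact: cvg_rtV.
rewrite mulr0 in c; apply: squeeze_cvgr (cvg_cst (0 : R)) c.
apply: nearW => n; rewrite expR_ge0/= expRN -invfM.
have r1 := @rt_ge1 R n; have r0 := @rt_gt0 R n.
rewrite lef_pV2 ?posrE ?expR_gt0 ?mulr_gt0//.
apply: le_trans (expR_ge1Dx _); have : rt n <= rt n ^+ 2 by rewrite expr2 ler_peMl// ltW.
move=> /(ler_wpM2l (ltW g0)); set u := g * _; set v := g * _; lra.
Qed.

Section Sequence.
Variables (l : R) (k : nat -> nat).
Hypotheses (l0 : 0 < l) (hk : (k n)%:R / rt n ^+ 2 @[n --> \oo] --> kap l).

Definition long_chains J j (dl : R) n : set (seq (int * int)) :=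
  [set s | chains R n (k n) s /\ (J%:R^-1 + dl) * n%:R <= seclen (cone J j) s].

(** Cone j contains the share 1 / J of the primitive vectors, so [few_long_sectors] lowers the
    exponent by [ga] in the numerator, while [chains_card_lower] loses only ga / 2 in the
    denominator. *)
Lemma cvg_long_chains J j (dl : R) : (j < J)%N -> 0 < dl ->
  #|` fset_set (long_chains J j dl n)|%:R / (pJ R n (k n))%:R @[n --> \oo] --> (0 : R).
Proof.
move=> jJ dl0; have d0 := @dprim_gt0 R.
have J0 : (0 < J)%N by case: J jJ.
have Jr : 1 <= J%:R :> R by rewrite ler1n.
have Jr0 : 0 < J%:R :> R by rewrite ltr0n.
have c1 : 0 <= dprim / J%:R <= dprim.
  by rewrite (divr_ge0 (ltW d0) (ltW Jr0))/= ler_pdivrMr// ler_peMr// ltW.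
have [ga ga0 H] := few_long_sectors l0 hk (@scale_invariant_cone R J j) c1 dl0
  (dens_prim_cone jJ) (dens_prim_coneC jJ).
have g2 : 0 < ga / 2 by rewrite divr_gt0.
apply: squeeze_cvgr (cvg_cst (0 : R)) (cvg_expRN_rt2 g2).
have lo := chains_card_lower l0 hk g2.
near=> n; rewrite divr_ge0//=.
have p1 : expR ((ent l - ga / 2) * rt n ^+ 2) <= (pJ R n (k n))%:R by near: n.
have p0 : 0 < (pJ R n (k n))%:R :> R by apply: lt_le_trans p1; exact: expR_gt0.
rewrite ler_pdivrMr//.
apply: (@le_trans _ _ (expR ((ent l - ga) * rt n ^+ 2))).
  have : forall C : set (seq (int * int)), C `<=` chains R n (k n) ->
    (forall s, C s -> (dprim / J%:R / dprim + dl) * n%:R <= seclen (cone J j) s) ->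
    #|` fset_set C|%:R <= expR ((ent l - ga) * rt n ^+ 2) :> R by near: n.
  apply; first by move=> s [].
  by move=> s [_]; rewrite mulrAC divff ?gt_eqF// mul1r.
apply: le_trans (ler_wpM2l (expR_ge0 _) p1).
by rewrite -expRD ler_expR; set r := rt n ^+ 2; lra.
Unshelve. all: end_near. Qed.

Lemma card_bigcup_le (T : choiceType) (A : set T) (C : nat -> set T) J :
  finite_set A -> (forall j, C j `<=` A) ->
  (#|` fset_set (\bigcup_(j < J) C j)| <= \sum_(j < J) #|` fset_set (C j)|)%N.
Proof.
move=> fA CA; have fC j : finite_set (C j) by exact: sub_finite_set (CA j) fA.
elim: J => [|J ih]; first by rewrite big_ord0 (_ : \bigcup_(j < 0) C j = set0) ?fset_set0 ?cardfs0// -subset0 => x [].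
rewrite big_ord_recr/=.
have -> : \bigcup_(j < J.+1) C j = (\bigcup_(j < J) C j) `|` C J.
  apply/seteqP; split=> [x [j]|x [[j jJ Cx]|Cx]].
  - by rewrite /= ltnS leq_eqVlt => /orP[/eqP -> ?|jJ Cx]; [right|left; exists j].
  - by exists j => //=; exact: ltnW.
  - by exists J => /=.
have fU : finite_set (\bigcup_(j < J) C j) by apply: sub_finite_set fA => x [j _ /CA].
rewrite fset_setU// cardfsU; apply: leq_trans (leq_subr _ _) _; exact: leq_add.
Qed.

Lemma cvg_uniform_pr (E : nat -> set (seq (int * int))) J (dl : R) : 0 < dl ->
  (\forall n \near \oo, chains R n (k n) `&` E n `<=` \bigcup_(j < J) long_chains J j dl n) ->
  uniform_pr (chains R n (k n)) (E n) @[n --> \oo] --> (0 : R).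
Proof.
move=> dl0 HE.
have c : \sum_(j < J) (#|` fset_set (long_chains J j dl n)|%:R / (pJ R n (k n))%:R) @[n --> \oo] -->
    (\sum_(j < J) 0 : R).
  by apply: cvg_big => [|j _]; [exact: add_continuous|exact: cvg_long_chains].
rewrite big1// in c; apply: squeeze_cvgr (cvg_cst (0 : R)) c.
near=> n; rewrite /uniform_pr divr_ge0//= -mulr_suml ler_wpM2r ?invr_ge0//.
rewrite -natr_sum ler_nat; have fA := @finite_chains R n (k n).
have CA j : long_chains J j dl n `<=` chains R n (k n) by move=> s [].
apply: leq_trans (card_bigcup_le J fA CA).
have sub : chains R n (k n) `&` E n `<=` \bigcup_(j < J) long_chains J j dl n by near: n.
apply: fsubset_leq_card; rewrite -fset_set_sub//.
  by apply: sub_finite_set fA => s [].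
by apply: sub_finite_set fA => s [j _ []].
Unshelve. all: end_near. Qed.

End Sequence.
End LimitShape.

Theorem theorem6 (R : realType) (l : R) (hl : 0 < l) (k : nat -> nat)
    (hk : (fun n : nat => (k n)%:R / n%:R `^ (2 / 3)) @ \oo
            --> pi `^ (1 / 3) / 2 * c_param l) :
  (fun n : nat => 1 / n%:R `^ (2 / 3) * ln (pJ R n (k n))%:R) @ \oo
    --> pi `^ (1 / 3) / 2 * e_entropy l
  /\
  (forall eps : R, 0 < eps ->
    (fun n : nat => uniform_pr (chains R n (k n))
       [set s | (eps%:E < hausdorff_dist
                            (rescale (pi / (2 * n%:R)) (chain_curve s))
                            circle_arc)%E]) @ \oo
      --> (0 : R)).
Proof.
have hk' : (k n)%:R / rt n ^+ 2 @[n --> \oo] --> kap l.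
  apply: cvg_trans hk; apply: near_eq_cvg; near=> n.
  by rewrite rtX2//; near: n; exact: near_gt0.
split.
  apply: cvg_trans (cvg_entropy hl hk'); apply: near_eq_cvg; near=> n.
  by rewrite rtX2 1?mul1r 1?mulrC//; near: n; exact: near_gt0.
move=> eps eps0; have pi0 := pi_gt0 R.
(* Chosen so that the bound 2 (1 + 3 pi) h of [hausdorff_bound], which is (1 + 3 pi) pi / J for h =
   pi / (2 J), is below eps. *)
pose J := (Num.truncn (4 * (1 + 3 * pi) * pi / eps)).+1.
have J0 : (0 < J)%N by [].
have h0 := @step_gt0 R _ J0.
have Jr : 0 < J%:R :> R by rewrite ltr0n.
have small : 2 * ((1 + 3 * pi) * step J) <= eps.
  have : 4 * (1 + 3 * pi) * pi / eps < J%:R by exact: truncnS_gt.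
  rewrite ltr_pdivrMr// /step => lt.
  rewrite (_ : 2 * _ = (4 * (1 + 3 * pi) * pi) / J%:R / 4); last by field; rewrite gt_eqF.
  rewrite ler_pdivrMr// ler_pdivrMr//; apply: le_trans (ltW lt) _.
  by have := mulr_gt0 Jr eps0; lra.
(* The excess is h / J, the tolerance per cone of [hausdorff_bound]: a chain far from the arc must
   exceed it in one of the J cones. *)
apply: (cvg_uniform_pr hl hk' (J := J) (divr_gt0 h0 Jr)).
near=> n; have n0 : (0 < n)%N by near: n; exact: near_gt0.
move=> s [sC /= big]; apply: contrapT => nlong.
have short j : (j < J)%N -> @seclen R (@cone R J j) s <= (J%:R^-1 + step J / J%:R) * n%:R.
  by move=> jJ; rewrite leNgt; apply/negP => lt; apply: nlong; exists j; [exact: jJ|split; [exact: sC|exact: ltW lt]].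
have := lt_le_trans big (hausdorff_bound J0 n0 sC short).
by rewrite lte_fin ltNge small.
Unshelve. all: end_near. Qed.
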